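(* For every constant $c>0$ there exists an increasing sequence of real numbers $(x_n)_{n\ge1}$ with $x_{n+1}-x_n\ge1$ for all $n$, such that, with $\gamma_N=\frac{\log N\,(\log\log N)^{1+c}}{N}$, $E_{N,\gamma_N}\gg N^3$, and such that for Lebesgue-almost every $\alpha\in\mathbb{R}$ the sequence $(\alpha x_n)_{n\ge1}$ has Poissonian $k$-level correlation for every integer $k\ge2$.
   Context: For a real sequence $(x_n)$, $N\ge1$ and $\gamma>0$, the additive energy at scale $\gamma$ is $E_{N,\gamma}=\#\{1\le a,b,c,d\le N : |x_a+x_b-x_c-x_d|<\gamma\}$. For an integer $k\ge2$, let $\mathcal{X}_k(N)$ be the set of $k$-tuples $(a_1,\dots,a_k)$ of distinct integers in $\{1,\dots,N\}$. For $s=(s_1,\dots,s_{2k-2})\in\mathbb{R}^{2k-2}$ with $s_{2i-1}<s_{2i}$ for $1\le i<k$, let $\mathbb{1}_{s,N}(y_1,\dots,y_{k-1})$ be the indicator that for each $i$, $y_i$ lies modulo 1 in the interval $[s_{2i-1}/N,s_{2i}/N]$ (i.e. $y_i\in[s_{2i-1}/N,s_{2i}/N]+\mathbb{Z}$). A real sequence $(y_n)$ has Poissonian $k$-level correlation if for every such $s$, $$\lim_{N\to\infty}\frac1N\sum_{a\in\mathcal{X}_k(N)}\mathbb{1}_{s,N}(y_{a_1}-y_{a_2},y_{a_1}-y_{a_3},\dots,y_{a_1}-y_{a_k})=\prod_{i=1}^{k-1}(s_{2i}-s_{2i-1}).$$ *)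

(* Defs.v *)
From HB Require Import structures.
From mathcomp Require Import all_boot all_order all_algebra.
From mathcomp Require Import all_classical all_reals all_analysis.
Set Implicit Arguments. Unset Strict Implicit. Unset Printing Implicit Defensive.
Import Order.TTheory GRing.Theory Num.Theory.
Import numFieldNormedType.Exports.
Local Open Scope classical_set_scope.
Local Open Scope ring_scope.

(* Sequences are x : nat -> R and only the values x 1, x 2, ... matter.
   An index i : 'I_N stands for the integer i+1 in {1,...,N}. *)

Definition add_energy {R : realType} (x : nat -> R) (N : nat) (gamma : R) : nat :=
  #|[set t : 'I_N * 'I_N * 'I_N * 'I_N |
      `| x t.1.1.1.+1 + x t.1.1.2.+1 - x t.1.2.+1 - x t.2.+1 | < gamma]|.

Definition in_mod1 {R : realType} (y lo hi : R) : Prop :=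
  exists m : int, lo <= y - m%:~R <= hi.

Definition corr_count {R : realType} (k' : nat) (y : nat -> R) (lo hi : 'I_k' -> R)
    (N : nat) : R :=
  \sum_(a : {ffun 'I_k'.+1 -> 'I_N} | injectiveb a &&
        `[< forall i : 'I_k',
              in_mod1 (y (a ord0).+1 - y (a (lift ord0 i)).+1)
                      (lo i / N%:R) (hi i / N%:R) >]) 1.

(* Poissonian k-level correlation (meaningful for k >= 2): s is given as the
   pairs (lo i, hi i) = (s_{2i-1}, s_{2i}), i = 1..k-1. *)
Definition poissonian_corr {R : realType} (k : nat) (y : nat -> R) : Prop :=
  forall lo hi : 'I_k.-1 -> R, (forall i, lo i < hi i) ->
    (fun N : nat => corr_count y lo hi N / N%:R) @ \oo
      --> \prod_(i < k.-1) (hi i - lo i).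

Definition gammaN {R : realType} (c : R) (N : nat) : R :=
  ln (N%:R) * (ln (ln (N%:R))) `^ (1 + c) / N%:R.

(* Main.v *)
Require Import Defs.
From HB Require Import structures.
From mathcomp Require Import all_boot all_order all_algebra.
From mathcomp Require Import all_classical all_reals all_analysis measurable_realfun.
From mathcomp Require Import ring lra zify.
Set Implicit Arguments. Unset Strict Implicit. Unset Printing Implicit Defensive.
Import Order.TTheory GRing.Theory Num.Theory.
Import numFieldNormedType.Exports.
Local Open Scope classical_set_scope.
Local Open Scope ring_scope.

(** Take x_n = 2n + xi_n, where xi_n is a random perturbation of size
    w(n) ~ log n (log log n)^(1 + 2c/3) / n, constant on dyadic blocks.  As w(N) is
    smaller than gamma_N, every solution of a + b = c + d in a dyadic block counts for the
    additive energy.  For almost every alpha one has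
    |h alpha - p| >> 1 / (h log h (log log h)^(1 + c/3)) for all large h, so
    Dirichlet's theorem gives a denominator q with N/q much smaller than N w(N), and the
    multiples of alpha are equidistributed in arcs of length alpha w(N).  The expected
    number of points alpha x_b in an arc of length s/N, averaged over the
    perturbations, is then s + o(1); independence turns this into convergence of the mean
    of the k-level correlation, with a variance O(1/N) since only pairs of tuples sharing
    an index contribute.  Summing the variances over N = m^2 handles almost every
    perturbation, and monotonicity fills the gaps between consecutive squares.  The
    perturbations are finite-valued, xi_n = w(n) u_n / Q_n with a digit 0 <= u_n < Q_n, so
    that all expectations are finite averages, and a digit sequence good for almost every
    alpha is chosen greedily. *)

(** * Points of an irrational rotation in short arcs *)

(** The energy wants small perturbations and the correlations want large ones. The exponents
    [1 + s < 1 + 2 * s < 1 + 3 * s] with [s = c / 3] leave room between the two demands: the first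
    makes Borel-Cantelli converge, the second is the width, the third is that of [gammaN], and each
    gap supplies an unbounded factor, a power [s] of the double logarithm, which absorbs constants
    depending on alpha. A constant width on a dyadic block means that all its points are tested
    against arcs of one length, so a single discrepancy estimate serves the block. The other
    obstacle is the order of quantifiers: one digit sequence must serve almost every alpha, all [k]
    and all windows. Rational windows leave countably many tests. Their squared deviations,
    integrated over sets of alpha of finite measure and suitably weighted, combine into one
    increasing family of functions of finitely many digits with a common bound on the averages, and
    a single choice of digits can keep that bound. *)

Definition in_arc {R : realType} (x l : R) : bool := `[< in_mod1 x 0 l >].

Lemma in_arcP {R : realType} (x l : R) :
  reflect (exists m : int, 0 <= x - m%:~R <= l) (in_arc x l).
Proof. exact: asboolP. Qed.

Lemma in_arcDint {R : realType} (x l : R) (m : int) :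
  in_arc (x + m%:~R) l = in_arc x l.
Proof.
apply/in_arcP/in_arcP => -[k hk].
- by exists (k - m); rewrite rmorphB /=; lra.
- by exists (k + m); rewrite rmorphD /=; lra.
Qed.

Lemma in_arc_sub {R : realType} (x x' l l' : R) :
  x <= x' -> x' - x <= l' - l -> in_arc x l -> in_arc x' l'.
Proof. by move=> h1 h2 /in_arcP[m hm]; apply/in_arcP; exists m; lra. Qed.

Lemma count_ord_ge {R : realType} (a : R) (Q : nat) :
  \sum_(d < Q) (a <= d%:R)%R%:R <= Num.max 0 (Q%:R - a).
Proof.
elim: Q => [|Q IH]; first by rewrite big_ord0 le_max lexx.
rewrite big_ord_recr /= le_max; move: IH; rewrite le_max -natr1.
by case: (leP a Q%:R) => h /= /orP[h'|h'] ; apply/orP; (try by left; lra); right; lra.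
Qed.

Lemma count_ord_itv_le {R : realType} (a l : R) (Q : nat) : 0 <= l ->
  \sum_(d < Q) (a <= d%:R <= a + l)%R%:R <= l + 1.
Proof.
move=> l0; elim: Q => [|Q IH]; first by rewrite big_ord0; lra.
rewrite big_ord_recr /=; have [/andP[h1 h2]|_] := boolP (a <= Q%:R <= a + l);
  last by rewrite addr0.
apply: lerD => //; apply: (@le_trans _ _ (\sum_(d < Q) (a <= d%:R)%R%:R)).
  by apply: ler_sum => i _; rewrite ler_nat; case: (a <= i%:R); case: (i%:R <= a + l).
apply: (le_trans (count_ord_ge a Q)).
by rewrite ge_max l0 /=; lra.
Qed.

Lemma count_ord_itv_ge {R : realType} (a b : R) (Q : nat) : -1 <= a ->
  Num.min Q%:R b - a - 1 <= \sum_(d < Q) (a <= d%:R <= b)%R%:R.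
Proof.
move=> a1; elim: Q => [|Q IH].
  by rewrite big_ord0 -addrA -opprD subr_le0 ge_min; apply/orP; left; lra.
rewrite big_ord_recr /= -natr1.
have s0 : 0 <= \sum_(d < Q) ((a <= d%:R) && (d%:R <= b))%R%:R :> R by apply: sumr_ge0.
move: IH; rewrite !lerBlDr !ge_min.
case: (leP a Q%:R) => h1 /=; case: (leP Q%:R b) => h2 /= /orP[h|h]; apply/orP;
  (try by left; lra); right; lra.
Qed.

Lemma arc_grid_le {R : realType} (q : nat) (l t : R) : (0 < q)%N -> 0 <= l ->
  0 <= t < 1 -> \sum_(k < q) (in_arc ((k%:R + t) / q%:R) l)%:R <= q%:R * l + 1.
Proof.
move=> q0 l0 t01; have q0' : 0 < q%:R :> R by rewrite ltr0n.
case: (leP 1 l) => l1.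
  apply: (@le_trans _ _ (\sum_(k < q) 1)).
    by apply: ler_sum => k _; rewrite lern1 leq_b1.
  by rewrite sumr_const card_ord; have := ler_pM2l q0' 1 l; rewrite l1; lra.
apply: le_trans (@count_ord_itv_le _ (- t) (q%:R * l) q _); last first.
  by apply: mulr_ge0 => //; apply: ltW.
apply: ler_sum => k _; rewrite ler_nat.
case: (boolP (in_arc _ _)) => // /in_arcP[m] /andP[h1 h2].
have hk : k%:R + 1 <= q%:R :> R by rewrite natr1 ler_nat.
have k0 : 0 <= k%:R :> R by [].
have m1 : m%:~R < 1 :> R.
  apply: (@le_lt_trans _ _ ((k%:R + t) / q%:R)); first by rewrite -subr_ge0.
  by rewrite ltr_pdivrMr // mul1r; lra.
have m2 : - 1 < m%:~R :> R.
  have : 0 <= (k%:R + t) / q%:R by apply: divr_ge0; lra.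
  lra.
have m0 : m = 0.
  have : (m < 1)%R by rewrite -(@ltr_int R).
  have : (- 1 < m)%R by rewrite -(@ltr_int R).
  by clear; lia.
move: h2; rewrite m0 subr0 ler_pdivrMr // => h2.
suff -> : - t <= k%:R <= - t + q%:R * l by [].
by apply/andP; split; lra.
Qed.

Lemma arc_grid_ge {R : realType} (q : nat) (l t : R) : (0 < q)%N -> l <= 1 ->
  0 <= t < 1 -> q%:R * l - 1 <= \sum_(k < q) (in_arc ((k%:R + t) / q%:R) l)%:R.
Proof.
move=> q0 l1 t01; have q0' : 0 < q%:R :> R by rewrite ltr0n.
have ql : q%:R * l <= q%:R by rewrite -{2}[q%:R]mulr1 ler_pM2l.
apply: (@le_trans _ _ (\sum_(k < q) (- t <= k%:R <= q%:R * l - t)%R%:R)).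
  apply: le_trans (count_ord_itv_ge _ _ _); last lra.
  by rewrite -addrA -opprD lerBrDr le_min; apply/andP; split; lra.
apply: ler_sum => k _; rewrite ler_nat.
case: (boolP (_ <= _ <= _)) => // /andP[h1 h2].
suff -> : in_arc ((k%:R + t) / q%:R) l by [].
apply/in_arcP; exists 0; rewrite subr0 ler_pdivrMr //.
rewrite divr_ge0 //=; lra.
Qed.

(** Multiplication by [p] permutes the residues modulo [q]. The floor [c] of [- q z] only shifts the
    residues, so the permutation absorbs it, and the fractional part of [- q z] remains as [t]. *)
Lemma coprime_run {R : realType} (q : nat) (p : int) (z : R) (F : R -> R) :
  (0 < q)%N -> coprimez p q -> (forall (x : R) (m : int), F (x + m%:~R) = F x) ->
  exists t : R, 0 <= t < 1 /\
   \sum_(i < q) F (i%:R * p%:~R / q%:R - z) = \sum_(k < q) F ((k%:R + t) / q%:R).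
Proof.
move=> q0 cpq Fper; have q0' : q%:R != 0 :> R by rewrite pnatr_eq0 -lt0n.
have qz0 : (q : int) != 0 by rewrite eqz_nat -lt0n.
set w := - (q%:R * z); pose c := Num.floor w.
exists (w - c%:~R); split.
  have := floor_le_tmp w; have := floorD1_gt w.
  by rewrite -/c rmorphD /= => h1 h2; apply/andP; split; lra.
have kP (i : nat) : (`|((p * i + c) %% q)%Z| < q)%N.
  by rewrite -ltz_nat gez0_abs ?modz_ge0 // ltz_pmod.
pose kk (i : 'I_q) := Ordinal (kP i).
have kinj : injective kk.
  move=> i j /(congr1 val) /= /(congr1 Posz).
  rewrite !gez0_abs ?modz_ge0 // => /eqP; rewrite eqz_mod_dvd.
  rewrite opprD addrACA subrr addr0 -mulrBr Gauss_dvdzr; last by rewrite coprimez_sym.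
  move=> hd; apply: val_inj => /=.
  have := ltn_ord i; have := ltn_ord j.
  case/dvdzP: hd => m hm hj hi.
  have : m = 0 by nia.
  by move=> m0; move: hm; rewrite m0 mul0r => /eqP; rewrite subr_eq0 => /eqP [].
rewrite [RHS](reindex_inj kinj) /=; apply: eq_bigr => i _.
have e := divz_eq (p * i + c) q.
set m := ((p * i + c) %/ q)%Z in e.
rewrite -[RHS](Fper _ m); congr F.
have -> : (`|((p * i + c) %% q)%Z|%N)%:R = ((p * i + c) %% q)%Z%:~R :> R.
  by rewrite pmulrn gez0_abs ?modz_ge0.
have -> : ((p * i + c) %% q)%Z = p * i + c - m * q by apply/eqP; rewrite eq_sym subr_eq [X in _ == X]addrC; apply/eqP.
rewrite !rmorphB !rmorphD !rmorphM /= /w -!pmulrn.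
by field.
Qed.

(* The points [i * b], [i < q], stay within [1/q] of a rotated copy of the grid [k/q]. *)
Lemma run_count {R : realType} (q : nat) (p : int) (b y l : R) :
  (0 < q)%N -> coprimez p q -> `|q%:R * b - p%:~R| <= q%:R^-1 -> 0 <= l <= 1 ->
  `|\sum_(i < q) (in_arc (i%:R * b - y) l)%:R - q%:R * l| <= 3.
Proof.
move=> q0 cpq; have q0' : 0 < q%:R :> R by rewrite ltr0n.
set e := q%:R^-1 => hb /andP[l0 l1].
have e0 : 0 < e by rewrite invr_gt0.
have qe : q%:R * e = 1 by rewrite mulfV ?gt_eqF.
have near (i : 'I_q) : `|i%:R * b - i%:R * p%:~R / q%:R| <= e.
  have -> : i%:R * b - i%:R * p%:~R / q%:R = (i%:R * e) * (q%:R * b - p%:~R).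
    by rewrite -[RHS]mulrA mulrBr mulrA [e * q%:R]mulrC qe mul1r -/e; ring.
  rewrite normrM -[leRHS]mul1r; apply: ler_pM => //.
  rewrite ger0_norm; last by rewrite mulr_ge0 // ltW.
  rewrite -[leRHS]qe ler_pM2r // ler_nat.
  by apply: ltnW; apply: ltn_ord.
have Fper (v x : R) (m : int) : (in_arc (x + m%:~R) v)%:R = (in_arc x v)%:R :> R.
  by rewrite in_arcDint.
(* A displacement of at most [e] is absorbed by shrinking the arc by [e] at both ends for the lower
   bound and widening it for the upper one. This changes [q l] by 2, and the grid count costs 1
   more, whence the 3. *)
rewrite ler_norml; apply/andP; split.
- have [t [t01 ht]] := @coprime_run R q p (y + e) _ q0 cpq (Fper (l - 2 * e)).
  have e1 := @arc_grid_ge R q (l - 2 * e) t q0 _ t01.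
  rewrite -ht in e1; have {e1} : q%:R * (l - 2 * e) - 1 <= \sum_(i < q) (in_arc (i%:R * b - y) l)%:R.
    apply: (le_trans (e1 _)); first by lra.
    apply: ler_sum => i _; rewrite ler_nat; have := near i.
    case: (boolP (in_arc (_ - (y + e)) _)) => // h1 h2.
    rewrite (in_arc_sub _ _ h1) //; move: h2; rewrite ler_norml; lra.
  by rewrite mulrBr mulrCA qe; lra.
- have [t [t01 ht]] := @coprime_run R q p (y - e) _ q0 cpq (Fper (l + 2 * e)).
  have e1 := @arc_grid_le R q (l + 2 * e) t q0 _ t01.
  rewrite -ht in e1; have {e1} : \sum_(i < q) (in_arc (i%:R * b - y) l)%:R <= q%:R * (l + 2 * e) + 1.
    apply: (le_trans _ (e1 _)); last by lra.
    apply: ler_sum => i _; rewrite ler_nat; have := near i.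
    case: (boolP (in_arc (_ - y) _)) => // h1 h2.
    rewrite (in_arc_sub _ _ h1) //; move: h2; rewrite ler_norml; lra.
  by rewrite mulrDr mulrCA qe; lra.
Qed.

(** The count is squeezed between those of [r] and [r + 1] complete runs of length [q], where [r] is
    the quotient of [M] by [q]: each run costs at most 3, and the incomplete one at most [q l]
    more. *)
Lemma block_count {R : realType} (q : nat) (p : int) (b y l : R) (A M : nat) :
  (0 < q)%N -> coprimez p q -> `|q%:R * b - p%:~R| <= q%:R^-1 -> 0 <= l <= 1 ->
  `|\sum_(A <= i < A + M) (in_arc (i%:R * b - y) l)%:R - M%:R * l|
    <= 3 * (M%:R / q%:R + 1) + q%:R * l.
Proof.
move=> q0 cpq hb l01; have q0' : 0 < q%:R :> R by rewrite ltr0n.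
pose g i : R := (in_arc (i%:R * b - y) l)%:R.
have g0 i : 0 <= g i by [].
have runs r : `|\sum_(A <= i < A + r * q) g i - (r * q)%:R * l| <= 3 * r%:R.
  elim: r => [|r IH]; first by rewrite mul0n addn0 big_geq // mul0r subr0 normr0 mulr0.
  rewrite mulSnr addnA (big_cat_nat (leq_addr _ _) (leq_addr _ _)) /=.
  have := @run_count R q p b (y - (A + r * q)%:R * b) l q0 cpq hb l01.
  have -> : \sum_(A + r * q <= i < A + r * q + q) g i =
      \sum_(i < q) (in_arc (i%:R * b - (y - (A + r * q)%:R * b)) l)%:R.
    set s := (A + r * q)%N; rewrite -{1}[s]add0n big_addn addKn big_mkord.
    by apply: eq_bigr => i _; rewrite /g natrD; congr (in_arc _ _)%:R; ring.
  move: IH; rewrite -[r.+1%:R]natr1 [(_ + q)%:R]natrD !ler_norml; lra.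
have hM := divn_eq M q; set r := (M %/ q)%N in hM.
have rq : r%:R <= M%:R / q%:R :> R.
  by rewrite ler_pdivlMr // -natrM ler_nat leq_trunc_div.
have Mlo : (r * q <= M)%N by apply: leq_trunc_div.
have Mhi : (M <= r.+1 * q)%N by rewrite ltnW // ltn_ceil.
have split N : (N <= M)%N -> \sum_(A <= i < A + M) g i =
   \sum_(A <= i < A + N) g i + \sum_(A + N <= i < A + M) g i.
  by move=> h; rewrite -big_cat_nat ?leq_add2l ?leq_addr.
have mono N N' : (N <= N')%N -> \sum_(A <= i < A + N) g i <= \sum_(A <= i < A + N') g i.
  move=> h; rewrite [leRHS](@big_cat_nat _ _ _ (A + N)) ?leq_add2l ?leq_addr //=.
  by rewrite lerDl; apply: sumr_ge0.
have h1 := mono _ _ Mlo; have h2 := mono _ _ Mhi.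
have h3 := runs r; have h4 := runs r.+1.
have l0 : 0 <= l by lra.
have h5 : (r * q)%:R * l <= M%:R * l by apply: ler_wpM2r => //; rewrite ler_nat.
have h6 : M%:R * l <= (r.+1 * q)%:R * l by apply: ler_wpM2r => //; rewrite ler_nat.
have h7 : (r.+1 * q)%:R = (r * q)%:R + q%:R :> R by rewrite mulSnr natrD.
by move: h3 h4 h6; rewrite h7 mulrDl -natr1 !ler_norml; lra.
Qed.

Lemma dirichlet {R : realType} (b : R) (n : nat) : (0 < n)%N ->
  exists (q : nat) (p : int),
    [/\ (0 < q <= n)%N, coprimez p q & `|q%:R * b - p%:~R| <= n%:R^-1].
Proof.
move=> n0; have n0' : 0 < n%:R :> R by rewrite ltr0n.
(* A fraction that is not reduced suffices: dividing [q] and [p] by their gcd [g] divides the error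
   by [g]. Such a fraction comes from the pigeonhole principle, with [n + 1] fractional parts in [n]
   boxes. *)
suff [q [p [/andP[q0 qn] h]]] : exists (q : nat) (p : int),
    (0 < q <= n)%N /\ `|q%:R * b - p%:~R| <= n%:R^-1.
  pose g := gcdz p q.
  have g0 : 0 < g by rewrite lt0r gcdz_eq0 negb_and -!lt0n orbC ?q0 // .
  have /dvdzP[q' hq] : (g %| Posz q)%Z by apply: dvdz_gcdr.
  have /dvdzP[p' hp] : (g %| p)%Z by apply: dvdz_gcdl.
  have q'0 : 0 < q' by nia.
  exists `|q'|%N, p'; split.
  - by apply/andP; split; nia.
  - have : g * gcdz p' q' = g * 1.
      have -> : g * gcdz p' q' = `|g|%:Z * gcdz p' q' by rewrite gtz0_abs.
      by rewrite mulz_gcdr !(mulrC g) -hq -hp mul1r.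
    move/(mulfI (lt0r_neq0 g0)) => h1; rewrite /coprimez gtz0_abs //; exact/eqP.
  - have e : `|q%:R * b - p%:~R| = g%:~R * `|(`|q'|%N)%:R * b - p'%:~R|.
      have gR : 0 <= g%:~R :> R by rewrite ler0z ltW.
      rewrite -[in RHS](ger0_norm gR) -normrM; congr `|_|.
      rewrite !pmulrn gtz0_abs // hq hp !rmorphM /=; ring.
    apply: le_trans h; rewrite e ler_peMl //.
    by rewrite -[1]/(1%:~R) ler_int; lia.
pose fr (i : nat) := i%:R * b - (Num.floor (i%:R * b))%:~R.
have frP i : 0 <= fr i < 1.
  have := floor_le_tmp (i%:R * b); have := floorD1_gt (i%:R * b).
  by rewrite rmorphD /= /fr => h1 h2; apply/andP; split; lra.
pose bx (i : nat) := `|Num.floor (n%:R * fr i)|%N.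
have bxR i : (bx i)%:R <= n%:R * fr i < (bx i)%:R + 1.
  have h0 : 0 <= n%:R * fr i by apply: mulr_ge0; [|case/andP: (frP i)].
  have h1 := floor_le_tmp (n%:R * fr i); have h2 := floorD1_gt (n%:R * fr i).
  rewrite /bx !pmulrn gez0_abs ?floor_ge0 //.
  by rewrite rmorphD in h2; rewrite h1.
have bxP i : (bx i < n)%N.
  rewrite -(ltr_nat R); apply: (@le_lt_trans _ _ (n%:R * fr i)).
    by case/andP: (bxR i).
  by rewrite gtr_pMr //; case/andP: (frP i).
pose f (i : 'I_n.+1) := Ordinal (bxP i).
have /injectivePn[i [j ij fij]] : ~~ injectiveb f.
  by apply/negP => /injectiveP/leq_card; rewrite !card_ord ltnn.
have {fij} hij : bx i = bx j by move/(congr1 val): fij.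
wlog lij : i j ij hij / (i < j)%N.
  move=> H; case: (ltngtP i j) => h; [exact: (H i j)|apply: (H j i) => //|].
    by rewrite eq_sym.
  by move: ij; rewrite (val_inj h) eqxx.
exists (j - i)%N, (Num.floor (j%:R * b) - Num.floor (i%:R * b)); split.
  by rewrite subn_gt0 lij /=; have := ltn_ord j; lia.
rewrite natrB ?(ltnW lij) // rmorphB /=.
have -> : (j%:R - i%:R) * b - ((Num.floor (j%:R * b))%:~R - (Num.floor (i%:R * b))%:~R)
   = fr j - fr i by rewrite /fr; ring.
rewrite -(ler_pM2l n0') mulfV ?gt_eqF // -[X in X * _](ger0_norm (ltW n0')) -normrM.
rewrite mulrBr ler_norml; have := bxR i; have := bxR j; rewrite hij; lra.
Qed.

(** The error is measured against arcs of length comparable to [w j]; the extra term [l] pays for an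
    incomplete run. Uniformity in [y] allows the arc to be placed relative to another perturbed
    point. *)
Definition equidistributed {R : realType} (w : nat -> R) (b : R) : Prop :=
  forall eta : R, 0 < eta -> exists j0 : nat, forall j A M (y l : R),
    (j0 <= j)%N -> (M <= 2 ^ j)%N -> 0 <= l <= 1 ->
    `|\sum_(A <= i < A + M) (in_arc (i%:R * b - y) l)%:R - M%:R * l|
      <= eta * 2 ^+ j * (w j + l).

(* Dirichlet's theorem provides [q] with [|q (2a) - p|] small; badness of
   approximation is applied to [h = 2 q h0] rather than [2 q], so that small
   values of [q] need no separate treatment. *)
Lemma equidistributed_of_badly_approx {R : realType} (w : nat -> R) (Psi : nat -> R)
    (a c0 : R) (h0 : nat) :
  0 < c0 -> (forall h, (h0 <= h)%N -> 0 < Psi h) ->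
  (forall h h', (h0 <= h <= h')%N -> Psi h <= Psi h') ->
  (forall h (p : int), (h0 <= h)%N -> c0 <= h%:R * Psi h * `|h%:R * a - p%:~R|) ->
  (forall B : R, exists j0 : nat, forall j, (j0 <= j)%N -> B * Psi (2 ^ j)%N <= 2 ^+ j * w j) ->
  equidistributed w (2 * a).
Proof.
move=> c00 Psi0 Psim bad grow eta eta0.
wlog h1 : h0 Psi0 Psim bad / (0 < h0)%N.
  move=> H; apply: (H h0.+1) => //.
  - by move=> h hh; apply: Psi0; apply: ltnW.
  - by move=> h h' /andP[hh hh']; apply: Psim; rewrite hh' (ltnW hh).
  - by move=> h p hh; apply: bad; apply: ltnW.
have h0R : 0 < h0%:R :> R by rewrite ltr0n.
(* Dirichlet's theorem will be applied at level [2 ^ (j - k)]. The spare factor [2 ^ k] ensures both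
   [2 q h0 <= 2 ^ j], so that [Psi] is at most [Psi (2 ^ j)] there, and [q <= eta * 2 ^ j]. *)
have [k [k1 k2]] : exists k, (2 * h0 <= 2 ^ k)%N /\ eta^-1 <= 2 ^+ k.
  pose m := maxn (2 * h0) (Num.bound eta^-1).
  exists m; have mk : (m <= 2 ^ m)%N by rewrite ltnW // ltn_expl.
  split; first by apply: leq_trans mk; apply: leq_maxl.
  apply: le_trans (ltW (archi_boundP _)) _; first by rewrite invr_ge0 ltW.
  by rewrite -natrX ler_nat; apply: leq_trans mk; apply: leq_maxr.
pose K : R := 2 ^+ k; have K0 : 0 < K by apply: exprn_gt0.
(* The 12 is [6 * 2]: the runs cost at most [6 * 2 ^ j / q], and badness gives [2 ^ j / q <= 2 * h0
   ^ 2 * K / c0 * Psi (2 ^ j)]. *)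
have [j1 hj1] := grow (12 * h0%:R ^+ 2 * K / (c0 * eta)).
exists (maxn j1 (k + h0)) => j A M y l; rewrite geq_max => /andP[/hj1 hB kj] Mj l01.
have jN : (2 ^ j = 2 ^ (j - k) * 2 ^ k)%N by rewrite -expnD subnK //; lia.
have jR : 2 ^+ j = 2 ^+ (j - k) * K :> R by rewrite /K -exprD subnK //; lia.
have n0 : (0 < 2 ^ (j - k))%N by rewrite expn_gt0.
have [q [p [/andP[q0 qn] cpq hq]]] := dirichlet (2 * a) n0.
have q0R : 0 < q%:R :> R by rewrite ltr0n.
have qnR : q%:R <= 2 ^+ (j - k) :> R by rewrite -natrX ler_nat.
have hq' : `|q%:R * (2 * a) - p%:~R| <= q%:R^-1.
  by apply: (le_trans hq); rewrite lef_pV2 ?posrE ?natrX ?exprn_gt0.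
apply: le_trans (block_count y A M q0 cpq hq' l01) _.
pose J : R := 2 ^+ j; have J0 : 0 < J by apply: exprn_gt0.
have MJ : M%:R <= J by rewrite /J -natrX ler_nat.
have qJ : q%:R <= eta * J.
  apply: (le_trans qnR); rewrite /J jR mulrCA ler_peMr ?exprn_ge0 //.
  by rewrite mulrC -ler_pdivrMr // mul1r.
have hq2 : (h0 <= 2 * q * h0 <= 2 ^ j)%N.
  rewrite mulnAC [X in (X <= _)%N && _](_ : h0 = 1 * h0)%N ?mul1n // jN [(2 * h0 * q)%N]mulnC.
  by rewrite leq_mul // andbT mulnA leq_pmull // muln_gt0 q0.
have [hlo hhi] := andP hq2.
have := bad (2 * q * h0)%N (p * h0) hlo.
set P := Psi _; have P0 : 0 < P by apply: Psi0.
have PJ : P <= Psi (2 ^ j)%N by apply: Psim.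
have -> : (2 * q * h0)%:R * a - (p * h0)%:~R = h0%:R * (q%:R * (2 * a) - p%:~R).
  by rewrite !natrM rmorphM /= -pmulrn; ring.
rewrite normrM (ger0_norm (ltW h0R)) => hc.
have {hc} hc : c0 <= (2 * q * h0)%:R * P * (h0%:R * (K / J)).
  apply: (le_trans hc); apply: ler_wpM2l; first by rewrite mulr_ge0 // ltW.
  rewrite ler_pM2l //.
  by apply: (le_trans hq); rewrite natrX /J jR invfM mulrCA mulfV ?mulr1 // gt_eqF.
have {hc} hJq : J / q%:R <= 2 * h0%:R ^+ 2 * K / c0 * Psi (2 ^ j)%N.
  have h1c : c0 * J <= 2 * h0%:R ^+ 2 * K * Psi (2 ^ j)%N * q%:R.
    apply: (@le_trans _ _ (2 * h0%:R ^+ 2 * K * P * q%:R)).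
      rewrite -ler_pdivlMr //; apply: (le_trans hc); rewrite !natrM le_eqVlt.
      by apply/orP; left; apply/eqP; ring.
    by rewrite ler_pM2r // ler_wpM2l // !mulr_ge0 ?exprn_ge0 // ltW.
  rewrite ler_pdivrMr //.
  have -> : 2 * h0%:R ^+ 2 * K / c0 * Psi (2 ^ j)%N * q%:R =
     2 * h0%:R ^+ 2 * K * Psi (2 ^ j)%N * q%:R / c0 by ring.
  by rewrite ler_pdivlMr // mulrC.
have h2 : M%:R / q%:R <= J / q%:R by rewrite ler_pM2r ?invr_gt0.
have h3 : 1 <= J / q%:R.
  rewrite ler_pdivlMr // mul1r; apply: (le_trans qnR); rewrite /J.
  by rewrite -!natrX ler_nat leq_exp2l // leq_subr.
have h4 : eta * (12 * h0%:R ^+ 2 * K / (c0 * eta) * Psi (2 ^ j)%N) =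
    6 * (2 * h0%:R ^+ 2 * K / c0 * Psi (2 ^ j)%N).
  by field; rewrite !gt_eqF.
move: hB; rewrite -(ler_pM2l eta0) h4 => hB.
have h5 : q%:R * l <= eta * J * l by apply: ler_wpM2r => //; case/andP: l01.
rewrite -/J in hB *; have -> : eta * J * (w j + l) = eta * (J * w j) + eta * J * l by ring.
by rewrite mulrDr; lra.
Qed.

(** * Perturbed points in short arcs *)

Definition hit {R : realType} (Y : nat -> nat -> R) (Q : nat -> nat) (b : nat) (v l : R) : R :=
  (\sum_(d < Q b) (in_arc (Y b d - v) l)%:R) / (Q b)%:R.

(* [hit Y Q b v l] is the probability that the [b]-th point, whose digit is uniform
   in [0, Q b), falls in the arc [v, v + l] modulo 1; arcs of length about [1/N] then
   contain on average the expected number of the first [N] points. *)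
Definition locally_uniform {R : realType} (Y : nat -> nat -> R) (Q : nat -> nat) : Prop :=
  forall eps S : R, 0 < eps -> 0 < S -> exists K N0 : nat, (0 < K)%N /\
  forall (N : nat) (v l : R), (N0 <= N)%N -> 0 <= l -> l * N%:R <= S ->
    `|\sum_(K <= b < N.+1) hit Y Q b v l - N%:R * l| <= eps /\
    (forall b, (K <= b <= N)%N -> hit Y Q b v l <= eps).

(* Any sizes with summable inverses would do; this one makes the sum telescope. *)
Definition grid (b : nat) : nat := b.+1 * b.+2.

Definition perturbed {R : realType} (w : nat -> R) (a : R) (b d : nat) : R :=
  a * (2 * b%:R + w (trunc_log 2 b) * (d%:R / (grid b)%:R)).

Lemma sum_grid_inv {R : realType} (K n : nat) : (K <= n)%N ->
  \sum_(K <= b < n) (grid b)%:R^-1 <= K.+1%:R^-1 :> R.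
Proof.
move=> Kn; suff -> : \sum_(K <= b < n) (grid b)%:R^-1 = K.+1%:R^-1 - n.+1%:R^-1 :> R.
  by rewrite gerBl invr_ge0.
elim: n Kn => [|n IH]; first by rewrite leqn0 => /eqP ->; rewrite big_geq // subrr.
rewrite leq_eqVlt => /orP[/eqP -> |]; first by rewrite big_geq // subrr.
rewrite ltnS => Kn; rewrite big_nat_recr //= IH // /grid natrM.
have : n.+2%:R != 0 :> R by rewrite pnatr_eq0.
have : n.+1%:R != 0 :> R by rewrite pnatr_eq0.
rewrite -(natr1 n.+1); move: n.+1%:R K.+1%:R^-1 => x y x0 x1.
by field; rewrite x0 x1.
Qed.

Lemma hit_ge0 {R : realType} (Y : nat -> nat -> R) Q b v l : 0 <= hit Y Q b v l.
Proof. by apply: divr_ge0 => //; apply: sumr_ge0. Qed.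

Lemma hit_le1 {R : realType} (Y : nat -> nat -> R) Q b v l : hit Y Q b v l <= 1.
Proof.
rewrite /hit; have [->|Q0] := posnP (Q b); first by rewrite big_ord0 mul0r.
rewrite ler_pdivrMr ?ltr0n // mul1r; apply: (@le_trans _ _ (\sum_(d < Q b) 1)).
  by apply: ler_sum => d _; rewrite lern1 leq_b1.
by rewrite sumr_const card_ord.
Qed.

Section Window.
Context {R : realType}.
Variables (X W v l : R) (Q : nat).
Hypotheses (Q0 : (0 < Q)%N) (W0 : 0 < W) (l0 : 0 <= l).

Let pr : R := (\sum_(d < Q) (in_arc (X + W * (d%:R / Q%:R) - v) l)%:R) / Q%:R.

(** [pr] is nonzero only if the range [[X, X + W]] meets the arc, so [X] lies in [[v - W, v + l]]
    modulo 1. As [W + l < 1], all successful digits meet the same translate of the arc, hence lie in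
    an interval of length [l Q / W]. *)
Lemma window_le : W + l < 1 ->
  pr <= (l / W + Q%:R^-1) * (in_arc (X - (v - W)) (l + W))%:R.
Proof.
move=> Wl; have Q0' : 0 < Q%:R :> R by rewrite ltr0n.
have dQ (d : 'I_Q) : 0 <= W * (d%:R / Q%:R) < W.
  rewrite mulr_ge0 ?divr_ge0 ?(ltW W0) //= gtr_pMr // ltr_pdivrMr // mul1r.
  by rewrite ltr_nat.
rewrite /pr ler_pdivrMr //.
have [/in_arcP[m hm]|no] := boolP (in_arc (X - (v - W)) (l + W)); last first.
  rewrite mulr0 mul0r big1 // => d _; apply/eqP; rewrite pnatr_eq0 eqb0.
  by apply: contra no; apply: in_arc_sub; have := dQ d; lra.
rewrite mulr1 mulrDl mulVf ?gt_eqF //.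
have -> : l / W * Q%:R = l * Q%:R / W by ring.
pose B (d : nat) : bool := in_arc (X + W * (d%:R / Q%:R) - v) l.
have [/existsP[d1 hd1]|no] := boolP [exists d : 'I_Q, B d]; last first.
  rewrite big1; first by rewrite addr_ge0 // divr_ge0 ?mulr_ge0 // ltW.
  move=> d _; apply/eqP; rewrite pnatr_eq0 eqb0.
  by apply: contra no => h; apply/existsP; exists d.
have /in_arcP[n hn] := hd1.
pose e := (n%:~R - X + v) * Q%:R / W.
apply: le_trans (@count_ord_itv_le R e (l * Q%:R / W) Q _); last first.
  by rewrite divr_ge0 ?mulr_ge0 // ltW.
apply: ler_sum => d _; rewrite ler_nat.
case: (boolP (in_arc _ _)) => // /in_arcP[k hk].
have kn : k = n.
  have := dQ d; have := dQ d1; move: hk hn => hk hn h1 h2.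
  have : k%:~R < n%:~R + 1 :> R by lra.
  have : n%:~R < k%:~R + 1 :> R by lra.
  rewrite -[n%:~R + 1](rmorphD _ n 1) -[k%:~R + 1](rmorphD _ k 1) /= !ltr_int !ltzD1.
  by move=> nk kn; apply/eqP; rewrite eq_le nk kn.
move: hk; rewrite kn => /andP[hk1 hk2].
suff -> : e <= d%:R <= e + l * Q%:R / W by [].
have hd : d%:R = W * (d%:R / Q%:R) * Q%:R / W.
  by field; rewrite !gt_eqF.
rewrite hd /e -mulrDl -mulrDl !ler_pM2r ?invr_gt0 //.
by apply/andP; split; lra.
Qed.

(** If [X] lies in [[v - W + l, v]] modulo 1, the whole arc is inside [[X, X + W]], and the digits
    landing in it fill an interval of length [l Q / W] within [[0, Q]]. *)
Lemma window_ge :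
  (l / W - Q%:R^-1) * (in_arc (X - (v - W + l)) (W - l))%:R <= pr.
Proof.
have Q0' : 0 < Q%:R :> R by rewrite ltr0n.
have [/in_arcP[m hm]|no] := boolP (in_arc _ (W - l)); last first.
  by rewrite mulr0 divr_ge0 ?sumr_ge0.
rewrite /pr mulr1 ler_pdivlMr // mulrBl mulVf ?gt_eqF //.
pose e := (m%:~R - X + v) * Q%:R / W.
have e0 : 0 <= e by rewrite divr_ge0 ?mulr_ge0 ?(ltW W0) //; lra.
have eQ : e + l * Q%:R / W <= Q%:R.
  rewrite /e -mulrDl -mulrDl ler_pdivrMr // [leRHS]mulrC ler_pM2r //; lra.
apply: (@le_trans _ _ (\sum_(d < Q) (e <= d%:R <= e + l * Q%:R / W)%R%:R)).
  have := @count_ord_itv_ge R e (e + l * Q%:R / W) Q; rewrite minEle.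
  have -> : (Q%:R <= e + l * Q%:R / W) = (Q%:R == e + l * Q%:R / W).
    by rewrite [RHS]eq_le eQ andbT.
  have -> : l / W * Q%:R = l * Q%:R / W by ring.
  by case: eqP => [<-|_] h; have := h ltac:(lra); lra.
apply: ler_sum => d _; rewrite ler_nat.
case: (boolP (_ <= _ <= _)) => // /andP[h1 h2].
suff -> : in_arc (X + W * (d%:R / Q%:R) - v) l by [].
have hd : d%:R = W * (d%:R / Q%:R) * Q%:R / W.
  by field; rewrite !gt_eqF.
move: h1 h2; rewrite {1 2}hd /e -mulrDl -mulrDl !ler_pM2r ?invr_gt0 // => h1 h2.
by apply/in_arcP; exists m; apply/andP; split; lra.
Qed.

End Window.

Section PerturbedUniform.
Context {R : realType}.
Variables (w : nat -> R) (a : R).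
Hypotheses (a0 : 0 < a) (w0 : forall j, 0 < w j).
Hypothesis w_grow : forall B : R, exists j0 : nat, forall j, (j0 <= j)%N -> B <= 2 ^+ j * w j.
Hypothesis w_small : forall e : R, 0 < e -> exists j0 : nat, forall j, (j0 <= j)%N -> w j <= e.
Hypothesis w_equi : equidistributed w (2 * a).

Let p := hit (perturbed w a) grid.

Lemma hit_perturbed b j v l : trunc_log 2 b = j ->
  p b v l = (\sum_(d < grid b) (in_arc (b%:R * (2 * a) + a * w j * (d%:R / (grid b)%:R) - v) l)%:R)
     / (grid b)%:R.
Proof.
move=> bj; rewrite /p /hit; congr (_ / _); apply: eq_bigr => d _.
by rewrite /perturbed bj; congr (in_arc _ _)%:R; ring.
Qed.

(** The window estimates turn a hit probability into [l / W] times the indicator that the rotation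
    point [2 a b] lies in an arc of length [W + l] or [W - l]. Equidistribution counts these
    indicators, and [l] is negligible beside [W], so the sum is close to [M * (l / W) * W]. *)
Lemma perturbed_block (eps S : R) : 0 < eps -> 0 < S -> exists j1 : nat,
  forall j M N (v l : R), (j1 <= j)%N -> (M <= 2 ^ j)%N -> (2 ^ j <= N.+1)%N -> (0 < N)%N ->
   0 <= l -> l * N%:R <= S ->
   `|\sum_(2 ^ j <= b < 2 ^ j + M) p b v l - M%:R * l| <=
       eps * 2 ^+ j * l + \sum_(2 ^ j <= b < 2 ^ j + M) (grid b)%:R^-1 /\
   (forall b, trunc_log 2 b = j -> p b v l <= eps + (grid b)%:R^-1).
Proof.
have a0_ := a0; move=> e0 S0.
(* [eta <= a / 2] will give [l <= W / 2], and the last bound absorbs the total [eta * (a + 3) * x]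
   that appears in [key]. *)
have [eta [eta0 eta1 etaa etae]] : exists eta : R,
    [/\ 0 < eta, eta <= 1, eta <= a / 2 & eta * (a + 3) <= eps * a].
  exists (Num.min 1 (Num.min (a / 2) (eps * a / (a + 3)))).
  have a3 : 0 < a + 3 by lra.
  split; rewrite ?lt_min ?ge_min ?lexx ?orbT ?ltr01 //=.
    by rewrite !divr_gt0 ?mulr_gt0.
  by rewrite -ler_pdivlMr // !ge_min lexx !orbT.
have [j1 h1] := w_grow (2 * S / eta).
have a1 : 0 < a + 1 by lra.
have [j2 h2] := @w_small (2 * (a + 1))^-1 ltac:(by rewrite invr_gt0; lra).
have [j3 h3] := w_equi eta0.
exists (maxn j1 (maxn j2 j3)) => j M N v l; rewrite !geq_max => /and3P[/h1 hj1 /h2 hj2 jj3].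
move=> MJ JN N0 l0 lN.
pose J : R := 2 ^+ j; have J0 : 0 < J by apply: exprn_gt0.
pose x := w j; have x0 : 0 < x by apply: w0.
have NR : 1 <= N%:R :> R by rewrite ler1n.
have JNR : J <= N%:R + 1 by rewrite natr1 /J -natrX ler_nat.
(* An arc of length at most [S / N] is short compared with [w j], because [2 ^ j * w j] tends to
   infinity and [N + 1 >= 2 ^ j]. *)
have lx : l <= eta * x.
  have lJ : l * J <= 2 * S.
    apply: (@le_trans _ _ (l * (2 * N%:R))); last by lra.
    by apply: ler_wpM2l => //; lra.
  have SJ : 2 * S <= eta * (J * x).
    by rewrite [leRHS]mulrC -ler_pdivrMr //; exact: hj1.
  by rewrite -(ler_pM2r J0); lra.
pose W := a * x; have W0 : 0 < W by apply: mulr_gt0.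
have xW : x + W <= 1 / 2.
  have : x * (2 * (a + 1)) <= 1 by rewrite -ler_pdivlMr; [rewrite mul1r | lra].
  by rewrite /W; lra.
have lx1 : l <= x by apply: (le_trans lx); rewrite ler_piMl // ltW.
have lW : l <= W / 2.
  by apply: (le_trans lx); rewrite /W mulrAC ler_pM2r.
have Wl : W + l < 1 by lra.
have key : l + eta * (x + l + W) <= eps * W.
  have e1 : eta * l <= eta * x by rewrite ler_pM2l.
  have e2 : eta * (a + 3) * x <= eps * a * x by rewrite ler_pM2r.
  by rewrite /W; lra.
have gb b : (0 < grid b)%N by [].
have up b : trunc_log 2 b = j ->
    p b v l <= l / W * (in_arc (b%:R * (2 * a) - (v - W)) (l + W))%:R + (grid b)%:R^-1.
  move=> bj; rewrite (hit_perturbed v l bj).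
  apply: le_trans (@window_le R (b%:R * (2 * a)) W v l (grid b) (gb b) W0 l0 Wl) _.
  rewrite mulrDl lerD2l ler_piMr ?invr_ge0 // lern1 leq_b1 //.
have lo b : trunc_log 2 b = j ->
    l / W * (in_arc (b%:R * (2 * a) - (v - W + l)) (W - l))%:R - (grid b)%:R^-1 <= p b v l.
  move=> bj; rewrite (hit_perturbed v l bj).
  apply: (le_trans _ (@window_ge R (b%:R * (2 * a)) W v l (grid b) (gb b) W0)).
  rewrite mulrBl lerD2l lerN2 ler_piMr ?invr_ge0 // lern1 leq_b1 //.
have lW0 : 0 <= l / W by rewrite divr_ge0 // ltW.
split; last first.
  move=> b /up h; apply: (le_trans h); rewrite lerD2r.
  apply: (@le_trans _ _ (l / W)); first by rewrite ler_piMr // lern1 leq_b1.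
  rewrite ler_pdivrMr //; apply: le_trans key.
  by rewrite lerDl mulr_ge0 ?ltW //; lra.
have logb b : (2 ^ j <= b < 2 ^ j + M)%N -> trunc_log 2 b = j.
  by move=> /andP[b1 b2]; apply: trunc_log_eq => //; rewrite b1 /= expnS mul2n -addnn (leq_trans b2) // leq_add2l.
have MR : M%:R <= J by rewrite /J -natrX ler_nat.
have M0 : 0 <= M%:R :> R by [].
have c1 : 0 <= l + W <= 1 by lra.
have c2 : 0 <= W - l <= 1 by lra.
have d1 := h3 j (2 ^ j)%N M (v - W) (l + W) jj3 MJ c1.
have d2 := h3 j (2 ^ j)%N M (v - W + l) (W - l) jj3 MJ c2.
have WW : l / W * W = l by rewrite divfK ?gt_eqF.
have Ml : M%:R * l <= J * l by rewrite ler_wpM2r.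
rewrite ler_norml -/J; apply/andP; split.
- have : \sum_(2 ^ j <= b < 2 ^ j + M) (l / W * (in_arc (b%:R * (2 * a) - (v - W + l)) (W - l))%:R
       - (grid b)%:R^-1) <= \sum_(2 ^ j <= b < 2 ^ j + M) p b v l.
    by rewrite big_nat [leRHS]big_nat; apply: ler_sum => b /logb; apply: lo.
  rewrite sumrB -mulr_sumr.
  set G := \sum_(2 ^ j <= b < _) (grid b)%:R^-1; set P := \sum_(2 ^ j <= b < _) p _ _ _.
  move: d2; set I := \sum_(2 ^ j <= b < _) (in_arc _ _)%:R; rewrite ler_norml => /andP[d2 _].
  have e1 : M%:R * W - eps * J * W <= I.
    have e2 : J * (l + eta * (x + l + W)) <= J * (eps * W) by rewrite ler_pM2l.
    have e3 : 0 <= eta * J * l by rewrite !mulr_ge0 // ltW.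
    by move: d2; rewrite -/J -/x; lra.
  have e4 : l / W * (M%:R * W - eps * J * W) <= l / W * I by apply: ler_wpM2l.
  have e5 : l / W * (M%:R * W - eps * J * W) = M%:R * l - eps * J * l.
    by rewrite -[in RHS]WW; ring.
  lra.
- have : \sum_(2 ^ j <= b < 2 ^ j + M) p b v l <=
      \sum_(2 ^ j <= b < 2 ^ j + M) (l / W * (in_arc (b%:R * (2 * a) - (v - W)) (l + W))%:R
       + (grid b)%:R^-1).
    by rewrite big_nat [leRHS]big_nat; apply: ler_sum => b /logb; apply: up.
  rewrite big_split /= -mulr_sumr.
  set G := \sum_(2 ^ j <= b < _) (grid b)%:R^-1; set P := \sum_(2 ^ j <= b < _) p _ _ _.
  move: d1; set I := \sum_(2 ^ j <= b < _) (in_arc _ _)%:R; rewrite ler_norml => /andP[_ d1].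
  have e1 : I <= M%:R * W + eps * J * W.
    have e2 : J * (l + eta * (x + l + W)) <= J * (eps * W) by rewrite ler_pM2l.
    by move: d1; rewrite -/J -/x; lra.
  have e4 : l / W * I <= l / W * (M%:R * W + eps * J * W) by apply: ler_wpM2l.
  have e5 : l / W * (M%:R * W + eps * J * W) = M%:R * l + eps * J * l.
    by rewrite -[in RHS]WW; ring.
  lra.
Qed.

(** The block errors [eps * 2 ^ i * l] for [i <= j] form a geometric sum, at most
    [2 * eps * 2 ^ j * l]; only the last block may be incomplete. *)
Lemma perturbed_range (eps S : R) : 0 < eps -> 0 < S -> exists j1 : nat,
  forall j0 j M N (v l : R), (j1 <= j0 <= j)%N -> (M <= 2 ^ j)%N -> (2 ^ j <= N.+1)%N -> (0 < N)%N ->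
   0 <= l -> l * N%:R <= S ->
   `|\sum_(2 ^ j0 <= b < 2 ^ j + M) p b v l - ((2 ^ j + M)%:R - 2 ^+ j0) * l| <=
       2 * eps * 2 ^+ j * l + \sum_(2 ^ j0 <= b < 2 ^ j + M) (grid b)%:R^-1.
Proof.
move=> e0 S0; have [j1 h] := perturbed_block e0 S0; exists j1.
move=> j0 j M N v l /andP[j10]; elim: j M => [|j IH] M.
  rewrite leqn0 => /eqP j00; rewrite j00 in j10 *.
  move=> MJ JN N0 l0 lN; have [h1 _] := h 0%N M N v l j10 MJ JN N0 l0 lN.
  have : 0 <= eps * 2 ^+ 0 * l by rewrite expr0 !mulr_ge0 // ltW.
  by move: h1; rewrite natrD !natrX !ler_norml expr0; lra.
rewrite leq_eqVlt => /orP[/eqP j0j|].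
  rewrite -j0j in IH *.
  move=> MJ JN N0 l0 lN; have [h1 _] := h j0 M N v l j10 MJ JN N0 l0 lN.
  have : 0 <= eps * 2 ^+ j0 * l by rewrite !mulr_ge0 ?exprn_ge0 // ltW.
  by move: h1; rewrite natrD !natrX !ler_norml; lra.
rewrite ltnS => j0j MJ JN N0 l0 lN.
have JN' : (2 ^ j <= N.+1)%N by apply: leq_trans JN; rewrite leq_exp2l.
have := IH (2 ^ j)%N j0j (leqnn _) JN' N0 l0 lN.
rewrite addnn -mul2n -expnS => h1.
have [h2 _] := h j.+1 M N v l (leq_trans j10 (leq_trans j0j (leqnSn _))) MJ JN N0 l0 lN.
have s1 : (2 ^ j0 <= 2 ^ j.+1)%N by rewrite leq_exp2l // leqW.
rewrite !(big_cat_nat s1 (leq_addr M (2 ^ j.+1)%N)) /=.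
have e1 : 2 * eps * 2 ^+ j * l = eps * 2 ^+ j.+1 * l by rewrite exprS; ring.
move: h1 h2; rewrite e1 natrD !natrX !ler_norml; lra.
Qed.

Lemma perturbed_locally_uniform : locally_uniform (perturbed w a) grid.
Proof.
move=> eps S e0 S0.
(* The tolerance is spent as follows: half on the blocks, where [2 ^ j * l <= 2 * S] makes
   [eps / (8 * S)] the right input, a quarter on the sum of [1 / grid b], and a quarter on [K * l]
   for the skipped indices below [K]. *)
have eS0 : 0 < eps / (8 * S) by rewrite divr_gt0 // mulr_gt0.
have [j1 h1] := perturbed_range eS0 S0.
have e20 : 0 < eps / 2 by lra.
have [j2 h2] := perturbed_block e20 S0.
pose m := Num.bound (4 / eps).
have hm : 4 / eps <= m%:R by apply/ltW/archi_boundP; rewrite divr_ge0 // ltW.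
pose j0 := maxn m (maxn j1 j2).
have [mj j1j j2j] : [/\ m <= j0, j1 <= j0 & j2 <= j0]%N.
  by split; rewrite /j0 !leq_max leqnn ?orbT.
pose K := (2 ^ j0)%N.
have mK : (m <= K)%N by apply: (leq_trans mj); rewrite ltnW // ltn_expl.
have K0 : 0 < K%:R :> R by rewrite ltr0n expn_gt0.
have KR : K%:R = 2 ^+ j0 :> R by rewrite natrX.
have Ke : K.+1%:R^-1 <= eps / 4.
  rewrite -[leRHS]invrK lef_pV2 ?posrE ?ltr0n //; last by rewrite invr_gt0; lra.
  rewrite invf_div; apply: (le_trans hm); rewrite ler_nat; exact: leqW.
pose N1 := Num.bound (4 * K%:R * S / eps).
have hN1 : 4 * K%:R * S / eps <= N1%:R.
  by apply/ltW/archi_boundP; rewrite divr_ge0 ?mulr_ge0 // ltW.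
exists K, (maxn N1 K).+1; split=> [|N v l NN l0 lN]; first by rewrite expn_gt0.
have [N1N KN] : (N1 <= N)%N /\ (K < N)%N.
  by move: NN; rewrite gtn_max => /andP[h ->]; rewrite ltnW.
have N0 : (0 < N)%N by apply: leq_ltn_trans KN.
split; last first.
  move=> b /andP[Kb bN]; pose j := trunc_log 2 b.
  have b0 : (0 < b)%N by apply: leq_trans Kb; rewrite expn_gt0.
  have j0j : (j0 <= j)%N by apply: trunc_log_max.
  have Jb : (2 ^ j <= b)%N by apply: trunc_logP.
  have [_ /(_ b erefl) h] := h2 j 0%N N v l (leq_trans j2j j0j) (leq0n _)
     (leq_trans Jb (leqW bN)) N0 l0 lN.
  apply: (le_trans h).
  have : (grid b)%:R^-1 <= K.+1%:R^-1 :> R.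
    rewrite lef_pV2 ?posrE ?ltr0n // ler_nat /grid.
    by apply: (@leq_trans b.+1); [rewrite ltnS | apply: leq_pmulr].
  by move=> gK; have := le_trans gK Ke; move: e0; set z := (grid b)%:R^-1; move: z => z; lra.
pose j := trunc_log 2 N.+1.
have JN : (2 ^ j <= N.+1)%N by apply: trunc_logP.
have j0j : (j0 <= j)%N by apply: trunc_log_max => //; apply: leqW; apply: ltnW.
have := trunc_log_ltn N.+1 (isT : (1 < 2)%N); rewrite -/j expnS => NJ.
pose M := (N.+1 - 2 ^ j)%N; have MJ : (M <= 2 ^ j)%N by rewrite /M leq_subLR addnn -mul2n ltnW.
have NM : (2 ^ j + M = N.+1)%N by rewrite subnKC.
have := h1 j0 j M N v l _ MJ JN N0 l0 lN; rewrite j1j j0j NM => /(_ isT).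
have g1 : \sum_(2 ^ j0 <= b < N.+1) (grid b)%:R^-1 <= eps / 4 :> R.
  by apply: le_trans Ke; apply: sum_grid_inv; apply: leqW; apply: ltnW.
rewrite -/K -KR => h3.
have NR : 1 <= N%:R :> R by rewrite ler1n.
have JR : 2 ^+ j <= 2 * N%:R :> R.
  apply: (@le_trans _ _ N.+1%:R); first by rewrite -natrX ler_nat.
  by rewrite -natr1; lra.
have t1 : 2 * (eps / (8 * S)) * 2 ^+ j * l <= eps / 2.
  have t2 : 2 ^+ j * l <= 2 * S.
    apply: (@le_trans _ _ (2 * N%:R * l)); first by apply: ler_wpM2r.
    by rewrite -mulrA [N%:R * l]mulrC; lra.
  have t3 : 2 * (eps / (8 * S)) * (2 ^+ j * l) <= 2 * (eps / (8 * S)) * (2 * S).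
    by apply: ler_wpM2l => //; rewrite mulr_ge0 // ltW.
  have t4 : 2 * (eps / (8 * S)) * (2 * S) = eps / 2 by field; rewrite gt_eqF.
  by rewrite -mulrA -t4.
have t5 : K%:R * l <= eps / 4.
  have N0R : 0 < N%:R :> R by lra.
  have t7 : 4 * K%:R * S <= N%:R * eps.
    by rewrite -ler_pdivrMr //; apply: (le_trans hN1); rewrite ler_nat.
  have t6 : K%:R * l * N%:R <= K%:R * S by rewrite -mulrA ler_wpM2l // ltW.
  by rewrite -(ler_pM2r N0R); lra.
have lS : 1 * l <= K%:R * l by apply: ler_wpM2r => //; rewrite ler1n expn_gt0.
move: h3; rewrite -natr1 !ler_norml /p; lra.
Qed.

End PerturbedUniform.

(** * Averages over independent digits *)

Section Expectation.
Context {R : realType}.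
Variable Q : nat -> nat.
Hypothesis Q0 : forall i, (0 < Q i)%N.

Definition upd (u : nat -> nat) (i d : nat) : nat -> nat :=
  fun j => if j == i then d else u j.

Definition avg (i : nat) (F : (nat -> nat) -> R) (u : nat -> nat) : R :=
  (\sum_(d < Q i) F (upd u i d)) / (Q i)%:R.

(* The digits with index outside [s] are read from the base point. *)
Definition expect (s : seq nat) (F : (nat -> nat) -> R) : (nat -> nat) -> R :=
  foldr avg F s.

Definition depends_on (A : pred nat) (F : (nat -> nat) -> R) : Prop :=
  forall u v, (forall i, A i -> u i = v i) -> F u = F v.

Implicit Types (F G : (nat -> nat) -> R) (u : nat -> nat) (s : seq nat).

Lemma avg_cst i (c : R) u : avg i (fun=> c) u = c.
Proof.
by rewrite /avg /= sumr_const card_ord -[c *+ _]mulr_natr mulfK // pnatr_eq0 -lt0n.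
Qed.

Lemma expect_cons i s F u : expect (i :: s) F u = (\sum_(d < Q i) expect s F (upd u i d)) / (Q i)%:R.
Proof. by []. Qed.

Lemma expect_le s F G u : (forall v, F v <= G v) -> expect s F u <= expect s G u.
Proof.
move=> FG; elim: s u => [|i s IH] u /=; first exact: FG.
by rewrite ler_pM2r ?invr_gt0 ?ltr0n //; apply: ler_sum => d _; apply: IH.
Qed.

Lemma expect_sum I (r : seq I) (P : pred I) (F : I -> (nat -> nat) -> R) s u :
  expect s (fun v => \sum_(i <- r | P i) F i v) u = \sum_(i <- r | P i) expect s (F i) u.
Proof.
elim: s u => // i s IH u; rewrite !expect_cons.
under eq_bigr do rewrite IH.
by rewrite exchange_big /= mulr_suml.
Qed.

Lemma expectZ s (c : R) F u : expect s (fun v => c * F v) u = c * expect s F u.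
Proof.
elim: s u => // i s IH u; rewrite !expect_cons.
by under eq_bigr do rewrite IH; rewrite -mulr_sumr mulrA.
Qed.

Lemma expectD s F G u : expect s (fun v => F v + G v) u = expect s F u + expect s G u.
Proof.
elim: s u => // i s IH u; rewrite !expect_cons.
by under eq_bigr do rewrite IH; rewrite big_split /= mulrDl.
Qed.

Lemma expect_cst s (c : R) u : expect s (fun=> c) u = c.
Proof.
elim: s u => // i s IH u; rewrite expect_cons -[RHS](avg_cst i c u) /avg.
by congr (_ / _); apply: eq_bigr => d _; rewrite IH.
Qed.

Lemma expect_ge0 s F u : (forall v, 0 <= F v) -> 0 <= expect s F u.
Proof. by move=> F0; rewrite -(expect_cst s 0 u); apply: expect_le. Qed.

Lemma updC u i j d e : i != j -> upd (upd u i d) j e = upd (upd u j e) i d.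
Proof.
move=> ij; apply/funext => k; rewrite /upd.
by case: (eqVneq k j) => // ->; rewrite eq_sym (negbTE ij).
Qed.

Lemma upd_idem u i d e : upd (upd u i d) i e = upd u i e.
Proof. by apply/funext => k; rewrite /upd; case: eqP. Qed.

Lemma depends_on_expect A F s : depends_on A F -> depends_on A (expect s F).
Proof.
move=> AF; elim: s => // i s IH u v uv; rewrite !expect_cons; congr (_ / _).
apply: eq_bigr => d _; apply: IH => j Aj; rewrite /upd; case: eqP => // _.
exact: uv.
Qed.

Lemma depends_on_avg A F i u : depends_on A F -> ~~ A i -> avg i F u = F u.
Proof.
move=> AF Ai; rewrite -[RHS](avg_cst i (F u) u); congr (_ / _).
apply: eq_bigr => d _; apply: AF => j Aj; rewrite /upd; case: eqP => // ji.
by case/negP: Ai; rewrite -ji.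
Qed.

(** No digit is read by both factors, so at each averaging step one of them is constant and leaves
    the average. This is the independence of functions of disjoint sets of digits. *)
Lemma expectM A B F G s u : depends_on A F -> depends_on B G ->
  (forall i, A i -> ~~ B i) ->
  expect s (fun v => F v * G v) u = expect s F u * expect s G u.
Proof.
move=> AF BG AB; elim: s u => // i s IH u.
have AF' := depends_on_expect s AF; have BG' := depends_on_expect s BG.
have -> : expect (i :: s) (fun v => F v * G v) u =
          avg i (fun v => expect s F v * expect s G v) u.
  by rewrite expect_cons /avg; congr (_ / _); apply: eq_bigr => d _; rewrite IH.
rewrite -![expect (i :: s) _ u]/(avg i (expect s _) u).
have [Ai|nAi] := boolP (A i).
- rewrite (depends_on_avg u BG' (AB i Ai)) /avg [RHS]mulrAC [X in _ = X / _]mulr_suml; congr (_ / _).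
  apply: eq_bigr => d _; congr (_ * _); apply: BG' => j Bj; rewrite /upd.
  by case: eqP => // ji; case/negP: (AB i Ai); rewrite -ji.
- rewrite (depends_on_avg u AF' nAi) /avg [RHS]mulrA [X in _ = X / _]mulr_sumr; congr (_ / _).
  apply: eq_bigr => d _; congr (_ * _); apply: AF' => j Aj; rewrite /upd.
  by case: eqP => // ji; case/negP: nAi; rewrite -ji.
Qed.

Lemma expect_upd s c d F u : c \notin s ->
  expect s (fun v => F (upd v c d)) u = expect s F (upd u c d).
Proof.
elim: s u => // i s IH u; rewrite inE negb_or => /andP[ci cs].
rewrite !expect_cons; congr (_ / _); apply: eq_bigr => e _.
by rewrite IH // updC // eq_sym.
Qed.

Lemma expect_cond s c F u : uniq s -> c \in s ->
  expect s F u = (\sum_(d < Q c) expect s (fun v => F (upd v c d)) u) / (Q c)%:R.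
Proof.
elim: s u => // i s IH u; rewrite cons_uniq => /andP[ni us]; rewrite inE.
have [-> _|ci cs] := eqVneq c i.
  rewrite expect_cons; congr (_ / _); apply: eq_bigr => d _.
  rewrite expect_cons -[LHS](avg_cst i _ u); congr (_ / _); apply: eq_bigr => e _.
  by rewrite expect_upd // upd_idem.
rewrite expect_cons; have {}cs : c \in s by [].
under eq_bigr do rewrite IH //.
under [in RHS]eq_bigr do rewrite expect_cons.
rewrite -!mulr_suml exchange_big /= -!mulrA; congr (_ * _).
by rewrite mulrC.
Qed.

Lemma expect_coord s c (phi : nat -> R) u : uniq s -> c \in s ->
  expect s (fun v => phi (v c)) u = (\sum_(d < Q c) phi d) / (Q c)%:R.
Proof.
move=> us cs; rewrite (expect_cond _ _ us cs); congr (_ / _).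
apply: eq_bigr => d _.
have -> : (fun v => phi (upd v c d c)) = (fun=> phi d).
  by apply/funext => v; rewrite /upd eqxx.
by rewrite expect_cst.
Qed.

Lemma expect_prod (I : eqType) (r : seq I) (a : I -> nat) (phi : I -> nat -> R) s u :
  uniq s -> uniq (map a r) -> {subset map a r <= s} ->
  expect s (fun v => \prod_(i <- r) phi i (v (a i))) u =
  \prod_(i <- r) ((\sum_(d < Q (a i)) phi i d) / (Q (a i))%:R).
Proof.
move=> us; elim: r => [|i r IH] /=.
  move=> _ _; rewrite big_nil -[RHS](expect_cst s 1 u); congr expect.
  by apply/funext => v; rewrite big_nil.
move=> /andP[ir ur] sub; rewrite big_cons -IH //; last first.
  by move=> j jr; apply: sub; rewrite inE jr orbT.
have ais : a i \in s by apply: sub; rewrite inE eqxx.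
rewrite -(expect_coord (phi i) u us ais).
have d1 : depends_on (pred1 (a i)) (fun v => phi i (v (a i))).
  by move=> v w vw; rewrite vw //= eqxx.
have d2 : depends_on [pred j | j \in map a r] (fun v => \prod_(j <- r) phi j (v (a j))).
  move=> v w vw; rewrite [LHS]big_seq [RHS]big_seq; apply: eq_bigr => j jr.
  by congr (phi j _); apply: vw; apply: map_f.
rewrite -(expectM s u d1 d2); last by move=> j /= /eqP ->.
by congr expect; apply/funext => v; rewrite big_cons.
Qed.

End Expectation.

(** * Sums over injective tuples *)

Lemma prodr_le_exp {R : realType} (I : finType) (P : pred I) (F : I -> R) (C : R) :
  1 <= C -> (forall i, 0 <= F i <= C) -> \prod_(i | P i) F i <= C ^+ #|I|.
Proof.
move=> C1 FC; apply: (@le_trans _ _ (\prod_(i | P i) C)).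
  by apply: ler_prod => i _; apply: FC.
rewrite prodr_const; apply: ler_weXn2l => //; apply: max_card.
Qed.

Lemma prodr_dist_le {R : realType} (n : nat) (x y : 'I_n -> R) (C e : R) :
  1 <= C -> (forall i, `|x i| <= C) -> (forall i, `|y i| <= C) ->
  (forall i, `|x i - y i| <= e) ->
  `|\prod_(i < n) x i - \prod_(i < n) y i| <= n%:R * C ^+ n * e.
Proof.
move=> C1; have C0 : 0 <= C by apply: le_trans C1.
elim: n x y => [|n IH] x y hx hy hxy.
  by rewrite !big_ord0 subrr normr0 !mul0r.
have e0 : 0 <= e by apply: le_trans (hxy ord0).
rewrite !big_ord_recl; set X := \prod_(i < n) _; set Y := \prod_(i < n) _.
have -> : x ord0 * X - y ord0 * Y = x ord0 * (X - Y) + (x ord0 - y ord0) * Y by ring.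
apply: (le_trans (ler_normD _ _)); rewrite !normrM.
have h1 : `|X - Y| <= n%:R * C ^+ n * e by apply: IH.
have h2 : `|Y| <= C ^+ n.
  rewrite normr_prod; apply: (le_trans (@prodr_le_exp R _ predT _ C C1 _)).
    by move=> i; rewrite normr_ge0 hy.
  by rewrite card_ord.
have h3 : `|x ord0| * `|X - Y| <= C * (n%:R * C ^+ n * e) by apply: ler_pM.
have h4 : `|x ord0 - y ord0| * `|Y| <= e * C ^+ n by apply: ler_pM.
have h5 : e * C ^+ n <= C * (e * C ^+ n).
  by rewrite ler_peMl // mulr_ge0 // exprn_ge0.
apply: (le_trans (lerD h3 (le_trans h4 h5))).
by rewrite le_eqVlt -natr1 exprS; apply/orP; left; apply/eqP; ring.
Qed.

Lemma window_bound {R : realType} (k : nat) (lo hi : 'I_k -> R) : exists S : R,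
  [/\ 0 < S, forall i, `|lo i| <= S, forall i, `|hi i| <= S & forall i, hi i - lo i <= S].
Proof.
pose S : R := 1 + \sum_i (`|lo i| + `|hi i|).
have hS i : `|lo i| + `|hi i| <= S.
  rewrite /S (bigD1 i) //=; set r := \sum_(j | _) _.
  have : 0 <= r by apply: sumr_ge0 => j _; rewrite addr_ge0.
  lra.
have n0 (x : R) : 0 <= `|x| by [].
exists S; split=> [|i|i|i].
- by rewrite ltr_wpDr // sumr_ge0 // => j _; rewrite addr_ge0.
- by have := hS i; have := n0 (hi i); lra.
- by have := hS i; have := n0 (lo i); lra.
- by have := hS i; have := ler_norm (hi i); have := ler_norm (- lo i); rewrite normrN; lra.
Qed.

Section InjectiveSum.
Context {R : realType} (T : finType) (n : nat) (G : 'I_n -> T -> R) (C e : R).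
Hypotheses (G0 : forall i b, 0 <= G i b) (C1 : 1 <= C) (e0 : 0 <= e).
Hypothesis GC : forall i, \sum_b G i b <= C.
Hypothesis Ge : forall i j, i != j -> \sum_b G i b * G j b <= e.

Lemma injective_sum_le :
  \sum_(a : {ffun 'I_n -> T} | injectiveb a) \prod_i G i (a i) <= \prod_i \sum_b G i b.
Proof.
rewrite bigA_distr_bigA /= [leRHS](bigID (fun a : {ffun 'I_n -> T} => injectiveb a)) /=.
by rewrite lerDl; apply: sumr_ge0 => a _; apply: prodr_ge0 => i _.
Qed.

Lemma collision_sum_le i j : i != j ->
  \sum_(a : {ffun 'I_n -> T}) (\prod_l G l (a l)) * (a i == a j)%:R <= e * C ^+ n.
Proof.
move=> ij; have C0 : 0 <= C by apply: le_trans C1.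
(* [H] inserts into slots [i] and [j] the condition that the entry equals [b]. The collision
   [a i = a j = b] becomes a product over slots, so the sum over tuples factors again. *)
pose H b l c := G l c * (if (l == i) || (l == j) then (c == b)%:R else 1) : R.
have -> : \sum_(a : {ffun 'I_n -> T}) (\prod_l G l (a l)) * (a i == a j)%:R =
   \sum_b \prod_l \sum_c H b l c.
  under [RHS]eq_bigr do rewrite bigA_distr_bigA.
  rewrite [RHS]exchange_big /=; apply: eq_bigr => a _.
  under [RHS]eq_bigr do rewrite big_split /=.
  rewrite -mulr_sumr; congr (_ * _).
  rewrite (bigD1 (a i)) //= [X in _ + X]big1 ?addr0; last first.
    move=> b bi; rewrite (bigD1 i) //= eqxx /= [a i == b]eq_sym (negbTE bi) mul0r //.
  rewrite (bigD1 i) //= eqxx /= eqxx mul1r (bigD1 j) 1?eq_sym //=.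
  rewrite eqxx orbT [a j == _]eq_sym big1 ?mulr1 // => l /andP[/negbTE -> /negbTE ->] //.
have HE b l : l != i -> l != j -> \sum_c H b l c = \sum_c G l c.
  by move=> /negbTE li /negbTE lj; apply: eq_bigr => c _; rewrite /H li lj mulr1.
have HI b l : (l == i) || (l == j) -> \sum_c H b l c = G l b.
  move=> h; rewrite (bigD1 b) //= /H h eqxx mulr1 big1 ?addr0 // => c /negbTE ->.
  by rewrite mulr0.
have Cn : 0 <= C ^+ n by apply: exprn_ge0.
apply: (@le_trans _ _ (\sum_b G i b * G j b * C ^+ n)); last first.
  by rewrite -mulr_suml ler_wpM2r // Ge.
apply: ler_sum => b _; rewrite (bigD1 i) //= (bigD1 j) 1?eq_sym //= mulrA.
rewrite !HI ?eqxx ?orbT //; apply: ler_wpM2l; first by apply: mulr_ge0.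
rewrite (eq_bigr (fun l => \sum_c G l c)); last by move=> l /andP[li lj]; rewrite HE.
apply: (le_trans (@prodr_le_exp R _ _ _ C C1 _)); last by rewrite card_ord.
by move=> l; rewrite GC andbT; apply: sumr_ge0.
Qed.

(** Union bound: a tuple that is not injective has a colliding pair of slots, and there are at most
    [n ^ 2] ordered pairs. *)
Lemma injective_sum_ge :
  \prod_i \sum_b G i b - (n ^ 2)%:R * (e * C ^+ n) <=
  \sum_(a : {ffun 'I_n -> T} | injectiveb a) \prod_i G i (a i).
Proof.
rewrite lerBlDr bigA_distr_bigA /= [leLHS](bigID (fun a : {ffun 'I_n -> T} => injectiveb a)) /=.
rewrite lerD2l.
apply: (@le_trans _ _ (\sum_i \sum_(j | i != j)
   \sum_(a : {ffun 'I_n -> T}) (\prod_l G l (a l)) * (a i == a j)%:R)); last first.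
  have eC : 0 <= e * C ^+ n by rewrite mulr_ge0 // exprn_ge0 // (le_trans _ C1).
  apply: (@le_trans _ _ (\sum_(i < n) \sum_(j < n) e * C ^+ n)).
    apply: ler_sum => i _; rewrite big_mkcond /=; apply: ler_sum => j _.
    by case: ifP => // ij; apply: collision_sum_le.
  by rewrite !sumr_const !card_ord -mulrnA -[_ *+ (n * n)]mulr_natl mulnn.
under [leRHS]eq_bigr do rewrite exchange_big.
rewrite [leRHS]exchange_big /= [leRHS](bigID (fun a : {ffun 'I_n -> T} => injectiveb a)) /=.
apply: ler_wpDl.
  by do 3 (apply: sumr_ge0 => ? _); rewrite mulr_ge0 // prodr_ge0.
apply: ler_sum => a /injectivePn[i [j ij aij]].
rewrite [leRHS](bigD1 i) //= [X in _ <= X + _](bigD1 j) //= aij eqxx mulr1 -addrA lerDl.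
by rewrite addr_ge0 //; do ?(apply: sumr_ge0 => ? _); rewrite mulr_ge0 // prodr_ge0.
Qed.

End InjectiveSum.

(** * Mean and variance of the correlation counts *)

Lemma sum_ord_ge {V : nmodType} (K N : nat) (F : nat -> V) : (0 < K)%N ->
  \sum_(b < N | (K <= b.+1)%N) F b.+1 = \sum_(K <= b < N.+1) F b.
Proof.
move=> K0; rewrite (big_nat_widenl K 1) // big_add1 /= big_mkord.
by apply: eq_bigl.
Qed.

Lemma card_small_index (K N : nat) : (#|[pred b : 'I_N | ~~ (K <= b.+1)%N]| <= K)%N.
Proof.
have [->|K0] := posnP K; first by rewrite eq_card0.
rewrite -{2}[K]card_ord -(card_in_imset (f := fun b : 'I_N => insubd (Ordinal K0) (val b))).
  exact: max_card.
move=> b c; rewrite !unfold_in /= -!ltnNge => bK cK /(congr1 val).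
by rewrite !val_insubd (ltnW bK) (ltnW cK) => /val_inj.
Qed.

(** Lets one exponential moment control all moments: [n ^ r] is at most the falling factorial of
    [n + r], which is [r!] times a binomial coefficient. *)
Lemma expn_le_fact (n r : nat) : (n ^ r <= r`! * 2 ^ (n + r))%N.
Proof.
have bin2 m k : ('C(m, k) <= 2 ^ m)%N.
  elim: m k => [|m IH] [|k] //; first by rewrite bin0 expn_gt0.
  by rewrite binS expnS mul2n -addnn leq_add.
apply: (@leq_trans ((n + r) ^_ r)); last by rewrite -bin_ffact mulnC leq_mul2l bin2 orbT.
elim: r => [|r IH]; first by rewrite expn0 ffactn0.
by rewrite expnS addnS ffactnS /= leq_mul // leqW // leq_addr.
Qed.

Section Correlation.
Context {R : realType}.
Variables (Y : nat -> nat -> R) (Q : nat -> nat).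
Hypotheses (Q0 : forall i, (0 < Q i)%N) (YQ : locally_uniform Y Q).

Notation E N F := (expect Q (iota 1 N) F).

(** Local uniformity handles the indices from [K] on when [N >= N0]; the few smaller indices, and
    the case [N < N0], are covered by [hit <= 1]. Hence one constant for all [N]. *)
Lemma hit_sum_bounded (S : R) : 0 < S -> exists C : R, 1 <= C /\
  forall N (v l : R), 0 <= l -> l * N%:R <= S -> \sum_(b < N) hit Y Q b.+1 v l <= C.
Proof.
move=> S0; have [K [N0 [K0 h]]] := YQ ltr01 S0.
have KN0 : 0 <= K%:R + N0%:R :> R by rewrite addr_ge0.
exists (K%:R + N0%:R + S + 1); split; first by lra.
move=> N v l l0 lN; have [NN0|NN0] := leqP N0 N; last first.
  apply: (@le_trans _ _ N%:R).
    apply: (@le_trans _ _ (\sum_(b < N) 1)); last by rewrite sumr_const card_ord.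
    by apply: ler_sum => b _; apply: hit_le1.
  have : N%:R <= N0%:R :> R by rewrite ler_nat ltnW.
  have : 0 <= K%:R :> R by [].
  lra.
have [h1 _] := h N v l NN0 l0 lN.
rewrite (bigID (fun b : 'I_N => K <= b.+1)%N) /=.
rewrite (@sum_ord_ge _ K N (fun b => hit Y Q b v l)) //.
have h2 : \sum_(i < N | ~~ (K <= i.+1)%N) hit Y Q i.+1 v l <= K%:R.
  apply: (@le_trans _ _ (\sum_(b < N | ~~ (K <= b.+1)%N) 1)).
    by apply: ler_sum => b _; apply: hit_le1.
  by rewrite sumr_const ler_nat card_small_index.
have : 0 <= N0%:R :> R by [].
move: h1; rewrite ler_norml; lra.
Qed.

Section Neighbours.
Variables (N : nat) (u : nat -> nat) (del : R).

Definition nbrs (c : 'I_N) : {set 'I_N} :=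
  [set b : 'I_N | in_arc (Y b.+1 (u b.+1) - (Y c.+1 (u c.+1) - del)) (2 * del)].

End Neighbours.

(* Given [u c], the events [b \in nbrs c] are independent, which bounds the mean
   of [2 ^ #|nbrs c|], hence every moment. *)
Lemma nbrs_moment (r : nat) (S : R) : 0 < S -> exists C : R, 0 <= C /\
  forall N (c : 'I_N) u0,
   E N (fun u => #|nbrs u (S / N%:R) c|%:R ^+ r) u0 <= C.
Proof.
move=> S0; have S20 : 0 < 2 * S by lra.
have [C [C1 hC]] := hit_sum_bounded S20.
exists ((r`! * 2 ^ r)%:R * (2 * expR C)); split.
  by rewrite !mulr_ge0 // expR_ge0.
move=> N c u0; have N0 : (0 < N)%N by apply: leq_ltn_trans (ltn_ord c).
have N0R : 0 < N%:R :> R by rewrite ltr0n.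
set del := S / N%:R.
pose I (b : 'I_N) (y : R) (d : nat) : R := (in_arc (Y b.+1 d - (y - del)) (2 * del))%:R.
(* The factor 2 replaces the term [b = c], which is not independent of the digit conditioned on. *)
pose F (u : nat -> nat) : R := 2 * \prod_(b < N | b != c) (1 + I b (Y c.+1 (u c.+1)) (u b.+1)).
have us : uniq (iota 1 N) by apply: iota_uniq.
have ms (b : 'I_N) : b.+1 \in iota 1 N by rewrite mem_iota /= add1n ltnS ltn_ord.
apply: (@le_trans _ _ (E N (fun u => (r`! * 2 ^ r)%:R * F u) u0)).
  apply: expect_le => // u; set n := #|_|.
  rewrite -natrX; apply: (@le_trans _ _ ((r`! * 2 ^ (n + r))%:R)).
    by rewrite ler_nat expn_le_fact.
  rewrite expnD [(2 ^ n * _)%N]mulnC mulnA natrM; apply: ler_wpM2l => //.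
  have -> : (2 ^ n)%:R = \prod_(b < N) (1 + I b (Y c.+1 (u c.+1)) (u b.+1)).
    rewrite (bigID (fun b => b \in nbrs u del c)) /= [X in _ * X]big1 ?mulr1; last first.
      by move=> b; rewrite inE /I => /negbTE ->; rewrite addr0.
    rewrite (eq_bigr (fun=> 2)); first by rewrite prodr_const natrX.
    by move=> b; rewrite inE /I => ->.
  rewrite (bigD1 c) //=; apply: ler_wpM2r.
    by apply: prodr_ge0 => b _; rewrite addr_ge0.
  by rewrite lerD2l lern1 leq_b1.
rewrite expectZ //; apply: ler_wpM2l => //.
rewrite (expect_cond Q0 F u0 us (ms c)) ler_pdivrMr ?ltr0n //.
apply: (@le_trans _ _ (\sum_(d < Q c.+1) 2 * expR C)); last first.
  by rewrite sumr_const card_ord -[leLHS]mulr_natr.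
apply: ler_sum => d _.
pose rs := [seq b <- index_enum 'I_N | b != c].
have -> : (fun v => F (upd v c.+1 d)) =
   (fun v => 2 * \prod_(b <- rs) (fun d' => 1 + I b (Y c.+1 d) d') (v b.+1)).
  apply/funext => v; rewrite /F big_filter; congr (2 * _); apply: eq_bigr => b bc.
  by rewrite /upd eqxx eqSS (inj_eq val_inj) (negbTE bc).
rewrite expectZ //; apply: ler_wpM2l => //.
rewrite (expect_prod Q0 (a := fun b : 'I_N => b.+1) (fun b d' => 1 + I b (Y c.+1 d) d') u0 us).
(* Each factor is [1 + hit], at most [exp hit], and the exponents add up to at most [C]. *)
- apply: (@le_trans _ _ (\prod_(b <- rs) expR (hit Y Q b.+1 (Y c.+1 d - del) (2 * del)))).
    apply: ler_prod => b _; apply/andP; split.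
      by apply: divr_ge0 => //; apply: sumr_ge0 => e _; rewrite addr_ge0.
    rewrite big_split /= mulrDl sumr_const card_ord mulfV ?pnatr_eq0 -?lt0n //.
    exact: expR_ge1Dx.
  rewrite -expR_sum ler_expR big_filter.
  apply: (le_trans _ (hC N (Y c.+1 d - del) (2 * del) _ _)).
  + by rewrite [leRHS](bigID (fun b => b != c)) /= lerDl; apply: sumr_ge0 => b _; apply: hit_ge0.
  + by rewrite mulr_ge0 // divr_ge0 // ltW.
  + by rewrite -mulrA divfK // gt_eqF.
- rewrite map_inj_uniq ?filter_uniq ?index_enum_uniq // => b b' [] /val_inj //.
- by move=> b /mapP[b' _ ->].
Qed.

End Correlation.

Section CorrelationTerms.
Context {R : realType}.
Variables (Y : nat -> nat -> R) (Q : nat -> nat).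
Hypotheses (Q0 : forall i, (0 < Q i)%N) (YQ : locally_uniform Y Q).
Variables (k : nat) (lo hi : 'I_k -> R).
Hypothesis lohi : forall i, lo i < hi i.

Notation E N F := (expect Q (iota 1 N) F).

(** The window for a difference is restated as an arc for the later point, placed relative to the
    first one; with the first digit fixed, each factor then averages to a [hit]. *)
Definition corr_term (N : nat) (a : {ffun 'I_k.+1 -> 'I_N}) (u : nat -> nat) : R :=
  \prod_(i < k) (in_arc (Y (a (lift ord0 i)).+1 (u (a (lift ord0 i)).+1)
       - (Y (a ord0).+1 (u (a ord0).+1) - hi i / N%:R)) ((hi i - lo i) / N%:R))%:R.

Lemma corr_term_ge0 N (a : {ffun 'I_k.+1 -> 'I_N}) u : 0 <= corr_term a u.
Proof. by apply: prodr_ge0. Qed.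

Lemma corr_term_bool N (a : {ffun 'I_k.+1 -> 'I_N}) u :
  corr_term a u = `[< forall i, in_mod1 (Y (a ord0).+1 (u (a ord0).+1)
       - Y (a (lift ord0 i)).+1 (u (a (lift ord0 i)).+1)) (lo i / N%:R) (hi i / N%:R) >]%:R.
Proof.
rewrite /corr_term; set P := (X in `[< X >]).
have inE i : in_arc (Y (a (lift ord0 i)).+1 (u (a (lift ord0 i)).+1)
       - (Y (a ord0).+1 (u (a ord0).+1) - hi i / N%:R)) ((hi i - lo i) / N%:R) <->
   in_mod1 (Y (a ord0).+1 (u (a ord0).+1)
       - Y (a (lift ord0 i)).+1 (u (a (lift ord0 i)).+1)) (lo i / N%:R) (hi i / N%:R).
  rewrite mulrBl; split=> [/in_arcP[m hm]|[m hm]]; [exists (- m)|apply/in_arcP; exists (- m)];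
  by move: hm; rewrite rmorphN /=; lra.
have [hP|hP] := asboolP P; first by rewrite big1 // => i _; rewrite (iffRL (inE i) (hP i)).
have [i hi'] : exists i, ~ in_mod1 (Y (a ord0).+1 (u (a ord0).+1)
       - Y (a (lift ord0 i)).+1 (u (a (lift ord0 i)).+1)) (lo i / N%:R) (hi i / N%:R).
  by apply/existsNP.
rewrite (bigD1 i) //=; case: (boolP (in_arc _ _)) => [/inE //|_]; by rewrite mul0r.
Qed.

Lemma corr_countE N u :
  corr_count (fun n => Y n (u n)) lo hi N =
  \sum_(a : {ffun 'I_k.+1 -> 'I_N} | injectiveb a) corr_term a u.
Proof.
rewrite /corr_count big_mkcondr /=; apply: eq_bigr => a _.
by rewrite corr_term_bool; case: ifP.
Qed.

Lemma expect_corr_term N (a : {ffun 'I_k.+1 -> 'I_N}) u0 : injective a ->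
  E N (corr_term a) u0 = (\sum_(d < Q (a ord0).+1)
    \prod_(i < k) hit Y Q (a (lift ord0 i)).+1 (Y (a ord0).+1 d - hi i / N%:R)
       ((hi i - lo i) / N%:R)) / (Q (a ord0).+1)%:R.
Proof.
move=> ainj; have us : uniq (iota 1 N) by apply: iota_uniq.
have ms (b : 'I_N) : b.+1 \in iota 1 N by rewrite mem_iota /= add1n ltnS ltn_ord.
rewrite (expect_cond Q0 _ u0 us (ms (a ord0))); congr (_ / _).
apply: eq_bigr => d _; set c := (a ord0).+1.
pose phi (i : 'I_k) (e : nat) : R := (in_arc (Y (a (lift ord0 i)).+1 e
       - (Y c d - hi i / N%:R)) ((hi i - lo i) / N%:R))%:R.
have -> : (fun v => corr_term a (upd v c d)) =
  (fun v => \prod_(i < k) phi i (v (a (lift ord0 i)).+1)).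
  apply/funext => v; apply: eq_bigr => i _; rewrite /upd eqxx eqSS (inj_eq val_inj).
  by rewrite (inj_eq ainj).
rewrite (expect_prod Q0 (a := fun i => (a (lift ord0 i)).+1) phi u0 us) //.
  by rewrite map_inj_uniq ?index_enum_uniq // => i j [] /val_inj /ainj /lift_inj.
by move=> b /mapP[i _ ->].
Qed.

Variable S : R.
Hypotheses (S0 : 0 < S) (loS : forall i, `|lo i| <= S) (hiS : forall i, `|hi i| <= S).

(** Every point of a correlated tuple is within [S / N] of the first one modulo 1, so any two of
    them are within [2 * S / N]. *)
Lemma corr_term_nbrs N (a : {ffun 'I_k.+1 -> 'I_N}) u i j :
  corr_term a u != 0 -> a j \in nbrs Y u (2 * S / N%:R) (a i).
Proof.
rewrite corr_term_bool; case: asboolP => [h _|_]; last by rewrite eqxx.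
have N0 : (0 < N)%N by apply: leq_ltn_trans (ltn_ord (a i)).
have N0R : 0 < N%:R :> R by rewrite ltr0n.
set s := S / N%:R; have s0 : 0 <= s by rewrite divr_ge0 // ltW.
pose y j := Y (a j).+1 (u (a j).+1).
have off l : exists m : int, - s <= y ord0 - y l - m%:~R <= s.
  case: (unliftP ord0 l) => [l' ->|->]; last by exists 0; rewrite !subrr; lra.
  have [m hm] := h l'; exists m.
  have : - s <= lo l' / N%:R.
    rewrite /s -mulNr ler_pM2r ?invr_gt0 //; have := loS l'; rewrite ler_norml; lra.
  have : hi l' / N%:R <= s.
    rewrite /s ler_pM2r ?invr_gt0 //; have := hiS l'; rewrite ler_norml; lra.
  by rewrite /y; lra.
have [m hm] := off i; have [n hn] := off j.
rewrite inE; apply/in_arcP; exists (m - n).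
rewrite rmorphB /= -[2 * S / _]mulrA -/s -/(y i) -/(y j); lra.
Qed.

Lemma corr_term_le1 N (a : {ffun 'I_k.+1 -> 'I_N}) u : corr_term a u <= 1.
Proof. by rewrite corr_term_bool lern1 leq_b1. Qed.

Lemma corr_term_sum_le N u (i : 'I_k.+1) (c : 'I_N) :
  \sum_(a : {ffun 'I_k.+1 -> 'I_N} | a i == c) corr_term a u <=
  #|nbrs Y u (2 * S / N%:R) c|%:R ^+ k.+1.
Proof.
set B := nbrs _ _ _ _.
apply: (@le_trans _ _ (\sum_(a : {ffun 'I_k.+1 -> 'I_N} | a \in ffun_on (mem B)) 1)).
  rewrite [leRHS]big_mkcond /= big_mkcond /=; apply: ler_sum => a _.
  case: eqP => [aic|_]; last by case: ifP.
  have [->|nz] := eqVneq (corr_term a u) 0; first by case: ifP.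
  suff -> : a \in ffun_on (mem B) by apply: corr_term_le1.
  by apply/ffun_onP => j; rewrite /B -aic; apply: corr_term_nbrs.
by rewrite sumr_const card_ffun_on card_ord natrX.
Qed.

(* Two tuples sharing the index [c] both lie in the neighbourhood of [c]; tuples with
   no common index are independent, so only these pairs enter the variance. *)
Lemma corr_pairs_le N u :
  \sum_(a : {ffun 'I_k.+1 -> 'I_N} | injectiveb a)
  \sum_(b : {ffun 'I_k.+1 -> 'I_N} | injectiveb b)
     [exists i, exists j, a i == b j]%:R * (corr_term a u * corr_term b u) <=
  (k.+1 ^ 2)%:R * \sum_(c < N) #|nbrs Y u (2 * S / N%:R) c|%:R ^+ (k.+1 + k.+1).
Proof.
pose g := fun a : {ffun 'I_k.+1 -> 'I_N} => corr_term a u.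
have g0 a : 0 <= g a by apply: corr_term_ge0.
apply: (@le_trans _ _ (\sum_(a : {ffun 'I_k.+1 -> 'I_N}) \sum_(b : {ffun 'I_k.+1 -> 'I_N})
   \sum_i \sum_j \sum_(c < N) ((a i == c)%:R * g a) * ((b j == c)%:R * g b))).
  rewrite big_mkcond /=; apply: ler_sum => a _; case: ifP => _; last first.
    by do 4 (apply: sumr_ge0 => ? _); rewrite !mulr_ge0.
  rewrite big_mkcond /=; apply: ler_sum => b _; case: ifP => _; last first.
    by do 3 (apply: sumr_ge0 => ? _); rewrite !mulr_ge0.
  case: existsP => [[i /existsP[j /eqP ij]]|_]; last first.
    by rewrite mul0r; do 3 (apply: sumr_ge0 => ? _); rewrite !mulr_ge0.
  rewrite mul1r (bigD1 i) //= (bigD1 j) //= (bigD1 (a i)) //= -ij eqxx !mul1r -!addrA lerDl.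
  by rewrite !addr_ge0 //; do ?(apply: sumr_ge0 => ? _); rewrite !mulr_ge0.
have -> : \sum_(a : {ffun 'I_k.+1 -> 'I_N}) \sum_(b : {ffun 'I_k.+1 -> 'I_N})
   \sum_i \sum_j \sum_(c < N) ((a i == c)%:R * g a) * ((b j == c)%:R * g b) =
   \sum_i \sum_j \sum_(c < N) (\sum_(a : {ffun 'I_k.+1 -> 'I_N} | a i == c) g a)
      * (\sum_(b : {ffun 'I_k.+1 -> 'I_N} | b j == c) g b).
  under eq_bigr do rewrite exchange_big /=; rewrite exchange_big /=; apply: eq_bigr => i _.
  under eq_bigr do rewrite exchange_big /=; rewrite exchange_big /=; apply: eq_bigr => j _.
  under eq_bigr do rewrite exchange_big /=; rewrite exchange_big /=; apply: eq_bigr => c _.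
  rewrite [X in _ = X * _]big_mkcond [X in _ = _ * X]big_mkcond /= big_distrlr /=.
  apply: eq_bigr => a _; apply: eq_bigr => b _.
  by case: ifP => _; case: ifP => _; rewrite ?mul0r ?mul1r ?mulr0 ?mul0r.
apply: (@le_trans _ _ (\sum_(i < k.+1) \sum_(j < k.+1)
   \sum_(c < N) #|nbrs Y u (2 * S / N%:R) c|%:R ^+ (k.+1 + k.+1))); last first.
  by rewrite !sumr_const !card_ord -mulrnA -[_ *+ (_ * _)]mulr_natl mulnn.
apply: ler_sum => i _; apply: ler_sum => j _; apply: ler_sum => c _.
by rewrite exprD; apply: ler_pM; rewrite ?corr_term_sum_le //; apply: sumr_ge0.
Qed.

End CorrelationTerms.

Section CorrelationMoments.
Context {R : realType}.
Variables (Y : nat -> nat -> R) (Q : nat -> nat).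
Hypotheses (Q0 : forall i, (0 < Q i)%N) (YQ : locally_uniform Y Q).
Variables (k : nat) (lo hi : 'I_k -> R).
Hypothesis lohi : forall i, lo i < hi i.

Notation E N F := (expect Q (iota 1 N) F).
Notation g := (corr_term Y lo hi).

Definition corr_ratio (N : nat) (u : nat -> nat) : R :=
  corr_count (fun n => Y n (u n)) lo hi N / N%:R.

Lemma corr_ratioE N : corr_ratio N =
  (fun u => N%:R^-1 * \sum_(a : {ffun 'I_k.+1 -> 'I_N} | injectiveb a) g a u).
Proof. by apply/funext => u; rewrite /corr_ratio corr_countE mulrC. Qed.

Lemma depends_on_corr_term N (a : {ffun 'I_k.+1 -> 'I_N}) :
  depends_on [pred n | [exists i, n == (a i).+1]] (g a).
Proof.
move=> u v uv; apply: eq_bigr => i _; rewrite !uv //=; apply/existsP.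
- by exists ord0.
- by exists (lift ord0 i).
Qed.

Lemma corr_variance : exists C : R, 0 <= C /\ forall N u0, (0 < N)%N ->
  E N (fun u => (corr_ratio N u - E N (corr_ratio N) u0) ^+ 2) u0 <= C / N%:R.
Proof.
have [S [S0 loS hiS _]] := window_bound lo hi; have S20 : 0 < 2 * S by lra.
have [C [C0 hC]] := nbrs_moment Q0 YQ (k.+1 + k.+1) S20.
exists ((k.+1 ^ 2)%:R * C); split; first by rewrite mulr_ge0.
move=> N u0 N0; have N0R : 0 < N%:R :> R by rewrite ltr0n.
set m := E N (corr_ratio N) u0.
have -> : (fun u => (corr_ratio N u - m) ^+ 2) =
  (fun u => corr_ratio N u * corr_ratio N u + ((- 2 * m) * corr_ratio N u + m ^+ 2)).
  by apply/funext => u; ring.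
rewrite expectD // expectD // expectZ // expect_cst // -/m.
have -> : - 2 * m * m + m ^+ 2 = - (m * m) by ring.
have mE : m = N%:R^-1 * \sum_(a : {ffun 'I_k.+1 -> 'I_N} | injectiveb a) E N (g a) u0.
  by rewrite /m corr_ratioE expectZ // expect_sum.
have -> : E N (fun u => corr_ratio N u * corr_ratio N u) u0 = N%:R^-1 ^+ 2 *
  \sum_(a : {ffun 'I_k.+1 -> 'I_N} | injectiveb a)
  \sum_(b : {ffun 'I_k.+1 -> 'I_N} | injectiveb b) E N (fun u => g a u * g b u) u0.
  have -> : (fun u => corr_ratio N u * corr_ratio N u) = (fun u => N%:R^-1 ^+ 2 *
    \sum_(a : {ffun 'I_k.+1 -> 'I_N} | injectiveb a)
    \sum_(b : {ffun 'I_k.+1 -> 'I_N} | injectiveb b) g a u * g b u).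
    apply/funext => u; rewrite corr_ratioE mulrACA -expr2; congr (_ * _).
    by rewrite big_distrlr.
  rewrite expectZ // expect_sum //; congr (_ * _); apply: eq_bigr => a _.
  by rewrite expect_sum.
rewrite mE mulrACA -expr2 big_distrlr /= -mulrBr.
rewrite -sumrB; under eq_bigr do rewrite -sumrB.
pose sh (a b : {ffun 'I_k.+1 -> 'I_N}) : R := [exists i, exists j, a i == b j]%:R.
apply: (@le_trans _ _ (N%:R^-1 ^+ 2 * E N (fun u =>
  \sum_(a : {ffun 'I_k.+1 -> 'I_N} | injectiveb a)
  \sum_(b : {ffun 'I_k.+1 -> 'I_N} | injectiveb b) sh a b * (g a u * g b u)) u0)).
  apply: ler_wpM2l; first by rewrite exprn_ge0 // invr_ge0.
  rewrite expect_sum //; apply: ler_sum => a _; rewrite expect_sum //.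
  apply: ler_sum => b _; rewrite expectZ // /sh.
  case: (boolP [exists i, _]) => [_|nsh].
    rewrite mul1r gerBl mulr_ge0 //; apply: expect_ge0 => // v;
    exact: corr_term_ge0.
  rewrite mul0r (expectM Q0 _ u0 (depends_on_corr_term (a:=a)) (depends_on_corr_term (a:=b))).
    by rewrite subrr.
  move=> n /= /existsP[i /eqP ->]; apply: contra nsh => /existsP[j ij].
  by apply/existsP; exists i; apply/existsP; exists j; rewrite -(inj_eq val_inj) -eqSS.
have -> : (k.+1 ^ 2)%:R * C / N%:R = N%:R^-1 ^+ 2 * ((k.+1 ^ 2)%:R * (N%:R * C)).
  by field; rewrite gt_eqF.
apply: ler_wpM2l; first by rewrite exprn_ge0 // invr_ge0.
(* Each index [c] contributes a bounded moment of order [2 k + 2], so the sum is [O(N)] against the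
   factor [1 / N ^ 2]. *)
apply: le_trans (expect_le Q0 (iota 1 N) u0 (corr_pairs_le Y S0 loS hiS N)) _.
rewrite expectZ // ler_wpM2l // expect_sum //.
apply: (@le_trans _ _ (\sum_(c < N) C)); first by apply: ler_sum => c _; apply: hC.
by rewrite sumr_const card_ord -[_ *+ N]mulr_natl.
Qed.

End CorrelationMoments.

Section CorrelationMean.
Context {R : realType}.
Variables (Y : nat -> nat -> R) (Q : nat -> nat).
Hypotheses (Q0 : forall i, (0 < Q i)%N) (YQ : locally_uniform Y Q).
Variables (k : nat) (lo hi : 'I_k -> R).
Hypothesis lohi : forall i, lo i < hi i.

Notation E N F := (expect Q (iota 1 N) F).
Notation g := (corr_term Y lo hi).

(** Local uniformity controls no index below [K]. Tuples using such an index are bounded through its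
    neighbours; the bound does not depend on [N], so it is lost after division by [N]. *)
Lemma small_index_le (S C : R) (K N : nat) u0 :
  0 < S -> (forall i, `|lo i| <= S) -> (forall i, `|hi i| <= S) -> 0 <= C ->
  (forall c : 'I_N, E N (fun u => #|nbrs Y u (2 * S / N%:R) c|%:R ^+ k.+1) u0 <= C) ->
  \sum_(a : {ffun 'I_k.+1 -> 'I_N} | injectiveb a && ~~ [forall i, K <= (a i).+1]%N) E N (g a) u0
   <= (k.+1 * K)%:R * C.
Proof.
move=> S0 loS hiS C0 hC; rewrite -expect_sum //.
apply: (@le_trans _ _ (E N (fun u => \sum_(i < k.+1) \sum_(c < N | ~~ (K <= c.+1)%N)
    #|nbrs Y u (2 * S / N%:R) c|%:R ^+ k.+1) u0)).
  apply: expect_le => // u.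
  apply: (@le_trans _ _ (\sum_(i < k.+1) \sum_(c < N | ~~ (K <= c.+1)%N)
    \sum_(a : {ffun 'I_k.+1 -> 'I_N} | a i == c) g a u)); last first.
    by apply: ler_sum => i _; apply: ler_sum => c _; apply: corr_term_sum_le.
  have -> : \sum_(i < k.+1) \sum_(c < N | ~~ (K <= c.+1)%N)
      \sum_(a : {ffun 'I_k.+1 -> 'I_N} | a i == c) g a u =
      \sum_(a : {ffun 'I_k.+1 -> 'I_N}) \sum_(i < k.+1) \sum_(c < N | ~~ (K <= c.+1)%N)
        (a i == c)%:R * g a u.
    under eq_bigr => i _ do under eq_bigr => c _ do rewrite big_mkcond /=.
    under eq_bigr => i _ do rewrite exchange_big /=.
    rewrite exchange_big /=; apply: eq_bigr => a _; apply: eq_bigr => i _.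
    by apply: eq_bigr => c _; case: ifP; rewrite ?mul1r ?mul0r.
  rewrite big_mkcond /=; apply: ler_sum => a _.
  have g0 : 0 <= g a u by apply: corr_term_ge0.
  case: ifP => [/andP[_ /forallPn[i hi']]|_]; last first.
    by do 2 (apply: sumr_ge0 => ? _); rewrite mulr_ge0.
  rewrite (bigD1 i) //= (bigD1 (a i)) //= eqxx mul1r -addrA lerDl.
  by rewrite addr_ge0 //; do ?(apply: sumr_ge0 => ? _); rewrite mulr_ge0.
rewrite expect_sum //.
apply: (@le_trans _ _ (\sum_(i < k.+1) K%:R * C)); last first.
  by rewrite sumr_const card_ord natrM -mulrA -[_ *+ _]mulr_natl.
apply: ler_sum => i _; rewrite expect_sum //.
apply: (@le_trans _ _ (\sum_(c < N | ~~ (K <= c.+1)%N) C)); first by apply: ler_sum => c _.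
rewrite sumr_const -[_ *+ _]mulr_natl; apply: ler_wpM2r => //.
by rewrite ler_nat card_small_index.
Qed.

(* For a fixed value [c] of the first index and [d] of its digit, the probability of a
   correlation is a product over the slots of the tuple. *)
Definition slot (N K : nat) (c : 'I_N) (d : nat) (j : 'I_k.+1) (b : 'I_N) : R :=
  if unlift ord0 j is Some i then
    (K <= b.+1)%N%:R * hit Y Q b.+1 (Y c.+1 d - hi i / N%:R) ((hi i - lo i) / N%:R)
  else (b == c)%:R.

(** The indicator in slot 0 fixes the first index at [c], and the truncation at [K] sits in the
    other slots. What remains inside is a sum of products over injective tuples, to which the
    collision bound applies. *)
Lemma large_index_sum (N K : nat) u0 :
  \sum_(a : {ffun 'I_k.+1 -> 'I_N} | injectiveb a && [forall i, K <= (a i).+1]%N) E N (g a) u0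
  = \sum_(c < N | (K <= c.+1)%N) (\sum_(d < Q c.+1)
      \sum_(a : {ffun 'I_k.+1 -> 'I_N} | injectiveb a) \prod_j slot K c d j (a j)) / (Q c.+1)%:R.
Proof.
under [RHS]eq_bigr => c _ do rewrite exchange_big /= mulr_suml.
rewrite [RHS]exchange_big /= big_mkcondr /=; apply: eq_bigr => a /injectiveP ainj.
have sl0 (c : 'I_N) d b : slot K c d ord0 b = (b == c)%:R :> R by rewrite /slot unlift_none.
have sl (c : 'I_N) d i b : slot K c d (lift ord0 i) b = (K <= b.+1)%N%:R *
   hit Y Q b.+1 (Y c.+1 d - hi i / N%:R) ((hi i - lo i) / N%:R) by rewrite /slot liftK.
have vanish (c : 'I_N) d : c != a ord0 -> \prod_j slot K c d j (a j) = 0.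
  by move=> ca; rewrite big_ord_recl sl0 eq_sym (negbTE ca) mul0r.
case: (boolP [forall i, _]) => [/forallP hK|/forallPn[j hj]].
  rewrite (bigD1 (a ord0)) //= [X in _ = _ + X]big1 ?addr0; last first.
    move=> c /andP[_ ca]; rewrite big1 ?mul0r // => d _; exact: vanish.
  rewrite expect_corr_term //; congr (_ / _); apply: eq_bigr => d _.
  rewrite big_ord_recl sl0 eqxx mul1r; apply: eq_bigr => i _.
  by rewrite sl hK mul1r.
rewrite big1 // => c Kc; rewrite big1 ?mul0r // => d _.
have [ca|/vanish //] := eqVneq c (a ord0).
have [i ij] : exists i, j = lift ord0 i.
  case: (unliftP ord0 j) => [i ->|j0]; first by exists i.
  by move: hj; rewrite j0 -ca Kc.
rewrite (bigD1 j) //= {1}ij sl (negbTE hj) !mul0r //.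
Qed.

Lemma corr_mean (e : R) : 0 < e -> exists N1 : nat, forall N u0, (N1 <= N)%N ->
  `|E N (corr_ratio Y lo hi N) u0 - \prod_i (hi i - lo i)| <= e.
Proof.
have [S [S0 loS hiS hloS]] := window_bound lo hi; have S20 : 0 < 2 * S by lra.
have [C1 [C10 hC1]] := nbrs_moment Q0 YQ k.+1 S20.
have [C2 [C21 hC2]] := hit_sum_bounded YQ S0.
pose C := C2 + S + 1; have CC1 : 1 <= C by rewrite /C; lra.
have C0 : 0 <= C by lra.
(* [A * eps] is the error for a fixed first point: the first term of [A] comes from collisions, the
   second from replacing each slot sum by the window length. *)
pose A := (k.+1 ^ 2)%:R * (C * C ^+ k.+1) + k%:R * C ^+ k.
have A0 : 0 <= A by rewrite /A addr_ge0 // !mulr_ge0 ?exprn_ge0.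
move=> e0; pose eps := Num.min 1 (e / (2 * (A + 1))).
have A1 : 0 < A + 1 by lra.
have eps0 : 0 < eps by rewrite lt_min ltr01 divr_gt0 // mulr_gt0.
have eps1 : eps <= 1 by rewrite ge_min lexx.
have epsA : A * eps <= e / 2.
  apply: (@le_trans _ _ ((A + 1) * eps)); first by rewrite ler_pM2r //; lra.
  have : eps <= e / (2 * (A + 1)) by rewrite ge_min lexx orbT.
  by rewrite ler_pdivlMr ?mulr_gt0 //; lra.
have [K [N0 [K0 hK]]] := YQ eps0 S0.
pose P := \prod_i (hi i - lo i).
have P0 : 0 <= P by apply: prodr_ge0 => i _; rewrite subr_ge0 ltW.
(* What small indices cost, independently of [N]: the tuples containing one, and a missing term [P]
   for each first index below [K]. *)
pose B := (k.+1 * K)%:R * C1 + K%:R * P.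
have B0 : 0 <= B by rewrite addr_ge0 // mulr_ge0.
exists (maxn (maxn N0 1) (Num.bound (2 * B / e))) => N u0.
rewrite !geq_max => /andP[/andP[NN0 N0'] NB].
have N0R : 0 < N%:R :> R by rewrite ltr0n.
have BN : B / N%:R <= e / 2.
  have : 2 * B / e <= N%:R.
    apply: (le_trans (ltW (archi_boundP _))); first by rewrite divr_ge0 ?mulr_ge0 // ltW.
    by rewrite ler_nat.
  rewrite ler_pdivrMr // => h; rewrite ler_pdivrMr //; lra.
pose l i := (hi i - lo i) / N%:R.
have l0 i : 0 <= l i by rewrite divr_ge0 // subr_ge0 ltW.
have lN i : l i * N%:R = hi i - lo i by rewrite divfK // gt_eqF.
have lS i : l i * N%:R <= S by rewrite lN.
pose Z c d := \sum_(a : {ffun 'I_k.+1 -> 'I_N} | injectiveb a) \prod_j slot K c d j (a j).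
have ZP c d : `|Z c d - P| <= A * eps.
  have s0 j b : 0 <= slot K c d j b.
    by rewrite /slot; case: unlift => [i|//]; rewrite mulr_ge0 // hit_ge0.
  have sum0 : \sum_b slot K c d ord0 b = 1.
    rewrite (bigD1 c) //= /slot unlift_none eqxx big1 ?addr0 // => b /negbTE -> //.
  have sumE i : \sum_b slot K c d (lift ord0 i) b =
      \sum_(K <= b < N.+1) hit Y Q b (Y c.+1 d - hi i / N%:R) (l i).
    rewrite -(@sum_ord_ge _ K N (fun b => hit Y Q b (Y c.+1 d - hi i / N%:R) (l i))) //.
    rewrite [RHS]big_mkcond /=; apply: eq_bigr => b _; rewrite /slot liftK.
    by case: leqP; rewrite ?mul1r ?mul0r.
  have sumi i : `|\sum_b slot K c d (lift ord0 i) b - (hi i - lo i)| <= eps.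
    have [h _] := hK N (Y c.+1 d - hi i / N%:R) (l i) NN0 (l0 i) (lS i).
    by rewrite sumE -lN [l i * _]mulrC.
  have sumC j : \sum_b slot K c d j b <= C.
    case: (unliftP ord0 j) => [i ->|->]; last by rewrite sum0.
    have := sumi i; have := hloS i; rewrite ler_norml /C; lra.
  have sle i b : slot K c d (lift ord0 i) b <= eps.
    rewrite /slot liftK; case: leqP => Kb; last by rewrite mul0r ltW.
    rewrite mul1r; have [_ h] := hK N (Y c.+1 d - hi i / N%:R) (l i) NN0 (l0 i) (lS i).
    by apply: h; rewrite Kb /= ltn_ord.
  (* In every slot but the first, each single probability is at most [eps], and of two distinct
     slots one is not the first. *)
  have pair i j : i != j -> \sum_b slot K c d i b * slot K c d j b <= eps * C.
    wlog : i j / j != ord0.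
      move=> H ij; have [j0|j0] := eqVneq j ord0; last exact: H.
      under eq_bigr do rewrite mulrC.
      by apply: H; [rewrite -j0 | rewrite eq_sym].
    case: (unliftP ord0 j) => [j' ->|->]; last by rewrite eqxx.
    move=> _ _; apply: (@le_trans _ _ (\sum_b eps * slot K c d i b)).
      by apply: ler_sum => b _; rewrite mulrC ler_wpM2r.
    by rewrite -mulr_sumr ler_wpM2l // ltW.
  have eC0 : 0 <= eps * C by rewrite mulr_ge0 // ltW.
  have up := injective_sum_le s0.
  have down := injective_sum_ge s0 CC1 eC0 sumC pair.
  rewrite -/(Z c d) in up down.
  have prodE : \prod_j \sum_b slot K c d j b = \prod_(i < k) \sum_b slot K c d (lift ord0 i) b.
    by rewrite big_ord_recl sum0 mul1r.
  have near : `|\prod_(i < k) \sum_b slot K c d (lift ord0 i) b - P| <= k%:R * C ^+ k * eps.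
    apply: prodr_dist_le => // i.
      by rewrite ger0_norm ?sumr_ge0.
    rewrite ger0_norm ?subr_ge0 ?(ltW (lohi i)) //; have := hloS i; rewrite /C; lra.
  rewrite prodE in up down.
  have AE : A * eps = (k.+1 ^ 2)%:R * (eps * C * C ^+ k.+1) + k%:R * C ^+ k * eps.
    by rewrite /A; ring.
  have q0 : 0 <= (k.+1 ^ 2)%:R * (eps * C * C ^+ k.+1).
    by rewrite mulr_ge0 // mulr_ge0 // exprn_ge0.
  rewrite AE; move: near; rewrite !ler_norml; lra.
pose Zm (c : 'I_N) := (\sum_(d < Q c.+1) Z c d) / (Q c.+1)%:R.
have Qc c : 0 < (Q c)%:R :> R by rewrite ltr0n.
have ZmP c : `|Zm c - P| <= A * eps.
  have -> : Zm c - P = (\sum_(d < Q c.+1) (Z c d - P)) / (Q c.+1)%:R.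
    rewrite sumrB mulrBl; congr (_ - _).
    by rewrite sumr_const card_ord -[P *+ _]mulr_natr mulfK // gt_eqF.
  rewrite normrM normfV [`|_%:R|]ger0_norm // ler_pdivrMr //.
  apply: (le_trans (ler_norm_sum _ _ _)).
  apply: (@le_trans _ _ (\sum_(d < Q c.+1) A * eps)); first by apply: ler_sum.
  by rewrite sumr_const card_ord -[_ *+ _]mulr_natr.
rewrite corr_ratioE expectZ // expect_sum //.
rewrite (bigID (fun a : {ffun 'I_k.+1 -> 'I_N} => [forall i, K <= (a i).+1]%N)) /=.
rewrite large_index_sum.
set X := \sum_(a : {ffun 'I_k.+1 -> 'I_N} | injectiveb a && ~~ _) _.
have X1 : X <= (k.+1 * K)%:R * C1.
  by apply: (@small_index_le S C1 K N u0 S0 loS hiS C10) => c; apply: hC1.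
have X0 : 0 <= X by apply: sumr_ge0 => a _; apply: expect_ge0 => // u; apply: corr_term_ge0.
set W := \sum_(c < N | _) _.
have WP : `|W - N%:R * P| <= N%:R * (A * eps) + K%:R * P.
  have -> : W - N%:R * P = \sum_(c < N | (K <= c.+1)%N) (Zm c - P)
      - \sum_(c < N | ~~ (K <= c.+1)%N) P.
    rewrite sumrB /W -/Zm -addrA -opprD; congr (_ - _).
    rewrite -(bigID (fun c : 'I_N => K <= c.+1)%N predT (fun=> P)) /=.
    by rewrite sumr_const card_ord -[P *+ _]mulr_natl.
  apply: (le_trans (ler_normB _ _)); apply: lerD.
    apply: (le_trans (ler_norm_sum _ _ _)).
    apply: (@le_trans _ _ (\sum_(c < N) A * eps)).
      rewrite big_mkcond /=; apply: ler_sum => c _; case: ifP => // _.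
      by rewrite mulr_ge0 // ltW.
    by rewrite sumr_const card_ord -[_ *+ _]mulr_natl.
  rewrite ger0_norm; last by apply: sumr_ge0.
  rewrite sumr_const -[_ *+ _]mulr_natl; apply: ler_wpM2r => //.
  by rewrite ler_nat card_small_index.
have -> : N%:R^-1 * (W + X) - P = (W - N%:R * P + X) / N%:R.
  by field; rewrite gt_eqF.
rewrite normrM normfV [`|N%:R|]ger0_norm // ler_pdivrMr //.
have eN : e * N%:R = (e / 2) * N%:R + (e / 2) * N%:R by field.
have h1 : N%:R * (A * eps) <= (e / 2) * N%:R by rewrite mulrC ler_pM2r.
have h2 : B <= (e / 2) * N%:R by rewrite -ler_pdivrMr.
have BE : B = (k.+1 * K)%:R * C1 + K%:R * P by [].
move: WP; rewrite eN !ler_norml; lra.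
Qed.

End CorrelationMean.

(** * Choosing one sequence of digits for almost every dilation *)

Section Greedy.
Context {R : realType}.
Variable Q : nat -> nat.
Hypothesis Q0 : forall i, (0 < Q i)%N.
Implicit Types (F : (nat -> nat) -> R) (u : nat -> nat).

Lemma expect_cat s t F u : expect Q (s ++ t) F u = expect Q s (expect Q t F) u.
Proof. by rewrite /expect foldr_cat. Qed.

Lemma expect_out (A : pred nat) s F u : depends_on A F -> (forall i, i \in s -> ~~ A i) ->
  expect Q s F u = F u.
Proof.
move=> AF; elim: s u => // i s IH u sA.
rewrite -[LHS]/(avg Q i (expect Q s F) u).
have -> : avg Q i (expect Q s F) u = avg Q i F u.
  congr (_ / _); apply: eq_bigr => d _; apply: IH => j js.
  by apply: sA; rewrite inE js orbT.
by apply: (depends_on_avg Q0 u AF); apply: sA; rewrite inE eqxx.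
Qed.

Lemma expect_iota_stable n i l l' F u : depends_on [pred j | (j < n)%N] F ->
  (n <= i + l)%N -> (l <= l')%N -> expect Q (iota i l') F u = expect Q (iota i l) F u.
Proof.
move=> nF nil /subnKC <-; rewrite iotaD expect_cat.
congr expect; apply/funext => v; apply: (expect_out _ nF) => j.
by rewrite mem_iota /= -leqNgt => /andP[h _]; apply: leq_trans h.
Qed.

Lemma expect_iota0 N n F u : depends_on [pred j | (1 <= j <= N)%N] F -> (N < n)%N ->
  expect Q (iota 0 n) F u = expect Q (iota 1 N) F u.
Proof.
move=> NF Nn.
have NF' : depends_on [pred j | (j < N.+1)%N] F.
  by move=> v w vw; apply: NF => i /= /andP[_ iN]; apply: vw.
rewrite -(subnKC Nn) (@expect_iota_stable N.+1 0 N.+1) //; last exact: leq_addr.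
rewrite -[iota 0 N.+1]/(0%N :: iota 1 N) -[LHS]/(avg Q 0 (expect Q (iota 1 N) F) u).
by apply: (depends_on_avg Q0 u (depends_on_expect Q (iota 1 N) NF)).
Qed.

Variables (H : nat -> (nat -> nat) -> R) (n : nat -> nat) (C : R) (u0 : nat -> nat).
Hypotheses (H_mono : forall M u, H M u <= H M.+1 u)
  (H_dep : forall M, depends_on [pred i | (i < n M)%N] (H M))
  (H_le : forall M, expect Q (iota 0 (n M)) (H M) u0 <= C).

(** Method of conditional expectations: with the digits below [i] frozen as in [u], every [H M]
    still averages to at most [C] over the remaining digits that it reads. *)
Let good i u := forall M l, (n M <= i + l)%N -> expect Q (iota i l) (H M) u <= C.

(* If every digit were bad, the largest of the finitely many witnesses would contradict
   the bound on the average. *)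
Lemma greedy_step i u : good i u -> exists d : 'I_(Q i), good i.+1 (upd u i d).
Proof.
move=> gu; apply: contrapT => /forallNP bad.
have /choice[f hf] : forall d : 'I_(Q i), exists Ml : nat * nat, (n Ml.1 <= i.+1 + Ml.2)%N /\
    C < expect Q (iota i.+1 Ml.2) (H Ml.1) (upd u i d).
  move=> d; have /existsNP[M /existsNP[l /not_implyP[h1 /negP]]] := bad d.
  by rewrite -ltNge => h2; exists (M, l).
pose M := \max_(d < Q i) (f d).1.
pose l := maxn (n M) (\max_(d < Q i) (f d).2).
have Hle M1 M2 v : (M1 <= M2)%N -> H M1 v <= H M2 v.
  by move=> /subnK <-; elim: (M2 - M1)%N => //= k IH; apply: le_trans IH _.
have key (d : 'I_(Q i)) : C < expect Q (iota i.+1 l) (H M) (upd u i d).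
  have [h1 h2] := hf d; apply: (lt_le_trans h2).
  rewrite -(expect_iota_stable (l' := l) _ (@H_dep _) h1); last first.
    by rewrite leq_max; apply/orP; right; apply: (leq_bigmax d).
  by apply: expect_le => // v; apply: Hle; apply: (leq_bigmax d).
have : expect Q (iota i l.+1) (H M) u <= C.
  by apply: gu; rewrite addnS; apply: leqW; rewrite -[n M]add0n leq_add // leq_maxl.
rewrite /= leNgt => /negP; apply.
rewrite -[ltLHS](avg_cst Q0 i C u) ltr_pM2r ?invr_gt0 ?ltr0n //.
have Qi : (0 < Q i)%N by [].
apply: ltr_sum => [|d _]; last exact: key.
by apply/hasP; exists (Ordinal Qi) => //; rewrite mem_index_enum.
Qed.

Lemma greedy_choice : exists u, (forall i, (u i < Q i)%N) /\ forall M, H M u <= C.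
Proof.
have /choice[nxt hnxt] : forall iu : nat * (nat -> nat), exists d,
    (d < Q iu.1)%N /\ (good iu.1 iu.2 -> good iu.1.+1 (upd iu.2 iu.1 d)).
  move=> [i u] /=; have [/greedy_step[d hd]|ng] := pselect (good i u).
    by exists d; split.
  by exists 0%N.
(* [st i] has its first [i] digits chosen and later updates never revisit them, so the limit
   sequence agrees with [st (n M)] on everything that [H M] reads. *)
pose st := fix st i := if i is j.+1 then upd (st j) j (nxt (j, st j)) else u0.
have gst i : good i (st i).
  elim: i => [|i IH] /=; last exact: (hnxt (i, st i)).2 IH.
  move=> M l; rewrite add0n => nl; have nn : (n M <= 0 + n M)%N by [].
  by rewrite (expect_iota_stable _ (@H_dep M) nn nl).
have stab i j : (i < j)%N -> st j i = st i.+1 i.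
  elim: j => // j IH; rewrite ltnS leq_eqVlt => /orP[/eqP -> //|ij].
  by rewrite -IH //= /upd; case: eqP => // ji; move: ij; rewrite ji ltnn.
exists (fun i => st i.+1 i); split=> [i|M].
  by rewrite /= /upd eqxx; exact: (hnxt (i, st i)).1.
rewrite (H_dep (v := st (n M))); last by move=> i /= iM; rewrite (stab i (n M)).
(* At stage [n M] no digit is left to average, so the invariant bounds [H M] itself. *)
have := gst (n M) M 0%N; rewrite addn0 /=; exact.
Qed.

End Greedy.

(** * Exchange of digit averages with integrals *)

Section AverageIntegral.
Context {R : realType}.
Variable Q : nat -> nat.
Hypothesis Q0 : forall i, (0 < Q i)%N.
Local Notation mu := (@lebesgue_measure R).

Lemma integrable_bounded (A : set R) (f : R -> R) (B : R) :
  measurable A -> (mu A < +oo)%E -> measurable_fun setT f -> (forall x, 0 <= f x <= B) ->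
  mu.-integrable A (EFin \o f).
Proof.
move=> mA A_fin mf fB; apply: measurable_bounded_integrable => //.
  exact: measurable_funTS.
exists B; split; first exact: num_real.
by move=> M BM x _ /=; have /andP[f0 f1] := fB x; rewrite ger0_norm // (le_trans f1) // ltW.
Qed.

Lemma Rintegral_sum I (r : seq I) (A : set R) (f : I -> R -> R) (B : R) :
  measurable A -> (mu A < +oo)%E -> (forall i, measurable_fun setT (f i)) ->
  (forall i x, 0 <= f i x <= B) ->
  \int[mu]_(x in A) (\sum_(i <- r) f i x) = \sum_(i <- r) \int[mu]_(x in A) f i x.
Proof.
move=> mA A_fin mf fB; elim: r => [|i r IH].
  rewrite big_nil; under eq_Rintegral do rewrite big_nil.
  by rewrite Rintegral_cst // mul0r.
rewrite big_cons -IH -RintegralD //.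
- by apply: eq_Rintegral => x _; rewrite big_cons.
- exact: (integrable_bounded mA A_fin (mf i) (fB i)).
- apply: (@integrable_bounded _ _ (\sum_(j <- r) B)) => //.
    by apply: measurable_sum => j.
  move=> x; rewrite sumr_ge0 ?ler_sum // => j _; by case/andP: (fB j x).
Qed.

Lemma expect_bounded s (F : (nat -> nat) -> R) (B : R) u :
  (forall v, 0 <= F v <= B) -> 0 <= expect Q s F u <= B.
Proof.
move=> FB; rewrite -{1}(expect_cst Q0 s 0 u) -[X in _ && (_ <= X)](expect_cst Q0 s B u).
by apply/andP; split; apply: expect_le => // v; case/andP: (FB v).
Qed.

Lemma expect_measurable s (F : (nat -> nat) -> R -> R) u :
  (forall v, measurable_fun setT (F v)) ->
  measurable_fun setT (fun x => expect Q s (F^~ x) u).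
Proof.
move=> mF; elim: s u => [|i s IH] u; first exact: mF.
by apply: measurable_funM => //; apply: measurable_sum => d; apply: IH.
Qed.

Lemma expect_Rintegral s (A : set R) (F : (nat -> nat) -> R -> R) (B : R) u :
  measurable A -> (mu A < +oo)%E -> (forall v, measurable_fun setT (F v)) ->
  (forall v x, 0 <= F v x <= B) ->
  expect Q s (fun v => \int[mu]_(x in A) F v x) u =
  \int[mu]_(x in A) expect Q s (F^~ x) u.
Proof.
move=> mA A_fin mF FB; elim: s u => // i s IH u.
have mE v : measurable_fun setT (fun x => expect Q s (F^~ x) v) by apply: expect_measurable.
have bE v x : 0 <= expect Q s (F^~ x) v <= B by apply: expect_bounded.
rewrite expect_cons; under eq_bigr do rewrite IH.
rewrite -(@Rintegral_sum 'I_(Q i) (index_enum _) A (fun d x => expect Q s (F^~ x) (upd u i d)) B) //.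
rewrite -RintegralZr //.
apply: (@integrable_bounded _ _ (\sum_(d < Q i) B)) => //.
  by apply: measurable_sum => d.
by move=> x; rewrite sumr_ge0 ?ler_sum // => d _; case/andP: (bE (upd u i d) x).
Qed.

End AverageIntegral.

(** * Almost-everywhere convergence from summable integrals *)

Section Summability.
Context {R : realType}.
Local Notation mu := (@lebesgue_measure R).

(** By monotone convergence the sum of the series of the [f m] has a finite integral over [A], so
    the series converges almost everywhere on [A] and its terms tend to 0. *)
Lemma ae_cvg0_of_summable_integrals (A : set R) (f : nat -> R -> R) (B : nat -> R) (C : R) :
  measurable A -> (mu A < +oo)%E -> (forall m, measurable_fun setT (f m)) ->
  (forall m x, 0 <= f m x <= B m) ->
  (forall M, \sum_(m < M) \int[mu]_(x in A) f m x <= C) ->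
  {ae mu, forall x, A x -> (fun m => f m x) @ \oo --> (0 : R)}.
Proof.
move=> mA A_fin mf fB fC.
have If m : mu.-integrable A (EFin \o f m) by apply: (integrable_bounded mA A_fin (mf m) (fB m)).
pose g x := (\sum_(m <oo) (f m x)%:E)%E.
have g0 x : (0 <= g x)%E by apply: nneseries_ge0 => m _ _; rewrite lee_fin; case/andP: (fB m x).
have mfE m : measurable_fun A (fun x => (f m x)%:E).
  by apply/measurable_EFinP; apply: measurable_funTS.
have ig : (\int[mu]_(x in A) g x = \sum_(m <oo) \int[mu]_(x in A) (f m x)%:E)%E.
  by apply: integral_nneseries => // m x _; rewrite lee_fin; case/andP: (fB m x).
have ig_fin : (\int[mu]_(x in A) g x < +oo)%E.
  rewrite ig; apply: (@le_lt_trans _ _ C%:E); last exact: ltry.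
  apply: lime_le; first by apply: is_cvg_nneseries => m _ _; apply: integral_ge0 => x _;
    rewrite lee_fin; case/andP: (fB m x).
  apply: nearW => M; rewrite big_mkord.
  apply: (@le_trans _ _ (\sum_(m < M) \int[mu]_(x in A) f m x)%:E); last by rewrite lee_fin.
  rewrite -sumEFin; apply: lee_sum => m _.
  rewrite /Rintegral fineK; [exact: lexx | by apply: integrable_fin_num (If m)].
have mg : measurable_fun A g.
  by apply: ge0_emeasurable_sum => // m x _ _; rewrite lee_fin; case/andP: (fB m x).
have Ig : mu.-integrable A g.
  apply/integrableP; split => //; under eq_integral do rewrite gee0_abs //.
  exact: ig_fin.
have : {ae mu, forall x, A x -> g x \is a fin_num} by apply: integrable_ae.
apply: filterS; first exact: (ae_filter_ringOfSetsType mu).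
move=> x h /h {h} gx.
apply: cvg_series_cvg_0; apply: nondecreasing_is_cvgn.
  apply/nondecreasing_seqP => n; rewrite /series /= big_nat_recr //= lerDl.
  by case/andP: (fB n x).
exists (fine (g x)) => _ [n _ <-]; rewrite -lee_fin fineK //.
rewrite /series /= -sumEFin; apply: nneseries_lim_ge => m _ _.
by rewrite lee_fin; case/andP: (fB m x).
Qed.

End Summability.

Lemma sum_inv_sq_le {R : realType} (M : nat) : \sum_(m < M) (m.+1%:R ^+ 2)^-1 <= 2 :> R.
Proof.
case: M => [|M]; first by rewrite big_ord0.
suff h : \sum_(m < M.+1) (m.+1%:R ^+ 2)^-1 <= 2 - M.+1%:R^-1 :> R.
  by apply: (le_trans h); rewrite gerBl invr_ge0.
elim: M => [|M IH].
  by rewrite big_ord_recr big_ord0 /= expr1n add0r invr1; lra.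
rewrite big_ord_recr /=; apply: (le_trans (lerD IH (lexx _))).
have x0 : 0 < M.+1%:R :> R by rewrite ltr0n.
rewrite -(natr1 M.+1); move: M.+1%:R x0 => x x0 {IH}.
have h : x^-1 - (x + 1)^-1 = (x * (x + 1))^-1 by field; rewrite !gt_eqF //; lra.
suff : ((x + 1) ^+ 2)^-1 <= (x * (x + 1))^-1 by lra.
by rewrite lef_pV2 ?posrE ?exprn_gt0 ?mulr_gt0 //; nra.
Qed.

Lemma sum_geom_half_le {R : realType} (M : nat) : \sum_(p < M) (2 ^+ p)^-1 <= 2 :> R.
Proof.
suff -> : \sum_(p < M) (2 ^+ p)^-1 = 2 - 2 / 2 ^+ M :> R by rewrite gerBl divr_ge0.
elim: M => [|M IH]; first by rewrite big_ord0 expr0 divr1 subrr.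
rewrite big_ord_recr /= IH exprS.
by field; rewrite expf_neq0.
Qed.

Section Derandomization.
Context {R : realType}.
Variable Q : nat -> nat.
Hypothesis Q0 : forall i, (0 < Q i)%N.
Local Notation mu := (@lebesgue_measure R).

(* A substitute for Fubini's theorem on the space of digit sequences times the real line. *)
Theorem derandomization (D : nat -> nat -> (nat -> nat) -> R -> R) (B : nat -> nat -> R)
    (n : nat -> nat -> nat) (u0 : nat -> nat) :
  (forall p m u, measurable_fun setT (D p m u)) ->
  (forall p m u x, 0 <= D p m u x <= B p m) ->
  (forall p m x, depends_on [pred i | (i < n p m)%N] (fun u => D p m u x)) ->
  {ae mu, forall x, forall p, exists C : R, forall m,
     expect Q (iota 0 (n p m)) (fun u => D p m u x) u0 <= C / m.+1%:R ^+ 2} ->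
  exists u, (forall i, (u i < Q i)%N) /\
    {ae mu, forall x, forall p, (fun m => D p m u x) @ \oo --> (0 : R)}.
Proof.
move=> mD DB Ddep Dsum.
pose V p m x := expect Q (iota 0 (n p m)) (fun u => D p m u x) u0.
have mV p m : measurable_fun setT (V p m).
  by apply: (@expect_measurable R Q (iota 0 (n p m)) (D p m)) => v.
have VB p m x : 0 <= V p m x <= B p m by apply: expect_bounded => // v.
(* The constant in the hypothesis depends on [x], and the line has infinite measure. Both are cured
   by the sets where [|x|] and the constant are at most [l]; for each [p], almost every [x] lies in
   one of them. *)
pose A p l : set R := `[- l%:R, l%:R]%classic `&`
   \bigcap_m [set x | V p m x <= l%:R / m.+1%:R ^+ 2].
have mA p l : measurable (A p l).
  apply: measurableI; first exact: measurable_itv.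
  apply: bigcap_measurable => // m _.
  rewrite -[X in measurable X]setTI.
  exact: (measurable_fun_ler (mV p m) (measurable_cst _)).
have A_le p l : (mu (A p l) <= (l%:R + l%:R)%:E)%E.
  apply: (@le_trans _ _ (mu `[- l%:R, l%:R]%classic)).
    apply: le_measure; [by rewrite inE; exact: mA | by rewrite inE; exact: measurable_itv | exact: subIsetl].
  rewrite lebesgue_measure_itv /= lte_fin; case: ifP => _.
    by rewrite -EFinB opprK.
  by rewrite lee_fin addr_ge0.
have A_fin p l : (mu (A p l) < +oo)%E by apply: le_lt_trans (A_le p l) (ltry _).
pose a p l : R := fine (mu (A p l)).
have a0 p l : 0 <= a p l by apply: fine_ge0.
pose I p l m u := \int[mu]_(x in A p l) D p m u x.
have I0 p l m u : 0 <= I p l m u.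
  by apply: Rintegral_ge0 => x _; case/andP: (DB p m u x).
have EI p l m : expect Q (iota 0 (n p m)) (I p l m) u0 <= l%:R / m.+1%:R ^+ 2 * a p l.
  rewrite (@expect_Rintegral R Q _ _ (A p l) (D p m) (B p m)) // -Rintegral_cst //.
  apply: le_Rintegral => //.
  - exact: mA.
  - exact: (integrable_bounded (mA p l) (A_fin p l) (mV p m) (VB p m)).
  - apply: (@integrable_bounded R (A p l) (fun=> l%:R / m.+1%:R ^+ 2) (l%:R / m.+1%:R ^+ 2)) => // x.
    by rewrite lexx andbT divr_ge0 // exprn_ge0.
  - by move=> x [_ /(_ m Logic.I)].
  - exact: mA.
have Idep p l m : depends_on [pred i | (i < n p m)%N] (I p l m).
  by move=> u v uv; apply: eq_Rintegral => x _; apply: Ddep.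
(* The weights leave at most [2 * 2 ^ (- p) * 2 ^ (- l)] for each pair, the 2 bounding the sum of
   inverse squares; summation over [p] and [l] gives the bound 8. The summand 1 keeps the
   denominator positive when [A p l] is null. *)
pose w p l : R := (2 ^+ p)^-1 * (2 ^+ l)^-1 / (1 + l%:R * a p l).
have wden p l : 0 < 1 + l%:R * a p l by rewrite ltr_wpDr // mulr_ge0.
have w0 p l : 0 < w p l by rewrite /w divr_gt0 // mulr_gt0 // invr_gt0 exprn_gt0.
pose H M u := \sum_(p < M) \sum_(l < M) w p l * \sum_(m < M) I p l m u.
have S0 p l M u : 0 <= w p l * \sum_(m < M) I p l m u.
  by rewrite mulr_ge0 ?sumr_ge0 // ltW.
have H_mono M u : H M u <= H M.+1 u.
  rewrite /H [leRHS]big_ord_recr /=; apply: ler_wpDr; first by apply: sumr_ge0 => l _; apply: S0.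
  apply: ler_sum => p _; rewrite [leRHS]big_ord_recr /=; apply: ler_wpDr; first exact: S0.
  apply: ler_sum => l _.
  by rewrite ler_pM2l // [leRHS]big_ord_recr /= lerDl.
pose N M := \max_(p < M) \max_(m < M) n p m.
have nN M (p m : 'I_M) : (n p m <= N M)%N.
  by apply: leq_trans (leq_bigmax p); apply: (leq_bigmax (F := fun m : 'I_M => n p m) m).
have H_dep M : depends_on [pred i | (i < N M)%N] (H M).
  move=> u v uv; apply: eq_bigr => p _; apply: eq_bigr => l _; congr (_ * _).
  apply: eq_bigr => m _; apply: Idep => i /= im; apply: uv => /=.
  exact: leq_trans im (nN M p m).
have H_le M : expect Q (iota 0 (N M)) (H M) u0 <= 8.
  rewrite /H expect_sum //.
  apply: (@le_trans _ _ (\sum_(p < M) \sum_(l < M) (2 ^+ p)^-1 * (2 ^+ l)^-1 * 2)); last first.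
    under eq_bigr do rewrite -mulr_suml -mulr_sumr.
    rewrite -!mulr_suml; have := @sum_geom_half_le R M; set g := \sum_(p < M) _ => g2.
    have g0 : 0 <= g by apply: sumr_ge0 => i _; rewrite invr_ge0 exprn_ge0.
    have : g * g <= 2 * 2 by apply: ler_pM.
    lra.
  apply: ler_sum => p _; rewrite expect_sum //; apply: ler_sum => l _.
  rewrite expectZ // expect_sum //.
  apply: (@le_trans _ _ (w p l * (l%:R * a p l * 2))).
    rewrite ler_pM2l //.
    apply: (@le_trans _ _ (\sum_(m < M) l%:R * a p l * (m.+1%:R ^+ 2)^-1)).
      apply: ler_sum => m _.
      rewrite (@expect_iota_stable R Q Q0 (n p m) 0 (n p m) (N M) (I p l m) u0 (@Idep p l m) (leqnn _) (nN M p m)).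
      by rewrite mulrAC; apply: EI.
    by rewrite -mulr_sumr; apply: ler_wpM2l; [rewrite mulr_ge0 | apply: sum_inv_sq_le].
  rewrite mulrA ler_pM2r // /w; set z := _ * (2 ^+ l)^-1.
  have z0 : 0 <= z by rewrite mulr_ge0 ?invr_ge0 ?exprn_ge0.
  rewrite mulrAC ler_pdivrMr // ler_wpM2l // lerDr //.
have [u [uQ hu]] := @greedy_choice R Q Q0 H N 8 u0 H_mono H_dep H_le.
exists u; split => //.
have key p l : {ae mu, forall x, A p l x -> (fun m => D p m u x) @ \oo --> (0 : R)}.
  apply: (@ae_cvg0_of_summable_integrals R (A p l) (fun m => D p m u) (B p) (8 / w p l)) => //.
  move=> M; rewrite ler_pdivlMr // mulrC.
  pose K := (p + l + M).+1.
  have pK : (p < K)%N by rewrite /K ltnS -addnA leq_addr.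
  have lK : (l < K)%N by rewrite /K ltnS addnAC leq_addl.
  apply: (le_trans _ (hu K)); rewrite /H (bigD1 (Ordinal pK)) //= (bigD1 (Ordinal lK)) //= -addrA.
  apply: ler_wpDr; first by rewrite addr_ge0 // sumr_ge0 // => ? _; [exact: S0 | apply: sumr_ge0 => ? _; exact: S0].
  rewrite ler_pM2l // -!(big_mkord xpredT (fun m => I p l m u)).
  have MK : (M <= K)%N by rewrite /K leqW // leq_addl.
  by rewrite [leRHS](big_cat_nat (leq0n M) MK) /= lerDl sumr_ge0.
have {key} key : {ae mu, forall x, forall p l, A p l x -> (fun m => D p m u x) @ \oo --> (0 : R)}.
  by apply: ae_foralln => p; apply: ae_foralln => l; apply: key.
move: Dsum; apply: filterS2 key; first exact: (ae_filter_ringOfSetsType mu).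
move=> x hx hC p; have [C hC'] := hC p.
pose l := Num.bound (`|x| + `|C|).
have hl : `|x| + `|C| <= l%:R by apply/ltW/archi_boundP; rewrite addr_ge0.
have xl : `|x| <= l%:R by apply: le_trans hl; rewrite lerDl.
have Cl : C <= l%:R.
  by apply: le_trans (ler_norm C) _; apply: le_trans hl; rewrite lerDr.
apply: (hx p l); split; first by rewrite /= in_itv /= -ler_norml.
move=> m _ /=; apply: (le_trans (hC' m)); apply: ler_wpM2r => //.
Qed.

End Derandomization.

(** * Badly approximable numbers and the width of the perturbation *)

Section LogEstimates.
Context {R : realType}.
Implicit Types (x y s : R).

Lemma ln_ge1BV x : 0 < x -> 1 - x^-1 <= ln x.
Proof.
move=> x0; have h : - 1 < x^-1 - 1 by have := invr_gt0 x; rewrite x0; lra.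
by have := le_ln1Dx h; rewrite addrC subrK lnV ?posrE //; lra.
Qed.

Lemma lnB_ge x y : 0 < x -> 0 < y -> (y - x) / y <= ln y - ln x.
Proof.
move=> x0 y0; rewrite -ln_div ?posrE //.
apply: le_trans (ln_ge1BV (divr_gt0 y0 x0)).
by rewrite invf_div mulrBl divff ?gt_eqF.
Qed.

(** A derivative bound for [t ^ (- s)], taken at the end [y] where the slope is flattest. It comes
    from [exp t >= 1 + t] applied to the power [(x / y) ^ (- s)]. *)
Lemma powRN_sub_ge s x y : 0 < s -> 0 < x <= y ->
  s * (y - x) / (y * y `^ s) <= x `^ (- s) - y `^ (- s).
Proof.
move=> s0 /andP[x0 xy]; have y0 : 0 < y by apply: lt_le_trans xy.
have yx : x = y * (x / y) by rewrite mulrCA divff ?mulr1 // gt_eqF.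
rewrite {2}yx powRM ?(ltW y0) ?divr_ge0 ?(ltW x0) ?(ltW y0) //.
rewrite -[X in _ <= _ - X]mulr1 -mulrBr [y `^ (- s)]powRN.
have P0 : 0 < y `^ s by apply: powR_gt0.
have -> : s * (y - x) / (y * y `^ s) = (y `^ s)^-1 * (s * ((y - x) / y)).
  by rewrite invfM; ring.
rewrite ler_pM2l ?invr_gt0 // lerBrDl.
apply: (@le_trans _ _ (1 + s * (ln y - ln x))).
  by rewrite lerD2l ler_pM2l // lnB_ge.
rewrite /powR gt_eqF ?divr_gt0 //.
apply: le_trans (expR_ge1Dx _) _; rewrite ln_div ?posrE // ler_expR.
by rewrite mulNr -mulrN opprB.
Qed.

Lemma lnln_tends (B : R) : exists h0 : nat, forall x, h0%:R <= x -> B <= ln (ln x).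
Proof.
exists (Num.bound (expR (expR B))) => x hx.
have e0 := expR_gt0 (expR B).
have h1 : expR (expR B) <= x.
  by apply: le_trans hx; apply/ltW/archi_boundP/expR_ge0.
have x0 : 0 < x by apply: lt_le_trans h1.
have h2 : expR B <= ln x by rewrite -[leLHS]expRK ler_ln ?posrE.
by rewrite -[leLHS]expRK ler_ln ?posrE ?expR_gt0 // (lt_le_trans _ h2) // expR_gt0.
Qed.

(* Junk values: [ln] vanishes on nonpositive numbers, so the lemmas below ask for
   [1 <= ln (ln h)]. *)
Definition log_weight s (h : nat) : R := ln h%:R * (ln (ln h%:R)) `^ (1 + s).

Definition lnln_tail s (h : nat) : R := (ln (ln h%:R)) `^ (- s).

(* The inverses of [h * log_weight s h] are dominated by a telescoping series, hence
   summable, as Borel-Cantelli requires. *)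
Lemma lnln_tail_sub_ge s (h : nat) : 0 < s -> (0 < h)%N -> 1 <= ln (ln h%:R : R) ->
  s / (h.+1%:R * log_weight s h.+1) <= lnln_tail s h - lnln_tail s h.+1.
Proof.
move=> s0 h0 v1.
have hR : 0 < h%:R :> R by rewrite ltr0n.
have h1R : 0 < h.+1%:R :> R by rewrite ltr0n.
have a0 : 0 < ln (h%:R : R).
  rewrite ltNge; apply/negP => a_le; move: v1.
  by rewrite ln0 // ler10.
have ab : ln (h%:R : R) <= ln h.+1%:R by rewrite ler_ln ?posrE // ler_nat.
have b0 : 0 < ln (h.+1%:R : R) by apply: lt_le_trans ab.
have v12 : ln (ln (h%:R : R)) <= ln (ln h.+1%:R) by rewrite ler_ln ?posrE.
have e1 := @lnB_ge h%:R h.+1%:R hR h1R.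
have e2 := lnB_ge a0 b0.
have v10 : 0 < ln (ln (h%:R : R)) by apply: lt_le_trans v1.
have := @powRN_sub_ge s _ _ s0 (introT andP (conj v10 v12)).
rewrite -/(lnln_tail s h) -/(lnln_tail s h.+1); apply: le_trans.
rewrite /log_weight; set b := ln h.+1%:R; set v2 := ln b.
have v20 : 0 < v2 by apply: lt_le_trans v12.
rewrite powRD; last by apply/implyP => _; rewrite gt_eqF.
rewrite powRr1 ?(ltW v20) //.
set P := v2 * _; have P0 : 0 < P by rewrite mulr_gt0 // powR_gt0.
rewrite -[leRHS]mulrA ler_pM2l // mulrA invfM ler_pM2r ?invr_gt0 //.
apply: le_trans e2; rewrite invfM ler_pM2r ?invr_gt0 //.
apply: le_trans e1; rewrite -[h.+1%:R]natr1 addrAC subrr add0r mul1r //.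
Qed.

Lemma log_weight_gt0 s (h : nat) : 1 <= ln (ln h%:R : R) -> 0 < log_weight s h.
Proof.
move=> v1; have v0 : 0 < ln (ln (h%:R : R)) by apply: lt_le_trans v1.
rewrite mulr_gt0 ?powR_gt0 // ltNge; apply/negP => a_le.
by move: v1; rewrite ln0 // ler10.
Qed.

Lemma log_weight_le s (h h' : nat) : 0 <= s -> (0 < h <= h')%N -> 1 <= ln (ln h%:R : R) ->
  log_weight s h <= log_weight s h'.
Proof.
move=> s0 /andP[h0 hh'] v1.
have h'0 : (0 < h')%N by apply: leq_trans hh'.
have a0 : 0 < ln (h%:R : R).
  by rewrite ltNge; apply/negP => a_le; move: v1; rewrite ln0 // ler10.
have ab : ln (h%:R : R) <= ln h'%:R by rewrite ler_ln ?posrE ?ltr0n // ler_nat.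
have b0 : 0 < ln (h'%:R : R) by apply: lt_le_trans ab.
have v12 : ln (ln (h%:R : R)) <= ln (ln h'%:R) by rewrite ler_ln ?posrE.
apply: ler_pM => //; rewrite ?(ltW a0) ?powR_ge0 //.
apply: ge0_ler_powR => //; rewrite ?nnegrE; lra.
Qed.

End LogEstimates.

(** * The convergence half of Khinchin's theorem *)

Section Khinchin.
Context {R : realType}.
Local Notation mu := (@lebesgue_measure R).

(** The centres are [p / h] with [|p| <= T h + 1], the numerator being shifted to a natural number.
    For [|x| <= T] and [d <= 1] no other [p] can satisfy [|h x - p| < d]. *)
Definition near_rationals (T h : nat) (d : R) : set R :=
  \big[setU/set0]_(i < (2 * (T * h).+1).+1)
    `[(i%:R - (T * h).+1%:R) / h%:R - d / h%:R, (i%:R - (T * h).+1%:R) / h%:R + d / h%:R]%classic.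

Lemma measurable_near_rationals T h d : measurable (near_rationals T h d).
Proof. by apply: bigsetU_measurable => i _; apply: measurable_itv. Qed.

Lemma near_rationals_le T h d : (0 < h)%N -> 0 <= d ->
  (mu (near_rationals T h d) <= ((4 * T%:R + 6) * d)%:E)%E.
Proof.
move=> h0 d0; have hR : 0 < h%:R :> R by rewrite ltr0n.
pose F i : set R := `[(i%:R - (T * h).+1%:R) / h%:R - d / h%:R,
   (i%:R - (T * h).+1%:R) / h%:R + d / h%:R]%classic.
have mF i : measurable (F i) by apply: measurable_itv.
apply: (@le_trans _ _ (\sum_(i < (2 * (T * h).+1).+1) mu (F i))%E).
  apply: content_subadditive.
  - by move=> k _; apply: mF.
  - exact: measurable_near_rationals.
  - by [].
apply: (@le_trans _ _ (\sum_(i < (2 * (T * h).+1).+1) (2 * d / h%:R)%:E)%E).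
  apply: lee_sum => i _; rewrite /F lebesgue_measure_itv /=; case: ifP => _.
    by rewrite -EFinB lee_fin; lra.
  by rewrite lee_fin divr_ge0 ?mulr_ge0.
rewrite sumEFin lee_fin sumr_const card_ord -[_ *+ _]mulr_natr.
have -> : (2 * (T * h).+1).+1%:R = 2 * (T%:R * h%:R + 1) + 1 :> R.
  by rewrite -[in LHS]natr1 natrM -[(T * h).+1%:R]natr1 natrM.
rewrite mulrAC ler_pdivrMr //.
have : 1 * d <= h%:R * d by rewrite ler_wpM2r // ler1n.
lra.
Qed.

Lemma near_rationalsP T h (p : int) (d x : R) : (0 < h)%N -> d <= 1 -> `|x| <= T%:R ->
  `|h%:R * x - p%:~R| < d -> near_rationals T h d x.
Proof.
move=> h0 d1 xT hd; have hR : 0 < h%:R :> R by rewrite ltr0n.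
pose K := (T * h).+1.
have hx : `|h%:R * x| <= T%:R * h%:R.
  by rewrite normrM [X in X * _](ger0_norm (ltW hR)) [leLHS]mulrC ler_pM2r.
have pK : `|p%:~R : R| <= K%:R.
  rewrite /K -natr1 natrM; have := ler_distD (h%:R * x) p%:~R (0 : R).
  rewrite !subr0 distrC; lra.
have [i hi] : exists i : nat, p = i%:Z - K%:Z.
  exists (absz (p + K%:Z)); rewrite gez0_abs ?addrK //.
  move: pK; rewrite ler_norml => /andP[pK _].
  by rewrite -(@ler_int R) rmorphD /= -pmulrn; lra.
have iK : (i < (2 * K).+1)%N.
  move: pK; rewrite ler_norml => /andP[_ pK].
  rewrite ltnS -(ler_nat R) natrM; move: pK; rewrite hi rmorphB /= -!pmulrn; lra.
pose F i : set R := `[(i%:R - K%:R) / h%:R - d / h%:R, (i%:R - K%:R) / h%:R + d / h%:R]%classic.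
rewrite /near_rationals -(bigcup_mkord _ F); exists i => //; rewrite /F /= in_itv /=.
have -> : i%:R - K%:R = p%:~R :> R by rewrite hi rmorphB /= -!pmulrn.
move: hd; rewrite -!mulrBl -!mulrDl ler_pdivrMr // ler_pdivlMr // ltr_norml; lra.
Qed.

(** Borel-Cantelli. The radii [d n] are differences of [lnln_tail], so their sum telescopes, and
    they dominate [s] divided by [h * log_weight s h]; hence the constant [s] on the left of the
    conclusion. *)
Lemma khinchin_ae (s : R) : 0 < s ->
  {ae mu, forall a, exists h0 : nat, forall h (p : int), (h0 <= h)%N ->
     s <= h%:R * log_weight s h * `|h%:R * a - p%:~R|}.
Proof.
move=> s0; have [h1 hh1] := lnln_tends (1 : R).
pose h0 := h1.+1.
have v1 h : (h0 <= h)%N -> 1 <= ln (ln (h%:R : R)).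
  by move=> hh; apply: hh1; rewrite ler_nat ltnW.
pose g := @lnln_tail R s.
have g01 h : (h0 <= h)%N -> 0 <= g h <= 1.
  move=> /v1 vh; rewrite /g /lnln_tail powR_ge0 /=.
  rewrite -[leRHS](powRr0 (ln (ln h%:R))); apply: ler_powR => //; lra.
pose d n := g (h0 + n)%N - g (h0 + n).+1.
have sd n : s / ((h0 + n).+1%:R * log_weight s (h0 + n).+1) <= d n.
  by apply: lnln_tail_sub_ge => //; apply: v1; apply: leq_addr.
have W0 h : (h0 <= h)%N -> 0 < log_weight s h by move=> /v1; apply: log_weight_gt0.
have d01 n : 0 <= d n <= 1.
  have -> /= : 0 <= d n.
    apply: le_trans (sd n); apply: divr_ge0; first exact: ltW.
    by apply: mulr_ge0 => //; apply/ltW/W0; rewrite leqW // leq_addr.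
  have /andP[_ g1] := g01 (h0 + n)%N (leq_addr _ _).
  have /andP[g2 _] := g01 (h0 + n).+1 (leqW (leq_addr _ _)).
  by rewrite /d lerBlDr (le_trans g1) // lerDl.
have sumd M : \sum_(n < M) d n <= 1.
  have -> : \sum_(n < M) d n = g h0 - g (h0 + M)%N.
    elim: M => [|M IH]; first by rewrite big_ord0 addn0 subrr.
    by rewrite big_ord_recr /= IH /d addnS addrA subrK.
  have := g01 h0 (leqnn _); have := g01 (h0 + M)%N (leq_addr _ _); lra.
have key (T : nat) : {ae mu, forall a, `|a| <= T%:R -> exists h0 : nat, forall h (p : int), (h0 <= h)%N ->
     s <= h%:R * log_weight s h * `|h%:R * a - p%:~R|}.
  pose F n := near_rationals T (h0 + n).+1 (d n).
  have mF n : measurable (F n) by apply: measurable_near_rationals.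
  have F0 : mu (lim_sup_set F) = 0%E.
    apply: lim_sup_set_cvg0 => //.
    apply: (@le_lt_trans _ _ (4 * T%:R + 6)%:E); last exact: ltry.
    apply: lime_le; first exact: is_cvg_nneseries.
    apply: nearW => M; rewrite big_mkord.
    apply: (@le_trans _ _ (\sum_(n < M) ((4 * T%:R + 6) * d n)%:E)%E).
      by apply: lee_sum => n _; apply: near_rationals_le => //; case/andP: (d01 n).
    by rewrite sumEFin lee_fin -mulr_sumr ler_piMr // addr_ge0 // mulr_ge0.
  exists (lim_sup_set F); split => //.
    apply: bigcap_measurable => // k _; apply: bigcup_measurable => j _; exact: mF.
  move=> a /= /not_implyP[aT /forallNP na] n _.
  have /existsNP[h /existsNP[p /not_implyP[hn /negP]]] := na (h0 + n).+1.
  rewrite -ltNge => hlt; pose m := (h - h0.+1)%N.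
  have hm : h = (h0 + m).+1 by rewrite /m -addSn subnKC //; apply: leq_trans hn; rewrite ltnS leq_addr.
  exists m; first by rewrite /= -(leq_add2l h0.+1) !addSn -hm.
  rewrite /F -hm; apply: (near_rationalsP (p := p)) => //.
  - by rewrite hm.
  - by case/andP: (d01 m).
  apply: lt_le_trans (sd m); rewrite -hm.
  have hh : (h0 <= h)%N by rewrite hm leqW // leq_addr.
  have hpos : (0 < h)%N by apply: leq_trans hh.
  rewrite ltr_pdivlMr; first by rewrite mulrC.
  by rewrite mulr_gt0 ?W0 // ltr0n.
have {}key : {ae mu, forall a, forall T : nat, `|a| <= T%:R ->
    exists h0 : nat, forall h (p : int), (h0 <= h)%N ->
     s <= h%:R * log_weight s h * `|h%:R * a - p%:~R|} by exact: ae_foralln.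
move: key; apply: filterS; first exact: (ae_filter_ringOfSetsType mu).
move=> a ha; apply: (ha (Num.bound `|a|)).
by apply/ltW/archi_boundP.
Qed.

End Khinchin.

(** * The width of the perturbation *)

Section Width.
Context {R : realType}.
Variables (s : R).
Hypothesis s0 : 0 < s.

Let v (j : nat) : R := ln (ln (2 ^ j)%:R).
Let b (j : nat) : R := ln (2 ^ j)%:R.

Lemma lnln_pow2_tends (B : R) : exists j0 : nat, forall j, (j0 <= j)%N -> B <= v j.
Proof.
have [h0 h] := lnln_tends B; exists h0 => j hj; apply: h.
by rewrite ler_nat; apply: leq_trans hj _; rewrite ltnW // ltn_expl.
Qed.

Lemma ln_ge_lnln (x : R) : 0 < ln (ln x) -> ln (ln x) <= ln x.
Proof.
move=> v0; apply/ltW/ln_sublinear; rewrite ltNge; apply/negP => h.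
by move: v0; rewrite ln0 // ltxx.
Qed.

Lemma powR_tends (B : R) : exists j0 : nat, forall j, (j0 <= j)%N -> 1 <= v j /\ B <= v j `^ s.
Proof.
pose B1 := Num.max 1 B; have B11 : 1 <= B1 by rewrite le_max lexx.
have [j0 h] := lnln_pow2_tends (B1 `^ s^-1); exists j0 => j /h hv.
have h1 : 1 <= B1 `^ s^-1.
  by rewrite -[leLHS](powRr0 B1); apply: ler_powR => //; rewrite invr_ge0 ltW.
have v1 : 1 <= v j by apply: le_trans hv.
split=> //; apply: (@le_trans _ _ B1); first by rewrite le_max lexx orbT.
have -> : B1 = (B1 `^ s^-1) `^ s by rewrite -powRrM mulVf ?gt_eqF // powRr1 // (le_trans ler01).
by apply: ge0_ler_powR; rewrite ?nnegrE ?(ltW s0) ?(le_trans ler01).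
Qed.

(** The exponent [1 + 2 s] is halfway between the [1 + s] of the approximation property and the
    [1 + 3 s] of the energy scale; each comparison gains a factor [v j] to the power [s]. *)
Let gam (j : nat) : R := log_weight (2 * s) (2 ^ j) / 2 ^+ j.

Lemma gam_gt0 j : 1 <= v j -> 0 < gam j.
Proof. by move=> h; rewrite divr_gt0 ?exprn_gt0 // log_weight_gt0. Qed.

Lemma gamE j : 2 ^+ j * gam j = log_weight (2 * s) (2 ^ j).
Proof. by rewrite /gam mulrC divfK // expf_neq0. Qed.

Lemma log_weightE t j : 1 <= v j -> log_weight (t + s) (2 ^ j) = log_weight t (2 ^ j) * v j `^ s.
Proof.
move=> v1; rewrite /log_weight addrA powRD ?mulrA //.
by apply/implyP => _; rewrite gt_eqF // (lt_le_trans _ v1).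
Qed.

Lemma gam_small (e : R) : 0 < e -> exists j0 : nat, forall j, (j0 <= j)%N -> gam j <= e.
Proof.
(* With [b j = ln (2 ^ j)], the numerator is at most [b j ^ (n + 1)], while [2 ^ j = exp (b j)] is
   at least [b j ^ (n + 2) / K]; the spare power of [b j] beats [K / e]. *)
move=> e0; pose n := Num.bound (1 + 2 * s).
pose K : R := n.+2`!%:R; have K0 : 0 < K by rewrite ltr0n fact_gt0.
have s0_ := s0; have [j0 h] := lnln_pow2_tends (Num.max 1 (K / e)); exists j0 => j /h.
rewrite ge_max => /andP[v1 vK].
have v0 : 0 < v j by apply: lt_le_trans v1.
have vb : v j <= b j by apply: ln_ge_lnln.
have b1 : 1 <= b j by apply: le_trans vb.
have b0 : 0 < b j by lra.
have hn : v j `^ (1 + 2 * s) <= b j ^+ n.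
  apply: (@le_trans _ _ (v j `^ n%:R)).
    by apply: ler_powR => //; apply/ltW/archi_boundP; lra.
  by rewrite powR_mulrn ?(ltW v0) //; apply: lerXn2r => //; rewrite nnegrE ltW.
have he : b j ^+ n.+2 / K <= 2 ^+ j.
  have := expR_ge1Dxn n.+1 (ltW b0); rewrite lnK ?posrE ?ltr0n ?expn_gt0 // natrX.
  by rewrite -/K; lra.
rewrite ler_pdivrMr ?exprn_gt0 //.
apply: (@le_trans _ _ (b j * b j ^+ n)); first by rewrite ler_pM2l.
have h3 : e * (b j ^+ n.+2 / K) <= e * 2 ^+ j by rewrite ler_pM2l.
apply: le_trans h3.
have P0 : 0 < b j * b j ^+ n by rewrite mulr_gt0 // exprn_gt0.
have -> : e * (b j ^+ n.+2 / K) = (b j * b j ^+ n) * (b j * (e / K)) by rewrite !exprS; ring.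
rewrite ler_peMr ?(ltW P0) //.
have : K / e <= b j by apply: le_trans vb.
by rewrite ler_pdivrMr // mulrA ler_pdivlMr // mul1r.
Qed.

Lemma gam_grow (B : R) : exists j0 : nat, forall j, (j0 <= j)%N ->
  B * log_weight s (2 ^ j) <= 2 ^+ j * gam j.
Proof.
have [j0 h] := powR_tends B; exists j0 => j /h[v1 vB].
rewrite gamE (_ : 2 * s = s + s); last by ring.
by rewrite log_weightE // mulrC ler_pM2l // log_weight_gt0.
Qed.

Lemma gam_grow1 (B : R) : exists j0 : nat, forall j, (j0 <= j)%N -> B <= 2 ^+ j * gam j.
Proof.
have [j0 h] := lnln_pow2_tends (Num.max 1 B); exists j0 => j /h.
rewrite ge_max gamE => /andP[v1 vB]; apply: (le_trans vB).
have v0 : 0 < v j by apply: lt_le_trans v1.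
have vb : v j <= b j by apply: ln_ge_lnln.
have s1 : 1 <= 1 + 2 * s by have := s0; lra.
apply: le_trans (le1r_powR v1 s1) _; rewrite ler_peMl ?powR_ge0 //.
exact: le_trans vb.
Qed.

Lemma gam_lt_gammaN : exists j0 : nat, forall j N, (j0 <= j)%N ->
  (2 ^ j.+1 <= N < 2 ^ j.+2)%N -> 2 * gam j < gammaN (3 * s) N.
Proof.
(* The 8 is the 2 of the statement times the 4 in [N < 4 * 2 ^ j]. *)
have [j0 h] := powR_tends 8; exists j0 => j N /h[v1 v8] /andP[N1 N2].
have J0 : 0 < 2 ^+ j :> R by apply: exprn_gt0.
have v0 : 0 < v j by apply: lt_le_trans v1.
have vb : v j <= b j by apply: ln_ge_lnln.
have b0 : 0 < b j by lra.
have JN : (2 ^ j <= N)%N by apply: leq_trans N1; rewrite leq_exp2l.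
have N0 : (0 < N)%N by apply: leq_trans JN; rewrite expn_gt0.
have NR : 0 < N%:R :> R by rewrite ltr0n.
have NJ : N%:R < 4 * 2 ^+ j :> R.
  by have : N%:R < (2 ^ j.+2)%:R :> R by [rewrite ltr_nat]; rewrite natrX !exprS; lra.
have W : log_weight (3 * s) (2 ^ j) <= ln N%:R * (ln (ln N%:R)) `^ (1 + 3 * s).
  by apply: log_weight_le => //; [have := s0; lra | rewrite expn_gt0].
have g0 : 0 < log_weight (2 * s) (2 ^ j) :> R by apply: log_weight_gt0.
rewrite /gammaN ltr_pdivlMr //; apply: lt_le_trans W.
rewrite (_ : 3 * s = 2 * s + s); last by ring.
rewrite log_weightE //.
apply: (@lt_le_trans _ _ (2 * gam j * (4 * 2 ^+ j))).
  by rewrite ltr_pM2l // mulr_gt0 // gam_gt0.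
have -> : 2 * gam j * (4 * 2 ^+ j) = 8 * (2 ^+ j * gam j) by ring.
by rewrite gamE mulrC ler_pM2l.
Qed.

Lemma width_exists : exists w : nat -> R,
  [/\ forall j, 0 < w j <= 1,
      forall e : R, 0 < e -> exists j0 : nat, forall j, (j0 <= j)%N -> w j <= e,
      forall B : R, exists j0 : nat, forall j, (j0 <= j)%N -> B <= 2 ^+ j * w j,
      forall B : R, exists j0 : nat, forall j, (j0 <= j)%N ->
         B * log_weight s (2 ^ j) <= 2 ^+ j * w j &
      exists j0 : nat, forall j N, (j0 <= j)%N ->
         (2 ^ j.+1 <= N < 2 ^ j.+2)%N -> 2 * w j < gammaN (3 * s) N].
Proof.
have [j1 h1] := lnln_pow2_tends 1; have [j2 h2] := gam_small ltr01.
(* [gam j] is known to be positive and at most 1 only for large [j]; the value 1 before that is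
   harmless because the other requirements are asymptotic. *)
pose j0 := maxn j1 j2; pose w j := if (j0 <= j)%N then gam j else 1.
have wE j : (j0 <= j)%N -> w j = gam j by rewrite /w => ->.
have tail (P : nat -> R -> Prop) : (exists k, forall j, (k <= j)%N -> P j (gam j)) ->
    exists k, forall j, (k <= j)%N -> P j (w j).
  move=> [k h]; exists (maxn j0 k) => j; rewrite geq_max => /andP[hj hk].
  by rewrite wE //; apply: h.
exists w; split.
- move=> j; rewrite /w; case: ifP => [|_]; last by rewrite ltr01 lexx.
  by rewrite geq_max => /andP[/h1 v1 /h2 g1]; rewrite gam_gt0.
- by move=> e e0; apply: (tail (fun _ x => x <= e)); apply: gam_small.
- by move=> B; apply: (tail (fun j x => B <= 2 ^+ j * x)); apply: gam_grow1.
- by move=> B; apply: (tail (fun j x => B * log_weight s (2 ^ j) <= 2 ^+ j * x)); apply: gam_grow.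
- have [k h] := gam_lt_gammaN.
  have [k' h'] := tail (fun j x => forall N, (2 ^ j.+1 <= N < 2 ^ j.+2)%N -> 2 * x < gammaN (3 * s) N)
    (ex_intro _ k (fun j kj N => h j N kj)).
  by exists k' => j N /h'; apply.
Qed.

End Width.

(** * Energy, and correlations along the squares *)

Section Energy.
Context {R : realType}.

(** The identity [(i + t) + k = i + (k + t)] has three free parameters below [m], and the quadruple
    determines them. *)
Lemma add_energy_ge (x : nat -> R) (N m A : nat) (gamma : R) :
  (0 < A)%N -> (0 < m)%N -> (A + 2 * m <= N.+1)%N ->
  (forall i k t, (i < m)%N -> (k < m)%N -> (t < m)%N ->
    `|x (A + (i + t))%N + x (A + k)%N - x (A + i)%N - x (A + (k + t))%N| < gamma) ->
  (m ^ 3 <= add_energy x N gamma)%N.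
Proof.
move=> A0 m0 AN hx.
have N0 : (0 < N)%N by lia.
(* An element of ['I_N] stands for the next integer, hence the predecessor. The default of [insubd]
   is never reached, as [A + n <= N] for [n < 2 m]. *)
pose idx (n : nat) : 'I_N := insubd (Ordinal N0) (A + n).-1.
have idxE n : (n < 2 * m)%N -> (idx n).+1 = (A + n)%N.
  by move=> nm; rewrite val_insubd; case: ltnP; lia.
pose f (q : 'I_m * 'I_m * 'I_m) : 'I_N * 'I_N * 'I_N * 'I_N :=
  (idx (q.1.1 + q.2)%N, idx q.1.2, idx q.1.1, idx (q.1.2 + q.2)%N).
have f_inj : injective f.
  move=> [[i k] t] [[i' k'] t'] [] /= e1 e2 e3 e4.
  have := idxE k; have := idxE k'; have := idxE i; have := idxE i'.
  have := idxE (i + t)%N; have := idxE (i' + t')%N.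
  rewrite e1 e2 e3 {e1 e2 e3 e4}.
  have := ltn_ord i; have := ltn_ord k; have := ltn_ord t.
  have := ltn_ord i'; have := ltn_ord k'; have := ltn_ord t'.
  move=> h1 h2 h3 h4 h5 h6 g1 g2 g3 g4 g5 g6.
  have it : (i' + t' < 2 * m)%N by clear -h1 h3; lia.
  have it' : (i + t < 2 * m)%N by clear -h4 h6; lia.
  have lt2 (z : nat) : (z < m)%N -> (z < 2 * m)%N by clear; lia.
  move: (g1 it) (g2 it') (g3 (lt2 _ h3)) (g4 (lt2 _ h6)) (g5 (lt2 _ h2)) (g6 (lt2 _ h5)).
  move=> -> /addnI e1 -> /addnI e3 -> /addnI e5.
  have ei : i = i' by apply: val_inj.
  have ek : k = k' by apply: val_inj.
  have et : t = t' by apply: val_inj; move: e1; rewrite ei => /addnI.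
  by rewrite ei ek et.
have <- : #|codom f| = (m ^ 3)%N.
  by rewrite card_codom // !card_prod !card_ord !expnS expn0 muln1 mulnA.
apply: subset_leq_card; apply/fintype.subsetP => _ /codomP[[[i k] t] ->].
have := ltn_ord i; have := ltn_ord k; have := ltn_ord t => ht hk hi.
by rewrite inE /= !idxE; [exact: hx|lia..].
Qed.

End Energy.

(** * From squares and rational windows to all [N] and all windows *)

Section CorrelationMonotone.
Context {R : realType}.
Variables (k : nat) (y : nat -> R).

Lemma corr_count_card (lo hi : 'I_k -> R) N : corr_count y lo hi N =
  #|[pred a : {ffun 'I_k.+1 -> 'I_N} | injectiveb a && `[< forall i,
     in_mod1 (y (a ord0).+1 - y (a (lift ord0 i)).+1) (lo i / N%:R) (hi i / N%:R) >]]|%:R.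
Proof. by rewrite /corr_count sumr_const. Qed.

Lemma corr_count_ge0 (lo hi : 'I_k -> R) N : 0 <= corr_count y lo hi N.
Proof. by rewrite corr_count_card. Qed.

(** Both the set of points and the windows grow, so the tuples inject. This sandwiches a count at
    [N] between counts at the two neighbouring squares. *)
Lemma corr_count_le (lo hi lo' hi' : 'I_k -> R) N M : (N <= M)%N ->
  (forall i, lo' i / M%:R <= lo i / N%:R) -> (forall i, hi i / N%:R <= hi' i / M%:R) ->
  corr_count y lo hi N <= corr_count y lo' hi' M.
Proof.
move=> NM hlo hhi; rewrite !corr_count_card ler_nat.
pose f (a : {ffun 'I_k.+1 -> 'I_N}) : {ffun 'I_k.+1 -> 'I_M} :=
  [ffun i => widen_ord NM (a i)].
have f_inj : injective f.
  move=> a b /ffunP ab; apply/ffunP => i; have := ab i; rewrite !ffunE.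
  by move/(congr1 val) => /= /val_inj.
rewrite -(fintype.card_image f_inj); apply: subset_leq_card.
apply/fintype.subsetP => _ /fintype.imageP[a + ->]; rewrite !inE => /andP[/injectiveP ainj /asboolP h].
apply/andP; split.
  apply/injectiveP => i j; rewrite !ffunE => /(congr1 val) /= /val_inj; exact: ainj.
apply/asboolP => i; have [n hn] := h i; exists n; rewrite !ffunE /=.
by have := hlo i; have := hhi i; lra.
Qed.

Lemma corr_countN (lo hi : 'I_k -> R) N :
  corr_count (fun n => - y n) lo hi N =
  corr_count y (fun i => - hi i) (fun i => - lo i) N.
Proof.
apply: eq_bigl => a; congr (_ && _); apply: asbool_equiv_eq.
by split=> h i; have [n hn] := h i; exists (- n); rewrite rmorphN /=; lra.
Qed.

End CorrelationMonotone.

Lemma poissonian_corrN {R : realType} (k : nat) (y : nat -> R) :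
  poissonian_corr k y -> poissonian_corr k (fun n => - y n).
Proof.
move=> h lo hi lohi; have := h (fun i => - hi i) (fun i => - lo i).
have lohi' i : - hi i < - lo i by rewrite ltrN2.
move/(_ lohi').
under [X in _ --> X -> _]eq_bigr do rewrite opprK addrC.
by under [X in _ -> X @ _ --> _]eq_fun do rewrite corr_countN.
Qed.

Lemma sqrt_floor (N : nat) : exists m : nat, (m ^ 2 <= N < m.+1 ^ 2)%N.
Proof.
elim: N => [|N [m /andP[h1 h2]]]; first by exists 0%N.
have [h|h] := ltnP N.+1 (m.+1 ^ 2); first by exists m; rewrite h (leq_trans h1).
exists m.+1; rewrite h /=; apply: (leq_ltn_trans h2).
by rewrite ltn_exp2r.
Qed.

Lemma square_ratio {R : realType} (x n : R) : 1 <= x -> x ^+ 2 <= n <= (x + 1) ^+ 2 ->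
  `|(x + 1) ^+ 2 / n - 1| <= 3 / x /\ `|x ^+ 2 / n - 1| <= 3 / x.
Proof.
move=> x1 /andP[xn nx]; have x0 : 0 < x by apply: lt_le_trans x1.
have n0 : 0 < n by apply: lt_le_trans xn; apply: exprn_gt0.
have k0 : 0 < 3 / x by rewrite divr_gt0.
have kx : 3 / x * x ^+ 2 = 3 * x by field; rewrite gt_eqF.
have kn : 3 * x <= 3 / x * n by rewrite -kx ler_pM2l.
have sq : (x + 1) ^+ 2 = x ^+ 2 + 2 * x + 1 by ring.
have dist (z : R) : z - n <= 3 * x -> n - z <= 3 * x -> `|z / n - 1| <= 3 / x.
  move=> h1 h2; have -> : z / n - 1 = (z - n) / n by rewrite mulrBl divff // gt_eqF.
  rewrite normrM normfV (gtr0_norm n0) ler_pdivrMr // ler_norml.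
  by apply/andP; split; lra.
by rewrite sq in nx *; split; apply: dist; lra.
Qed.

Lemma ratio_squeeze {R : realType} (P Q1 Q2 e k n M1 M2 Z Z1 Z2 : R) :
  0 < n -> 0 < M1 -> 0 < M2 -> 0 <= Z1 -> 0 <= Z2 -> Z2 <= Z -> Z <= Z1 ->
  `|M2 / n - 1| <= k -> `|M1 / n - 1| <= k ->
  `|Q1 - Z1 / M2| <= e / 4 -> `|Q1 - P| <= e / 4 ->
  `|Q2 - Z2 / M1| <= e / 4 -> `|Q2 - P| <= e / 4 ->
  (P + e) * k <= e / 2 -> `|P - Z / n| <= e.
Proof.
move=> n0 M10 M20 Z10 Z20 low up r1 r2 h1 q1 h2 q2 Pk.
have k0 : 0 <= k by apply: le_trans r1.
have approx (q z : R) : `|q - z| <= e / 4 -> `|q - P| <= e / 4 -> P - e / 2 <= z <= P + e / 2.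
  by rewrite !ler_norml; clear; move=> ? ?; apply/andP; split; lra.
have /andP[_ u2] := approx _ _ h1 q1; have /andP[l2 l3] := approx _ _ h2 q2.
have e0 : 0 <= e by have := le_trans (normr_ge0 _) q1; rewrite pmulr_lge0.
have z1 : 0 <= Z1 / M2 by rewrite divr_ge0 // ltW.
have z2 : 0 <= Z2 / M1 by rewrite divr_ge0 // ltW.
have u1 : Z / n <= Z1 / M2 * (M2 / n) by rewrite mulrA divfK ?gt_eqF // ler_pM2r ?invr_gt0.
have l1 : Z2 / M1 * (M1 / n) <= Z / n by rewrite mulrA divfK ?gt_eqF // ler_pM2r ?invr_gt0.
have u3 : Z1 / M2 * (M2 / n) <= (P + e / 2) * (1 + k).
  by apply: ler_pM; rewrite ?divr_ge0 ?(ltW M20) ?(ltW n0) //; move: r1; rewrite ler_distlC; case/andP; lra.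
have l4 : Z2 / M1 * (1 - k) <= Z2 / M1 * (M1 / n).
  by apply: ler_wpM2l => //; move: r2; rewrite ler_distl; case/andP.
have l5 : Z2 / M1 * k <= (P + e / 2) * k by apply: ler_wpM2r.
have ek : 0 <= e * k by apply: mulr_ge0.
move: u1 l1 l2 u3 l4 l5 ek Pk; clear; move: (Z / n) (Z1 / M2) (Z2 / M1) => z a b.
by move=> *; rewrite ler_norml; apply/andP; split; lra.
Qed.

Lemma poissonian_corr_of_squares {R : realType} (k : nat) (y : nat -> R) :
  (forall lo hi : 'I_k -> rat, (forall i, lo i < hi i) ->
    (fun m : nat => corr_count y (fun i => ratr (lo i)) (fun i => ratr (hi i)) (m.+1 ^ 2)
        / (m.+1 ^ 2)%:R) @ \oo --> \prod_i (ratr (hi i) - ratr (lo i) : R)) ->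
  poissonian_corr k.+1 y.
Proof.
move=> hsq lo hi; rewrite /= in lo hi * => lohi.
pose P := \prod_i (hi i - lo i).
have [S [S0 loS hiS _]] := window_bound lo hi.
(* A common positive lower bound for the window lengths; the reciprocal of a sum makes sense even
   when there is no window. *)
pose gap : R := (1 + \sum_i (hi i - lo i)^-1)^-1.
have inv0 i : 0 <= (hi i - lo i)^-1 by rewrite invr_ge0 subr_ge0 ltW.
have gap_den : 1 <= 1 + \sum_i (hi i - lo i)^-1 by rewrite lerDl sumr_ge0.
have gap0 : 0 < gap by rewrite invr_gt0 (lt_le_trans ltr01).
have gap_le i : gap <= hi i - lo i.
  rewrite -[leRHS]invrK lef_pV2 ?posrE ?(lt_le_trans ltr01 gap_den) ?invr_gt0 ?subr_gt0 //.
  rewrite (bigD1 i) //=; set r := \sum_(j | _) _.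
  have : 0 <= r by apply: sumr_ge0 => j _.
  lra.
apply/cvgrPdist_le => e e0.
pose C : R := 2 * S + 2; have C1 : 1 <= C by rewrite /C; lra.
pose D : R := k%:R * C ^+ k; have D0 : 0 <= D by rewrite mulr_ge0 // exprn_ge0 //; lra.
(* [gap / 4] keeps the inner windows nondegenerate, 1 keeps the factors below [C], and the last term
   keeps both products within [e / 4] of [P]. *)
pose del := Num.min (gap / 4) (Num.min 1 (e / (8 * (D + 1)))).
have D10 : 0 < 8 * (D + 1) by lra.
have del0 : 0 < del by rewrite !lt_min !divr_gt0 // ltr01.
have del_gap : del <= gap / 4 by rewrite ge_min lexx.
have del1 : del <= 1 by rewrite !ge_min lexx orbT.
have del_e : D * (2 * del) <= e / 4.
  have : del <= e / (8 * (D + 1)) by rewrite !ge_min lexx !orbT.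
  rewrite ler_pdivlMr // => h; have : D * del <= (D + 1) * del by rewrite ler_pM2r //; lra.
  lra.
have pick (a b : R) : a < b -> exists q : rat, a < ratr q < b.
  by move=> ab; have [q] := rat_in_itvoo ab; rewrite in_itv /= => hq; exists q.
have half_del : del / 2 < del by lra.
(* The rational ends are off by less than [del], but by more than [del / 2]: this leaves room for
   rescaling a window from [1 / N] to the reciprocal of a square. *)
have /choice[lo1 hlo1] : forall i, exists q : rat, lo i - del < ratr q < lo i - del / 2.
  by move=> i; apply: pick; lra.
have /choice[hi1 hhi1] : forall i, exists q : rat, hi i + del / 2 < ratr q < hi i + del.
  by move=> i; apply: pick; lra.
have /choice[lo2 hlo2] : forall i, exists q : rat, lo i + del / 2 < ratr q < lo i + del.
  by move=> i; apply: pick; lra.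
have /choice[hi2 hhi2] : forall i, exists q : rat, hi i - del < ratr q < hi i - del / 2.
  by move=> i; apply: pick; lra.
have near_prod (l h : 'I_k -> rat) :
    (forall i, `|ratr (l i) - lo i| <= del) -> (forall i, `|ratr (h i) - hi i| <= del) ->
    `|\prod_i (ratr (h i) - ratr (l i) : R) - P| <= e / 4.
  move=> hl hh; apply: le_trans del_e; apply: prodr_dist_le => // i.
  - have := hl i; have := hh i; have := loS i; have := hiS i.
    rewrite /C !ler_norml; lra.
  - have := loS i; have := hiS i; rewrite /C !ler_norml; lra.
  - have := hl i; have := hh i; rewrite !ler_norml; lra.
have P1 := near_prod lo1 hi1.
have P2 := near_prod lo2 hi2.
have {}P1 : `|\prod_i (ratr (hi1 i) - ratr (lo1 i) : R) - P| <= e / 4.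
  by apply: P1 => i; have := hlo1 i; have := hhi1 i; rewrite ler_norml; lra.
have {}P2 : `|\prod_i (ratr (hi2 i) - ratr (lo2 i) : R) - P| <= e / 4.
  by apply: P2 => i; have := hlo2 i; have := hhi2 i; rewrite ler_norml; lra.
have v1 i : lo1 i < hi1 i.
  by rewrite -(ltr_rat R); have := hlo1 i; have := hhi1 i; have := lohi i; lra.
have v2 i : lo2 i < hi2 i.
  by rewrite -(ltr_rat R); have := hlo2 i; have := hhi2 i; have := gap_le i; lra.
have e4 : 0 < e / 4 by lra.
have /cvgrPdist_le /(_ _ e4) [m1 _ hm1] := hsq lo1 hi1 v1.
have /cvgrPdist_le /(_ _ e4) [m2 _ hm2] := hsq lo2 hi2 v2.
have P0 : 0 <= P by apply: prodr_ge0 => i _; rewrite subr_ge0 ltW.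
(* A relative change of [th] moves a window end by at most [del / 2], and a quantity of size [P + e]
   by at most [e / 2]. *)
pose th := Num.min (del / (2 * S)) (e / (2 * (P + e))).
have th0 : 0 < th by rewrite lt_min !divr_gt0 // mulr_gt0 //; lra.
pose m0 := maxn (maxn m1 m2) (Num.bound (3 / th)).
exists (m0.+2 ^ 2)%N => // N /= hN.
have [m /andP[mN Nm]] := sqrt_floor N.
have m0m : (m0.+1 < m)%N.
  by rewrite -ltnS -(@ltn_exp2r _ _ 2) // (leq_ltn_trans hN).
case: m mN Nm m0m => [|m] // mN Nm m0m.
have mm0 : (m0 <= m)%N by apply: ltnW.
have m1m : (m1 <= m)%N by apply: leq_trans mm0; rewrite /m0 !leq_max leqnn.
have m2m : (m2 <= m)%N by apply: leq_trans mm0; rewrite /m0 !leq_max leqnn orbT.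
have bm : (Num.bound (3 / th) <= m.+1)%N by apply: leqW; apply: leq_trans mm0; rewrite /m0 leq_max leqnn orbT.
have [x xE] : exists x : R, x = m.+1%:R by exists m.+1%:R.
have x0 : 0 < x by rewrite xE ltr0n.
have xth : 3 / x <= th.
  rewrite ler_pdivrMr // mulrC -ler_pdivrMr //.
  by apply: (le_trans (ltW (archi_boundP _))); [rewrite divr_ge0 // ltW | rewrite xE ler_nat].
have N0 : (0 < N)%N by apply: leq_trans mN; rewrite expn_gt0.
pose n : R := N%:R; have n0 : 0 < n by rewrite ltr0n.
pose M1 : R := (m.+1 ^ 2)%:R; pose M2 : R := (m.+2 ^ 2)%:R.
have M10 : 0 < M1 by rewrite ltr0n expn_gt0.
have M20 : 0 < M2 by rewrite ltr0n expn_gt0.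
have xsq : x ^+ 2 <= n <= (x + 1) ^+ 2.
  by rewrite xE natr1 -!natrX !ler_nat mN ltnW.
have x1 : 1 <= x by rewrite xE ler1n.
have [] := square_ratio x1 xsq.
have -> : x ^+ 2 = M1 by rewrite xE -natrX.
have -> : (x + 1) ^+ 2 = M2 by rewrite xE natr1 -natrX.
move=> rho3 sg3.
have xth' : S * (3 / x) <= del / 2.
  have h : 3 / x <= del / (2 * S) by apply: (le_trans xth); rewrite ge_min lexx.
  rewrite mulrC -ler_pdivlMr //.
  by apply: (le_trans h); rewrite invfM mulrA.
have Pth : (P + e) * (3 / x) <= e / 2.
  have h : 3 / x <= e / (2 * (P + e)) by apply: (le_trans xth); rewrite ge_min lexx orbT.
  rewrite mulrC -ler_pdivlMr; last by rewrite ltr_wpDl.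
  by apply: (le_trans h); rewrite invfM mulrA.
have scale (z r : R) : `|z| <= S -> `|r - 1| <= 3 / x -> z - del / 2 <= z * r <= z + del / 2.
  move=> zS r1; rewrite -ler_distl; apply: le_trans xth'.
  rewrite -[X in _ - X]mulr1 -mulrBr normrM.
  by apply: ler_pM.
have conv (z t M : R) : 0 < M -> (z / M <= t / n) = (z <= t * (M / n)).
  by move=> M0; rewrite ler_pdivrMr // mulrAC mulrA.
have conv' (z t M : R) : 0 < M -> (t / n <= z / M) = (t * (M / n) <= z).
  by move=> M0; rewrite ler_pdivlMr // mulrAC mulrA.
have up : corr_count y lo hi N <=
    corr_count y (fun i => ratr (lo1 i)) (fun i => ratr (hi1 i)) (m.+2 ^ 2).
  apply: corr_count_le => [|i|i]; first exact: ltnW.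
    rewrite -/n -/M2 conv //; have /andP[h _] := scale _ _ (loS i) rho3.
    by apply: le_trans h; apply: ltW; case/andP: (hlo1 i).
  rewrite -/n -/M2 conv' //; have /andP[_ h] := scale _ _ (hiS i) rho3.
  by apply: (le_trans h); apply: ltW; case/andP: (hhi1 i).
have low : corr_count y (fun i => ratr (lo2 i)) (fun i => ratr (hi2 i)) (m.+1 ^ 2) <=
    corr_count y lo hi N.
  apply: corr_count_le => // i.
    rewrite -/n -/M1 conv' //; have /andP[_ h] := scale _ _ (loS i) sg3.
    by apply: (le_trans h); apply: ltW; case/andP: (hlo2 i).
  rewrite -/n -/M1 conv //; have /andP[h _] := scale _ _ (hiS i) sg3.
  by apply: le_trans h; apply: ltW; case/andP: (hhi2 i).
have h1 := hm1 m.+1 (leqW m1m); have h2 := hm2 m m2m.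
exact: (ratio_squeeze n0 M10 M20 (corr_count_ge0 _ _ _ _) (corr_count_ge0 _ _ _ _)
  low up rho3 sg3 h1 P1 h2 P2 Pth).
Qed.

(** * The random perturbation *)

Section Measurability.
Context {R : realType}.

Lemma measurable_in_arc (l : R) : measurable_fun setT (fun x : R => (in_arc x l)%:R : R).
Proof.
pose A : set R := \bigcup_n (`[n%:R, n%:R + l]%classic `|` `[- n%:R, - n%:R + l]%classic).
have mA : measurable A.
  by apply: bigcup_measurable => n _; apply: measurableU; apply: measurable_itv.
have -> : (fun x : R => (in_arc x l)%:R) = (\1_A : R -> R).
  apply/funext => x; rewrite indicE; congr (_ %:R); congr nat_of_bool.
  apply/in_arcP/idP => [[m hm]|].
    rewrite inE; exists `|m|%N => //; rewrite /= !in_itv /=.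
    case: m hm => n hn; [left|right]; rewrite ?NegzE ?absz_nat ?abszN in hn *; move: hn.
      by rewrite -pmulrn; lra.
    by rewrite rmorphN /= -pmulrn; lra.
  rewrite inE => -[n _ []]; rewrite /= in_itv /= => h.
    by exists n%:Z; rewrite -pmulrn; lra.
  by exists (- n%:Z); rewrite rmorphN /= -pmulrn; lra.
exact: measurable_indic.
Qed.

Lemma measurable_corr_ratio (w : nat -> R) (k : nat) (lo hi : 'I_k -> R) (N : nat) u :
  measurable_fun setT (fun a : R => corr_ratio (perturbed w `|a|) lo hi N u).
Proof.
rewrite (_ : (fun a : R => _) = (fun a => N%:R^-1 *
    \sum_(f <- seq.filter (fun f : {ffun 'I_k.+1 -> 'I_N} => injectiveb f) (index_enum _))
       corr_term (perturbed w `|a|) lo hi f u)); last first.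
  by apply/funext => a; rewrite corr_ratioE big_filter.
apply: measurable_funM => //; apply: measurable_sum => f.
rewrite /corr_term; apply: measurable_prod => i _.
pose z b : R := 2 * b%:R + w (trunc_log 2 b) * ((u b)%:R / (grid b)%:R).
rewrite (_ : (fun a : R => _) = (fun x : R => (in_arc x ((hi i - lo i) / N%:R))%:R : R) \o
   (fun a : R => `|a| * (z (f (lift ord0 i)).+1 - z (f ord0).+1) + hi i / N%:R)); last first.
  apply/funext => a /=; rewrite /perturbed -!/(z _).
  by congr (in_arc _ _)%:R; ring.
apply: measurableT_comp; first exact: measurable_in_arc.
apply: measurable_funD => //; apply: measurable_funM => //.
Qed.

End Measurability.

Lemma ae_perturbed_locally_uniform {R : realType} (s : R) (w : nat -> R) :
  0 < s -> (forall j, 0 < w j) ->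
  (forall e : R, 0 < e -> exists j0 : nat, forall j, (j0 <= j)%N -> w j <= e) ->
  (forall B : R, exists j0 : nat, forall j, (j0 <= j)%N -> B <= 2 ^+ j * w j) ->
  (forall B : R, exists j0 : nat, forall j, (j0 <= j)%N ->
     B * log_weight s (2 ^ j) <= 2 ^+ j * w j) ->
  {ae (@lebesgue_measure R), forall a, locally_uniform (perturbed w `|a|) grid}.
Proof.
move=> s0 w0 w_small w_grow w_weight; have := khinchin_ae s0.
apply: filterS; first exact: (ae_filter_ringOfSetsType (@lebesgue_measure R)).
move=> a [h0 ha].
have a0 : 0 < `|a|.
  rewrite normr_gt0; apply/eqP => a0; have := ha h0 0 (leqnn _).
  by rewrite a0 mulr0 subr0 normr0 mulr0 leNgt s0.
apply: perturbed_locally_uniform => //.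
have [h1 hh1] := lnln_tends (1 : R).
pose h2 := maxn h0 (maxn h1 1).
have v1 h : (h2 <= h)%N -> [/\ (h0 <= h)%N, (0 < h)%N & 1 <= ln (ln (h%:R : R))].
  rewrite !geq_max => /and3P[h0h h1h h_gt0]; split=> //.
  by apply: hh1; rewrite ler_nat.
apply: (@equidistributed_of_badly_approx R w (log_weight s) `|a| s h2) => //.
- by move=> h /v1[_ _]; apply: log_weight_gt0.
- by move=> h h' /andP[/v1[_ hp hv] hh']; apply: log_weight_le => //; [exact: ltW | rewrite hp].
- move=> h p /v1[hh _ _]; have [_|_] := ger0P a; first exact: ha.
  have := ha h (- p) hh; rewrite rmorphN /= opprK.
  by rewrite mulrN -opprD normrN.
Qed.

Section RandomPerturbation.
Context {R : realType}.
Variable w : nat -> R.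
Local Notation mu := (@lebesgue_measure R).

Let u0 : nat -> nat := fun=> 0%N.
Let grid_gt0 i : (0 < grid i)%N. Proof. by []. Qed.

(** Countably many tests: [p] codes a number of windows and their rational ends. A code with too few
    ends gets a degenerate window from the default [(0, 0)], is then not [valid], and has deviation
    0 in [D]. *)
Let par (p : nat) : nat * seq (rat * rat) := odflt (0%N, [::]) (unpickle p).
Let plo p (i : 'I_(par p).1) : R := ratr (nth (0, 0) (par p).2 i).1.
Let phi p (i : 'I_(par p).1) : R := ratr (nth (0, 0) (par p).2 i).2.
Let valid p : bool := [forall i, plo i < phi (p := p) i].
Let X p m (a : R) u : R := corr_ratio (perturbed w `|a|) (plo (p := p)) (phi (p := p)) (m.+1 ^ 2) u.
Let mean p m (a : R) : R := expect grid (iota 1 (m.+1 ^ 2)) (X p m a) u0.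
Let D p m u (a : R) : R := if valid p then (X p m a u - mean p m a) ^+ 2 else 0.

Lemma corr_ratio_bounded (Y : nat -> nat -> R) (k : nat) (lo hi : 'I_k -> R) N u : (0 < N)%N ->
  0 <= corr_ratio Y lo hi N u <= #|{ffun 'I_k.+1 -> 'I_N}|%:R.
Proof.
move=> N0; have N1 : 1 <= N%:R :> R by rewrite ler1n.
rewrite /corr_ratio corr_count_card divr_ge0 //= ler_pdivrMr ?ltr0n //.
apply: (@le_trans _ _ #|{ffun 'I_k.+1 -> 'I_N}|%:R); first by rewrite ler_nat max_card.
by rewrite ler_peMr.
Qed.

Lemma depends_on_corr_ratio (Y : nat -> nat -> R) (k : nat) (lo hi : 'I_k -> R) N :
  depends_on [pred i | (1 <= i <= N)%N] (corr_ratio Y lo hi N).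
Proof.
move=> u v uv; rewrite corr_ratioE; congr (_ * _); apply: eq_bigr => f _.
apply: (@depends_on_corr_term R Y k lo hi N f) => i /= /existsP[j /eqP ->]; apply: uv => /=.
exact: ltn_ord.
Qed.

Lemma exists_good_digits :
  {ae mu, forall a, locally_uniform (perturbed w `|a|) grid} ->
  exists u : nat -> nat, (forall i, (u i < grid i)%N) /\
    {ae mu, forall a, forall k (lo hi : 'I_k -> rat), (forall i, lo i < hi i) ->
      (fun m : nat => corr_ratio (perturbed w `|a|) (fun i => ratr (lo i)) (fun i => ratr (hi i))
         (m.+1 ^ 2) u) @ \oo --> \prod_i (ratr (hi i) - ratr (lo i) : R)}.
Proof.
move=> good.
pose B p m : R := #|{ffun 'I_(par p).1.+1 -> 'I_(m.+1 ^ 2)}|%:R.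
have N0 m : (0 < m.+1 ^ 2)%N by rewrite expn_gt0.
have XB p m a v : 0 <= X p m a v <= B p m by apply: corr_ratio_bounded.
have MB p m a : 0 <= mean p m a <= B p m by apply: expect_bounded => // v; apply: XB.
have mX p m v : measurable_fun setT (fun a => X p m a v) by apply: measurable_corr_ratio.
have mM p m : measurable_fun setT (mean p m).
  by apply: (@expect_measurable R grid _ (fun v a => X p m a v)).
have mD p m v : measurable_fun setT (D p m v).
  rewrite /D; case: (valid p) => //.
  by apply: measurable_funX; apply: measurable_funB.
have DB p m v a : 0 <= D p m v a <= B p m ^+ 2.
  rewrite /D; case: (valid p); last by rewrite lexx exprn_ge0 // /B.
  rewrite sqr_ge0 /= -[leLHS]real_normK ?num_real //.
  rewrite lerXn2r ?nnegrE /B //; have := XB p m a v; have := MB p m a.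
  by rewrite /B ler_norml; lra.
have D_dep' p m a : depends_on [pred i | (1 <= i <= m.+1 ^ 2)%N] (fun v => D p m v a).
  move=> v v' vv; rewrite /D; case: (valid p) => //; congr ((_ - _) ^+ 2).
  by apply: (@depends_on_corr_ratio (perturbed w `|a|) _ (plo (p := p)) (phi (p := p)) (m.+1 ^ 2)) => i; apply: vv.
have D_dep p m a : depends_on [pred i | (i < (m.+1 ^ 2).+1)%N] (fun v => D p m v a).
  by move=> v v' vv; apply: D_dep' => i /= /andP[_ hi]; apply: vv.
have D_var : {ae mu, forall a, forall p, exists C : R, forall m,
    expect grid (iota 0 (m.+1 ^ 2).+1) (fun v => D p m v a) u0 <= C / m.+1%:R ^+ 2}.
  move: good; apply: filterS; first exact: (ae_filter_ringOfSetsType mu).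
  move=> a LU p; have [vp|nvp] := boolP (valid p).
    have [C [_ hC]] := corr_variance grid_gt0 LU (plo (p := p)) (phi (p := p)).
    exists C => m; rewrite (expect_iota0 grid_gt0 _ (D_dep' p m a)) // -natrX.
    rewrite /D vp; exact: hC.
  exists 0 => m; rewrite mul0r /D (negbTE nvp) expect_cst //.
have [u [u_lt hu]] := derandomization grid_gt0 mD DB D_dep D_var.
exists u; split => //; move: hu good.
apply: filterS2; first exact: (ae_filter_ringOfSetsType mu).
move=> a Dto0 LU k lo hi lohi.
pose p := pickle (k, [seq (lo i, hi i) | i <- enum 'I_k]).
have pE : par p = (k, [seq (lo i, hi i) | i <- enum 'I_k]) by rewrite /par pickleK.
have loE : (fun i : 'I_k => ratr (nth (0, 0) [seq (lo i, hi i) | i <- enum 'I_k] i).1) =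
    (fun i => ratr (lo i) : R).
  by apply/funext => i; rewrite (nth_map i) ?size_enum_ord // nth_ord_enum.
have hiE : (fun i : 'I_k => ratr (nth (0, 0) [seq (lo i, hi i) | i <- enum 'I_k] i).2) =
    (fun i => ratr (hi i) : R).
  by apply/funext => i; rewrite (nth_map i) ?size_enum_ord // nth_ord_enum.
pose lo' i : R := ratr (lo i); pose hi' i : R := ratr (hi i).
have lohi' i : lo' i < hi' i by rewrite ltr_rat.
have := Dto0 p; rewrite /D /X /mean /valid /X /plo /phi pE /= loE hiE -/lo' -/hi'.
have -> : [forall i : 'I_k, ratr (nth (0, 0) [seq (lo i, hi i) | i <- enum 'I_k] i).1
    < (ratr (nth (0, 0) [seq (lo i, hi i) | i <- enum 'I_k] i).2 : R)] = true.
  apply/forallP => i; have := lohi' i; rewrite /lo' /hi'.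
  by rewrite -(congr1 (fun f => f i) loE) -(congr1 (fun f => f i) hiE).
move=> /cvgrPdist_le Dto; apply/cvgrPdist_le => e e0.
have e2 : 0 < e / 2 by lra.
have [N1 hN1] := corr_mean grid_gt0 LU lohi' e2.
have [M _ hM] := Dto _ (exprn_gt0 2 e2).
exists (maxn M N1) => // m /=; rewrite geq_max => /andP[Mm Nm].
have := hM m Mm; rewrite /= sub0r normrN normrX ler_pXn2r ?nnegrE ?(ltW e2) // => h1.
have Nm2 : (N1 <= m.+1 ^ 2)%N by apply: (leq_trans Nm); rewrite -mulnn mulSn; apply: leq_trans (leqnSn m) (leq_addr _ _).
have h2 := hN1 _ u0 Nm2.
apply: (le_trans (ler_distD (expect grid (iota 1 (m.+1 ^ 2)) (corr_ratio (perturbed w `|a|) lo' hi' (m.+1 ^ 2)) u0) _ _)).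
by rewrite [e]splitr; apply: lerD; rewrite distrC.
Qed.

End RandomPerturbation.

(* The quadruples [A + i + t, A + k, A + i, A + k + t] in a dyadic block starting at [A]. *)
Lemma perturbed_energy {R : realType} (w : nat -> R) (gamma : nat -> R) (xi : nat -> R) (j0 : nat) :
  (forall n, 0 <= xi n <= w (trunc_log 2 n)) ->
  (forall j N, (j0 <= j)%N -> (2 ^ j.+1 <= N < 2 ^ j.+2)%N -> 2 * w j < gamma N) ->
  exists C : R, 0 < C /\ exists N0 : nat, forall N : nat, (N0 <= N)%N ->
    C * N%:R ^+ 3 <= (add_energy (fun n => 2 * n%:R + xi n) N (gamma N))%:R.
Proof.
(* With [m = 2 ^ j] and [N < 8 * m], the [m ^ 3] quadruples number at least [(N / 8) ^ 3]. *)
move=> xiw hw; exists (8^-1 ^+ 3); split; first by rewrite exprn_gt0 // invr_gt0.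
exists (2 ^ j0.+2)%N => N hN.
have N0 : (0 < N)%N by apply: leq_trans hN; rewrite expn_gt0.
have [j [jj0 N1 N2]] : exists j, [/\ (j0 <= j)%N, (2 ^ j.+2 <= N)%N & (N < 2 ^ j.+3)%N].
  have h1 := trunc_log_max (isT : (1 < 2)%N) hN.
  exists (trunc_log 2 N).-2; split; first by lia.
    by rewrite (_ : (_.-2).+2 = trunc_log 2 N) ?trunc_logP //; lia.
  by rewrite (_ : (_.-2).+3 = (trunc_log 2 N).+1) ?trunc_log_ltn //; lia.
pose m := (2 ^ j)%N; have m0 : (0 < m)%N by rewrite expn_gt0.
have A2 : (2 ^ j.+1 = 2 * m)%N by rewrite expnS.
have A4 : (2 ^ j.+2 = 4 * m)%N by rewrite !expnS mulnA.
have A8 : (2 ^ j.+3 = 8 * m)%N by rewrite !expnS !mulnA.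
have logA n : (n < 2 * m)%N -> trunc_log 2 (2 ^ j.+1 + n) = j.+1.
  move=> nm; apply: trunc_log_eq => //; rewrite leq_addr /= A4 A2; lia.
have en : (m ^ 3 <= add_energy (fun n => (2 * n%:R + xi n)%R) N (gamma N))%N.
  apply: (@add_energy_ge R _ N m (2 ^ j.+1)) => //; first by rewrite A2; lia.
    by rewrite A2; lia.
  move=> i k t im km tm.
  have lt2 n : (n < m)%N -> (n < 2 * m)%N by lia.
  have b1 := xiw (2 ^ j.+1 + (i + t))%N; have b2 := xiw (2 ^ j.+1 + k)%N.
  have b3 := xiw (2 ^ j.+1 + i)%N; have b4 := xiw (2 ^ j.+1 + (k + t))%N.
  rewrite !logA in b1 b2 b3 b4; [|lia..].
  have := hw j.+1 N (leqW jj0); rewrite N1 N2 => /(_ isT) hg.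
  (* Two perturbations enter with each sign and all four lie in [[0, w j.+1]], so the sum is at most
     [2 * w j.+1] in absolute value. *)
  apply: le_lt_trans hg; rewrite !natrD ler_norml; apply/andP; split; lra.
apply: (@le_trans _ _ (m ^ 3)%:R); last by rewrite ler_nat.
rewrite natrX -exprMn lerXn2r ?nnegrE ?mulr_ge0 ?invr_ge0 //.
by rewrite mulrC ler_pdivrMr // -natrM ler_nat mulnC -A8 ltnW.
Qed.

Theorem theorem4 (R : realType) (c : R) (hc : 0 < c) :
  exists x : nat -> R,
    (forall n, (1 <= n)%N -> x n < x n.+1) /\
    (forall n, (1 <= n)%N -> 1 <= x n.+1 - x n) /\
    (exists C : R, 0 < C /\ exists N0 : nat, forall N : nat, (N0 <= N)%N ->
        C * (N%:R) ^+ 3 <= (add_energy x N (gammaN c N))%:R) /\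
    {ae (@lebesgue_measure R), forall alpha : R,
        forall k : nat, (2 <= k)%N -> poissonian_corr k (fun n => alpha * x n)}.
Proof.
pose s := c / 3; have s0 : 0 < s by rewrite divr_gt0.
have cs : c = 3 * s by rewrite /s; field.
have [w [w01 w_small w_grow w_weight [j0 w_gamma]]] := width_exists s0.
have w0 j : 0 < w j by case/andP: (w01 j).
have LU := ae_perturbed_locally_uniform s0 w0 w_small w_grow w_weight.
have [u [u_lt hu]] := exists_good_digits LU.
pose xi n : R := w (trunc_log 2 n) * ((u n)%:R / (grid n)%:R).
have xiP n : 0 <= xi n <= w (trunc_log 2 n).
  have g0 : 0 < (grid n)%:R :> R by rewrite ltr0n.
  rewrite mulr_ge0 ?divr_ge0 ?(ltW (w0 _)) //= ler_piMr ?(ltW (w0 _)) //.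
  by rewrite ler_pdivrMr // mul1r ler_nat ltnW.
have xi1 n : 0 <= xi n <= 1.
  by have := xiP n; have := w01 (trunc_log 2 n); lra.
(* The factor 2 leaves a gap of at least 1 whatever the perturbations in [[0, 1]] are. *)
pose x n : R := 2 * n%:R + xi n.
have gap n : 1 <= x n.+1 - x n.
  by have := xi1 n; have := xi1 n.+1; rewrite /x -natr1; lra.
exists x; split; [|split; [|split]].
- by move=> n _; have := gap n; lra.
- by move=> n _; apply: gap.
- by rewrite cs; apply: (perturbed_energy xiP w_gamma).
move: hu; apply: filterS; first exact: (ae_filter_ringOfSetsType (@lebesgue_measure R)).
move=> a ha [//|k] _.
have pos : poissonian_corr k.+1 (fun n => `|a| * x n).
  by apply: poissonian_corr_of_squares => lo hi lohi; exact: ha.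
have [a0|a0] := ger0P a; first by move: pos; rewrite ger0_norm.
have -> : (fun n => a * x n) = (fun n => - (`|a| * x n)).
  by apply/funext => n; rewrite ltr0_norm // mulNr opprK.
exact: poissonian_corrN.
Qed.
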